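(* Let $I=[0,1]$, $1<\alpha\le2$ and $\lambda>\lambda_1^*$. Let $f:I\times[0,\infty)\to[0,\infty)$ be continuous, and suppose there exists a constant $K>0$ such that $|f(t,u)-f(t,v)|\le K|u-v|$ for each $t\in I$ and all $u,v\in[0,\infty)$. Then the problem $$D^{\alpha}u(t)-\lambda u(t)+f(t,t^{2-\alpha}u(t))=0,\quad t\in I,\qquad \lim_{t\to0^+}t^{2-\alpha}u(t)=u'(1)=0,$$ has a unique solution in $P_{u_0}$ provided that $$\frac{K\,M}{\alpha(\alpha-1)}<1.$$
   Context: $E_{\alpha,\beta}(x)=\sum_{k=0}^\infty \frac{x^k}{\Gamma(\alpha k+\beta)}$ is the Mittag-Leffler function, and $\lambda_1^*=\lambda_1^*(\alpha)$ is the largest negative zero of $\lambda\mapsto E_{\alpha,\alpha-1}(\lambda)$. $D^\alpha$ is the Riemann-Liouville fractional derivative with base point $0$: $D^\alpha f(t)=\frac{1}{\Gamma(n-\alpha)}\frac{d^n}{dt^n}\int_0^t (t-s)^{n-\alpha-1}f(s)\,ds$, $n=[\alpha]+1$. A solution is a function $u$ with $t^{2-\alpha}u(t)\in C^1(I)$ (possibly singular at $t=0$, the value of $t^{2-\alpha}u(t)$ at $0$ being its limit) satisfying the equation for $t>0$ and the boundary conditions. $C_{2-\alpha}(I)$ is the Banach space of functions $u$ with $t^{2-\alpha}u(t)\in C(I)$, normed by $\|u\|_{2-\alpha}=\max_{t\in I}t^{2-\alpha}|u(t)|$. Let $$G(t,s)=\begin{cases}\dfrac{t^{\alpha-1}E_{\alpha,\alpha}(\lambda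 t^\alpha)\,E_{\alpha,\alpha-1}(\lambda(1-s)^\alpha)}{(1-s)^{2-\alpha}E_{\alpha,\alpha-1}(\lambda)}-(t-s)^{\alpha-1}E_{\alpha,\alpha}(\lambda(t-s)^\alpha), & 0\le s\le t\le 1,\ s<1,\\[3mm] \dfrac{t^{\alpha-1}E_{\alpha,\alpha}(\lambda t^\alpha)\,E_{\alpha,\alpha-1}(\lambda(1-s)^\alpha)}{(1-s)^{2-\alpha}E_{\alpha,\alpha-1}(\lambda)}, & 0\le t<s<1.\end{cases}$$ Fix a constant $M>0$ and a continuous function $m:I\to[0,\infty)$ with $m(0)=0$, $m>0$ on $(0,1]$, such that $m(t)\le \frac{t^{2-\alpha}G(t,s)}{s(1-s)^{\alpha-2}}\le M$ for all $t,s\in(0,1)$ (such $m,M$ exist). Put $u_0(t)=t^{\alpha-2}\frac{m(t)}{M}$ and $P_{u_0}=\{u\in C_{2-\alpha}(I): u(t)\ge u_0(t)\|u\|_{2-\alpha},\ t\in I\}$, the inequality being equivalent to $t^{2-\alpha}u(t)\ge\frac{m(t)}{M}\|u\|_{2-\alpha}$. *)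

(* Defs.v *)
(* MathComp-Analysis, over an arbitrary R : realType. *)
From HB Require Import structures.
From mathcomp Require Import all_boot all_order all_algebra.
From mathcomp Require Import all_classical all_reals all_analysis.

Set Implicit Arguments.
Unset Strict Implicit.
Unset Printing Implicit Defensive.

Import Order.TTheory GRing.Theory Num.Theory.
Import numFieldNormedType.Exports.

Local Open Scope classical_set_scope.
Local Open Scope ring_scope.

Section FractionalProblem.
Context {R : realType}.
Implicit Types (alpha beta lambda x t s : R) (u v g : R -> R) (D : set R).

(* Euler's integral; meaningful for x > 0, the only case used below. *)
Definition Gamma x : R :=
  \int[lebesgue_measure]_(t in `]0, +oo[) (t `^ (x - 1) * expR (- t)).

Definition mittag_leffler alpha beta x : R :=
  limn (series (fun k : nat => x ^+ k / Gamma (alpha * k%:R + beta))).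

Definition largest_negative_zero (F : R -> R) x : Prop :=
  [/\ x < 0, F x = 0 & forall y, y < 0 -> F y = 0 -> y <= x].

(* Derivative of g relative to D: the usual one at interior points of D,
   one-sided at the endpoints of an interval D. *)
Definition is_derive_within D g x (l : R) : Prop :=
  (g y - g x) / (y - x) @[y --> within D x^'] --> l.

(* h is the n-th derivative of g on D. *)
Fixpoint is_derive_n_within D (n : nat) g (h : R -> R) : Prop :=
  if n is k.+1 then
    exists2 g1 : R -> R, (forall x, D x -> is_derive_within D g x (g1 x))
                       & is_derive_n_within D k g1 h
  else forall x, D x -> h x = g x.

Definition C1_on D g : Prop :=
  exists2 g1 : R -> R, (forall x, D x -> is_derive_within D g x (g1 x))
                     & {within D, continuous g1}.

(* For alpha >= 0: u has the Riemann-Liouville derivative Du of order alpha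
   (base point 0) everywhere on ]0, 1].  At t = 1 the derivatives are
   left-sided. *)
Definition is_RL_derive alpha u (Du : R -> R) : Prop :=
  let n := (Num.truncn alpha).+1 in
  exists2 h : R -> R,
    is_derive_n_within `]0, 1] n
      (fun t => \int[lebesgue_measure]_(s in `]0, t[)
                  ((t - s) `^ (n%:R - alpha - 1) * u s)) h
    & forall t, t \in `]0, 1] -> Du t = (Gamma (n%:R - alpha))^-1 * h t.

(* t^(2-alpha) u(t), with its limit as value at t = 0: u may be singular at 0
   and the number u 0 is irrelevant. *)
Definition weighted alpha u t : R :=
  if t == 0 then lim (s `^ (2 - alpha) * u s @[s --> 0^'+])
  else t `^ (2 - alpha) * u t.

(* The space C_{2-alpha}([0, 1]); continuity at 0 forces the limit in
   [weighted] to exist. *)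
Definition weighted_continuous alpha u : Prop :=
  {within `[0, 1], continuous (weighted alpha u)}.

Definition weighted_norm alpha u : R :=
  sup [set `|weighted alpha u t| | t in `[0, 1]].

Definition green alpha lambda t s : R :=
  let E := mittag_leffler alpha in
  let A := t `^ (alpha - 1) * E alpha (lambda * t `^ alpha)
             * E (alpha - 1) (lambda * (1 - s) `^ alpha)
           / ((1 - s) `^ (2 - alpha) * E (alpha - 1) lambda) in
  if s <= t then
    A - (t - s) `^ (alpha - 1) * E alpha (lambda * (t - s) `^ alpha)
  else A.

(* The cone P_{u0}.  For u0 = t^(alpha-2) m(t)/M with m 0 = 0, the weighted form
   of the inequality at t = 0 reads 0 <= weighted alpha u 0, which follows from
   the case t > 0 by passing to the limit. *)
Definition cone alpha (u0 u : R -> R) : Prop :=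
  weighted_continuous alpha u /\
  forall t, t \in `]0, 1] -> u0 t * weighted_norm alpha u <= u t.

Definition is_solution alpha lambda (f : R -> R -> R) u : Prop :=
  [/\ C1_on `[0, 1] (weighted alpha u),
      exists2 Du : R -> R, is_RL_derive alpha u Du
        & forall t, t \in `]0, 1] ->
            Du t - lambda * u t + f t (t `^ (2 - alpha) * u t) = 0,
      t `^ (2 - alpha) * u t @[t --> 0^'+] --> (0 : R)
    & is_derive_within `]0, 1] u 1 0].

End FractionalProblem.

(* Main.v *)
(* On functions that are O(t^(a-1)) on ]0, 1], the Riemann-Liouville integral of
   order b is convolution with t^(b-1)/Gamma(b).  Convolution being commutative and
   associative, u solves D^alpha u = lambda u - F iff
   u = c t^(alpha-1)/Gamma(alpha) + I^alpha (lambda u - F), and the resolvent identity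
   for E(t) = t^(alpha-1) E_{alpha,alpha}(lambda t^alpha) turns this into
   u = c E - E * F.  The condition u'(1) = 0 fixes c because
   E_{alpha,alpha-1}(lambda) <> 0, and the result is u(t) = \int G(t, s) F(s) ds.
   The upper bound on G and \int_0^1 s (1-s)^(alpha-2) ds = 1/(alpha (alpha-1)) make
   w |-> t^(2-alpha) \int G(t, s) f(s, w(s)) ds a contraction of ratio
   K M/(alpha (alpha-1)) for the uniform norm; the lower bound puts its fixed point
   in the cone.  Elements of the cone are nonnegative, so every solution there is a
   fixed point. *)
Require Import Defs.
From HB Require Import structures.
From mathcomp Require Import all_boot all_order all_algebra.
From mathcomp Require Import all_classical all_reals all_analysis.
From mathcomp Require Import measurable_realfun.
From mathcomp Require Import ring lra.

Set Implicit Arguments.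
Unset Strict Implicit.
Unset Printing Implicit Defensive.

Import Order.TTheory GRing.Theory Num.Theory.
Import numFieldNormedType.Exports.

Local Open Scope classical_set_scope.
Local Open Scope ring_scope.

(** * Convolution, Gamma and Beta functions *)

Section AffineSubstitution.
Context {R : realType}.
Notation mu := (@lebesgue_measure R).
Implicit Types (c d : R).

(** The kernels are powers $t^{a-1}$, singular at 0 when $a<1$, so each interchange of integrals
    needs absolute convergence. The class [tame a] (measurable, supported in $]0,1]$, $O(t^{a-1})$)
    settles this once: orders add under convolution, and identities between operators become ring
    computations. Convolutions are differentiated only when one factor is [gpow] of integer order,
    which makes them iterated primitives; no derivative is moved under a singular integral. The
    order $n=[\alpha]+1$ is 2 for $\alpha<2$ but 3 for $\alpha=2$, hence an inversion for arbitrary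
    $n$. The condition at 0 enters through growth: $t^{2-\alpha}u$ is $C^1$ and vanishes at 0, so
    $u=O(t^{\alpha-1})$, which rules out the homogeneous solution $t^{\alpha-2}$. Conversely, that
    $t^{2-\alpha}(cE-E*F)$ is $C^1$ up to 0 needs expansions of the solution and of its derivative,
    since the product rule is singular there. The bounds on $G$ are given on the open square only
    and reach $t=1$ by continuity. *)

Definition affine c d (x : R) : R := c * x + d.

Lemma measurable_affine c d :
  @measurable_fun _ _ (measurableTypeR R) (measurableTypeR R) setT (affine c d).
Proof.
by apply: measurable_funD => //; apply: measurable_funM.
Qed.

(** The factor $|c|$ undoes the scaling of preimages, so this is Lebesgue measure again and the
    change of variables becomes the push-forward formula. *)
Definition affine_measure c d : {measure set (measurableTypeR R) -> \bar R} :=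
  mscale (NngNum (normr_ge0 c))
    (measure_function_pushforward__canonical__measure_function_Measure mu
       (measurable_affine c d)).

(** Uniqueness of Lebesgue measure reduces this to intervals $]a,b]$; for $c<0$ the preimage is
    closed on the other side. *)
Lemma affine_measureE c d (A : set R) : c != 0 -> measurable A ->
  affine_measure c d A = mu A.
Proof.
move=> c0 mA; apply/esym; apply: (@lebesgue_measure_unique R (affine_measure c d)) => //.
move=> X [[a b] _ <-] /=.
rewrite /affine_measure /mscale /= /pushforward lebesgue_measure_itv /=.
have cb : affine c d @^-1` `]a, b] = if 0 < c then `](a - d) / c, (b - d) / c]%classic
   else `[(b - d) / c, (a - d) / c[%classic.
  apply/seteqP; split => x /=; rewrite /affine /=; case: ltP => cs /=; rewrite !in_itv/=.
  - by rewrite ltr_pdivrMr // ler_pdivlMr // mulrC ltrBlDr lerBrDr.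
  - have {}cs : c < 0 by rewrite lt_neqAle c0.
    by rewrite ltr_ndivlMr // ler_ndivrMr // mulrC ltrBlDr lerBrDr andbC.
  - by rewrite ltr_pdivrMr // ler_pdivlMr // mulrC ltrBlDr lerBrDr.
  - have {}cs : c < 0 by rewrite lt_neqAle c0.
    by rewrite ltr_ndivlMr // ler_ndivrMr // mulrC ltrBlDr lerBrDr andbC.
rewrite cb {cb}; case: (ltP 0 c) => cs /=.
  rewrite lebesgue_measure_itv /= !lte_fin ltr_pM2r ?invr_gt0// ltrD2r.
  case: ifP => ab; last by rewrite mule0.
  rewrite (gtr0_norm cs) -!EFinB -EFinM; congr EFin; field.
  by rewrite gt_eqF.
have {}cs : c < 0 by rewrite lt_neqAle c0.
rewrite lebesgue_measure_itv /= !lte_fin ltr_nM2r ?invr_lt0// ltrD2r.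
case: ifP => ab; last by rewrite mule0.
rewrite (ltr0_norm cs) -!EFinB -EFinM; congr EFin; field.
by rewrite lt_eqF.
Qed.

Lemma ge0_integral_affine c d (f : R -> \bar R) : c != 0 ->
  measurable_fun setT f -> (forall x, (0 <= f x)%E) ->
  (\int[mu]_x f x = `|c|%:E * \int[mu]_x f (affine c d x))%E.
Proof.
move=> c0 mf f0.
rewrite (eq_measure_integral (affine_measure c d)); last first.
  by move=> A mA _; rewrite affine_measureE.
rewrite ge0_integral_mscale//=.
by congr (_ * _)%E; rewrite (ge0_integral_pushforward (measurable_affine c d)) ?preimage_setT//.
Qed.

(** Signed integrands only undergo shifts and reflections. With $|c|=1$ no factor has to be
    distributed over the difference of the two parts, so integrability is not assumed. *)
Lemma integral_affine_unit c d (f : R -> \bar R) : `|c| = 1 ->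
  measurable_fun setT f -> (\int[mu]_x f x = \int[mu]_x f (affine c d x))%E.
Proof.
move=> c1 mf; have c0 : c != 0 by rewrite -normr_eq0 c1 oner_eq0.
have mfa : measurable_fun setT (fun x => f (affine c d x)).
  have maff : measurable_fun setT (affine c d) := measurable_affine c d.
  exact: measurableT_comp mf maff.
rewrite integralE [RHS]integralE.
rewrite (ge0_integral_affine d c0 (measurable_funepos mf)) //.
rewrite (ge0_integral_affine d c0 (measurable_funeneg mf)) //.
rewrite c1 !mul1e; congr (_ - _)%E; apply: eq_integral => x _; by rewrite ?funeposE ?funenegE.
Qed.

End AffineSubstitution.

(** * Convolution of nonnegative extended-real functions *)

Section Convolution.
Context {R : realType}.
Notation mu := (@lebesgue_measure R).
Local Open Scope ereal_scope.
Implicit Types (g h k : R -> \bar R) (t : R).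

Definition econv g h t : \bar R := \int[mu]_s (g (t - s)%R * h s).

Lemma measurable_sub_fst_snd : measurable_fun setT (fun z : R * R => (z.1 - z.2)%R).
Proof. by apply: measurable_funB. Qed.

Lemma measurable_econv_integrand g h :
  measurable_fun setT g -> measurable_fun setT h ->
  measurable_fun setT (fun z : R * R => g (z.1 - z.2)%R * h z.2).
Proof.
move=> mg mh; apply: emeasurable_funM; apply: measurableT_comp => //.
exact: measurable_sub_fst_snd.
Qed.

Lemma econv_ge0 g h t : (forall x, 0 <= g x) -> (forall x, 0 <= h x) ->
  0 <= econv g h t.
Proof. by move=> g0 h0; apply: integral_ge0 => s _; rewrite mule_ge0. Qed.

(** Tonelli, then translation invariance of the inner integral. This yields both the relation
    between Beta and Gamma and the joint integrability behind [measurable_rconv]. *)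
Lemma integral_econv g h :
  measurable_fun setT g -> measurable_fun setT h ->
  (forall x, 0 <= g x) -> (forall x, 0 <= h x) ->
  \int[mu]_t econv g h t = (\int[mu]_x g x) * \int[mu]_x h x.
Proof.
move=> mg mh g0 h0; rewrite /econv.
rewrite (@fubini_tonelli _ _ _ _ R mu mu (fun z : R * R => g (z.1 - z.2)%R * h z.2)); first last.
- by move=> z; rewrite mule_ge0.
- exact: measurable_econv_integrand.
rewrite /= -ge0_integralZl//; last exact: integral_ge0.
apply: eq_integral => s _.
rewrite ge0_integralZr//.
- congr (_ * _); rewrite [RHS](@integral_affine_unit _ 1 (- s)%R) ?normr1//.
  by apply: eq_integral => x _; rewrite /affine mul1r.
- apply: measurableT_comp => //; exact: measurable_funB.
Qed.

End Convolution.

(** * Truncated powers, and the relation between Beta and Gamma *)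

Section GammaFunction.
Context {R : realType}.
Notation mu := (@lebesgue_measure R).
Implicit Types (a b t x : R).

(** The truncated power $x_+^{a-1}$, indexed so that orders add under convolution. *)
Definition tpow a x : R := if 0 < x then x `^ (a - 1) else 0.

Lemma tpow_ge0 a x : 0 <= tpow a x.
Proof. by rewrite /tpow; case: ifP => // _; exact: powR_ge0. Qed.

Lemma measurable_tpow a : measurable_fun setT (tpow a).
Proof.
by apply: measurable_fun_ifT => //; exact: measurable_fun_ltr.
Qed.

Lemma tpowM a t x : 0 < t -> tpow a (t * x) = t `^ (a - 1) * tpow a x.
Proof.
move=> t0; rewrite /tpow pmulr_rgt0//; case: ifP => x0; last by rewrite mulr0.
by rewrite powRM // ltW.
Qed.

Definition ebeta a b : \bar R := econv (EFin \o tpow a) (EFin \o tpow b) 1.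
Definition egamma a : \bar R := (\int[mu]_x (tpow a x * expR (- x))%:E)%E.

Lemma GammaE a : Gamma a = fine (egamma a).
Proof.
rewrite /Gamma /Rintegral integral_mkcond; congr fine.
apply: eq_integral => x _; rewrite patchE /tpow.
rewrite [in LHS]mem_setE in_itv/= andbT; case: ifP => //.
by rewrite mul0r.
Qed.

Lemma ebeta_ge0 a b : (0 <= ebeta a b)%E.
Proof. by apply: econv_ge0 => x; rewrite lee_fin tpow_ge0. Qed.

Lemma measurable_Etpow a : measurable_fun setT (EFin \o tpow a).
Proof. by apply/measurable_EFinP; exact: measurable_tpow. Qed.

(** Homogeneity: for $t>0$ the substitution of $ts$ for $s$ extracts the power of $t$ and leaves the
    integral at 1, finite or not. *)
Lemma econv_tpow a b t :
  econv (EFin \o tpow a) (EFin \o tpow b) t = ((tpow (a + b) t)%:E * ebeta a b)%E.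
Proof.
case: (ltP 0 t) => t0; last first.
  rewrite /tpow ltNge t0 /= mul0e; apply: integral0_eq => s _ /=.
  rewrite -EFinM /tpow; case: ifP => [ts|_]; last by rewrite mul0r.
  case: ifP => [s0|_]; last by rewrite mulr0.
  exfalso; lra.
have m1 x : measurable_fun setT
    (fun s : R => ((EFin \o tpow a) (x - s)%R * (EFin \o tpow b) s)%E).
  apply: emeasurable_funM; last exact: measurable_Etpow.
  apply: measurableT_comp; [exact: measurable_Etpow|exact: measurable_funB].
have nn x s : (0 <= (EFin \o tpow a) (x - s)%R * (EFin \o tpow b) s)%E.
  by rewrite -EFinM lee_fin mulr_ge0 ?tpow_ge0.
have t_neq0 : t != 0 by rewrite gt_eqF.
have tE : tpow (a + b) t = t * (t `^ (a - 1) * t `^ (b - 1)).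
  rewrite /tpow t0 -powRD; last by rewrite t_neq0 implybT.
  by rewrite -{2}(powRr1 (ltW t0)) -powRD ?t_neq0 ?implybT//; congr powR; ring.
rewrite /econv (ge0_integral_affine 0 t_neq0 (m1 t) (nn t)) tE (gtr0_norm t0).
rewrite EFinM -muleA; congr mule.
rewrite -(ge0_integralZl mu measurableT (m1 1) (fun s _ => nn 1 s)); last first.
  by rewrite lee_fin mulr_ge0 // powR_ge0.
apply: eq_integral => s _ /=.
rewrite /affine addr0 (_ : t - t * s = t * (1 - s)); last ring.
by rewrite !tpowM// -!EFinM; congr EFin; ring.
Qed.

(** Convolve $x^{a-1}e^{-x}$ with $x^{b-1}e^{-x}$: the exponentials combine to $e^{-t}$, which
    leaves the convolution of two powers. Integrating in $t$ gives both sides. *)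
Lemma egammaM a b : (egamma a * egamma b = egamma (a + b) * ebeta a b)%E.
Proof.
pose h a x : \bar R := (tpow a x * expR (- x))%:E.
have mh c : measurable_fun setT (h c).
  apply/measurable_EFinP/measurable_funM; first exact: measurable_tpow.
  by apply: measurableT_comp => //; exact: measurable_expR.
have h0 c x : (0 <= h c x)%E by rewrite lee_fin mulr_ge0 ?tpow_ge0 ?expR_ge0.
rewrite -(integral_econv (mh a) (mh b))//.
rewrite /egamma -(ge0_integralZr mu measurableT (mh (a + b)) (fun x _ => h0 _ x) (ebeta_ge0 a b)).
apply: eq_integral => t _.
have -> : h (a + b) t = ((tpow (a + b) t)%:E * (expR (- t))%:E)%E by rewrite -EFinM.
rewrite muleAC -econv_tpow /econv muleC.
have m1 : measurable_fun setT
    (fun s : R => ((EFin \o tpow a) (t - s)%R * (EFin \o tpow b) s)%E).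
  apply: emeasurable_funM; last exact: measurable_Etpow.
  apply: measurableT_comp; [exact: measurable_Etpow|exact: measurable_funB].
have nn s : (0 <= (EFin \o tpow a) (t - s)%R * (EFin \o tpow b) s)%E.
  by rewrite -EFinM lee_fin mulr_ge0 ?tpow_ge0.
rewrite -(ge0_integralZl mu measurableT m1 (fun s _ => nn s)); last first.
  by rewrite lee_fin expR_ge0.
apply: eq_integral => s _; rewrite /h -!EFinM /=; congr EFin.
have -> : expR (- t) = expR (- (t - s)) * expR (- s).
  by rewrite -expRD; congr expR; ring.
by ring.
Qed.

End GammaFunction.

(** * Finiteness, positivity and functional equation of Gamma *)

Section GammaValues.
Context {R : realType}.
Notation mu := (@lebesgue_measure R).
Implicit Types (a b t x : R).

(** For $a<1$ the integrand is unbounded at 0, so the fundamental theorem is applied away from 0 and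
    monotone convergence concludes. *)
Lemma integral_powR a : 0 < a ->
  (\int[mu]_(x in `]0%R, 1%R]) (x `^ (a - 1))%:E = (a^-1)%:E)%E.
Proof.
move=> a0.
(* With $n+2$ the left endpoint is strictly below 1, as the fundamental theorem requires. *)
pose F (n : nat) : set R := `[n.+2%:R^-1, 1]%classic.
have -> : `]0%R, 1%R]%classic = \bigcup_n F n.
  apply/seteqP; split => x /=; last first.
    move=> [n _]; rewrite /F /= !in_itv/= => /andP[nx ->].
    by rewrite (lt_le_trans _ nx)// invr_gt0.
  rewrite in_itv/= => /andP[x0 x1].
  have [n _ /(_ n (leqnn n))] : \forall n \near \oo, n.+2%:R^-1 < x :> R.
    have /cvgrPdist_lt/(_ x x0) [n _ nP] := @cvg_harmonic R.
    exists n => // m nm; have := nP m.+1 (leqW nm).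
    rewrite /harmonic /= sub0r normrN gtr0_norm ?invr_gt0//.
  by move=> nx; exists n => //; rewrite /F /= in_itv/= (ltW nx).
have ndF : nondecreasing_seq F.
  move=> m n mn; apply/subsetPset => x; rewrite /F /= !in_itv/= => /andP[h ->].
  by rewrite andbT (le_trans _ h)// lef_pV2 ?posrE// ler_nat !ltnS.
have mF n : measurable (F n) by exact: measurable_itv.
have f0 (x : R) : (0 <= (x `^ (a - 1))%:E)%E by rewrite lee_fin powR_ge0.
have mf n : measurable_fun (F n) (fun x : R => (x `^ (a - 1))%:E).
  apply/measurable_funTS/measurable_EFinP; exact: measurable_powR.
have := ge0_nondecreasing_set_cvg_integral (mu := mu) ndF mF mf (fun _ x _ => f0 x).
have FE n : (\int[mu]_(x in F n) (x `^ (a - 1))%:E =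
   (a^-1 * (1 - n.+2%:R^-1 `^ a))%:E)%E.
  have n0 : 0 < n.+2%:R^-1 :> R by rewrite invr_gt0.
  have n1 : n.+2%:R^-1 < 1 :> R by rewrite invf_lt1// ltr1n.
  have dF (x : R) : 0 < x -> is_derive x 1 (fun y => a^-1 * y `^ a) (x `^ (a - 1)).
    move=> x0; have := is_derive1_powR a x0 => dx.
    rewrite (_ : x `^ (a - 1) = a^-1 *: (a * x `^ (a - 1))); last first.
      by rewrite /GRing.scale /= mulrA mulVf ?mul1r// gt_eqF.
    exact: is_deriveZ.
  have cF (x : R) : 0 < x -> {for x, continuous (fun y => a^-1 * y `^ a)}.
    move=> x0; apply: differentiable_continuous; apply/derivable1_diffP.
    by have [] := dF x x0.
  rewrite (@continuous_FTC2 _ _ (fun y => a^-1 * y `^ a)) //.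
  - by rewrite -EFinB powR1; congr EFin; ring.
  - apply: derivable_within_continuous => x; rewrite in_itv/= => /andP[nx _].
    apply: derivable_powR; rewrite in_itv/= andbT; exact: lt_le_trans nx.
  - split.
    + move=> x; rewrite in_itv/= => /andP[nx _].
      by have [] := dF x (lt_trans n0 nx).
    + by apply: cvg_at_right_filter; exact: cF.
    + by apply: cvg_at_left_filter; exact: cF.
  - move=> x; rewrite in_itv/= => /andP[nx _].
    by rewrite derive1E; have [_ ->] := dF x (lt_trans n0 nx).
under eq_fun do rewrite FE.
move=> /cvg_lim <- //; apply/cvg_lim => //.
apply: cvg_EFin; first exact: nearW.
rewrite -[X in _ --> X]mulr1; apply: cvgM => /=; first exact: cvg_cst.
rewrite -[X in _ --> X]subr0; apply: cvgB; first exact: cvg_cst.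
apply: ((cvg_at_rightP _ _ _).1 (powR_cvg0 a0)); split.
  by move=> n; rewrite invr_gt0.
by rewrite (cvg_shiftS (@harmonic R)); exact: cvg_harmonic.
Qed.

Lemma ebeta1l a : 0 < a -> (ebeta 1 a = (a^-1)%:E)%E.
Proof.
move=> a0; rewrite -(integral_powR a0) integral_mkcond /ebeta /econv.
rewrite (@ge0_ae_eq_integral _ _ _ mu setT _
   ((fun x => (x `^ (a - 1))%:E) \_ `]0%R, 1%R])) //.
- apply: emeasurable_funM; last exact: measurable_Etpow.
  apply: measurableT_comp; [exact: measurable_Etpow|exact: measurable_funB].
- apply/(measurable_restrictT _ _).1 => //.
  by apply/measurable_funTS/measurable_EFinP; exact: measurable_powR.
- by move=> x _; rewrite -EFinM lee_fin mulr_ge0 ?tpow_ge0.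
- by move=> x _; rewrite patchE; case: ifP => // _; rewrite lee_fin powR_ge0.
(* The two integrands differ only at 1, where [tpow 1 (1 - x)] vanishes. *)
- exists [set 1]; split => //; first exact: lebesgue_measure_set1.
  move=> x /= /existsNP[_]; apply: contra_notP => x1.
  rewrite patchE mem_setE in_itv/= /tpow subr_gt0 [x < 1]lt_neqAle.
  have -> /= : x != 1 by apply/eqP.
  case: (ltP 0 x) => x0 /=; last by rewrite mule0.
  by case: (leP x 1) => x1'; rewrite ?mul0e// subrr powRr0 mul1e.
Qed.

Lemma egamma_ge0 a : (0 <= egamma a)%E.
Proof.
by apply: integral_ge0 => x _; rewrite lee_fin mulr_ge0 ?tpow_ge0 ?expR_ge0.
Qed.

(** The integrand is, up to the point 0, the density of the exponential law of rate 1. *)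
Lemma egamma1 : egamma (1 : R) = 1%E.
Proof.
rewrite -(integral_exponential_pdf (ltr01 : 0 < 1 :> R)).
apply: ge0_ae_eq_integral => //.
- apply/measurable_EFinP/measurable_funM; first exact: measurable_tpow.
  by apply: measurableT_comp => //; exact: measurable_expR.
- by apply/measurable_EFinP; exact: measurable_exponential_pdf.
- by move=> x _; rewrite lee_fin mulr_ge0 ?tpow_ge0 ?expR_ge0.
- by move=> x _; rewrite lee_fin exponential_pdf_ge0.
- exists [set 0]; split => //; first exact: lebesgue_measure_set1.
  move=> x /= /existsNP[_]; apply: contra_notP => x1.
  rewrite /exponential_pdf patchE mem_setE in_itv/= andbT /tpow [0 < x]lt_neqAle eq_sym.
  have -> /= : x != 0 by apply/eqP.
  case: (leP 0 x) => x0 /=; rewrite ?mul0r// subrr powRr0 ?mul1r ?mulN1r.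
  reflexivity.
Qed.

(** Since $B(1,a)=1/a$, the functional equation is a case of [egammaM], without integration by
    parts. *)
Lemma egammaS a : 0 < a -> (egamma a = egamma (1 + a) * (a^-1)%:E)%E.
Proof. by move=> a0; rewrite -ebeta1l // -egammaM egamma1 mul1e. Qed.

Lemma egamma_gt0 a : 0 < a -> (0 < egamma a)%E.
Proof.
move=> a0.
apply: (@lt_le_trans _ _ ((expR (- 1))%:E * (a^-1)%:E)%E).
  by rewrite -EFinM lte_fin mulr_gt0 ?expR_gt0 ?invr_gt0.
have mp (D : set R) : measurable_fun D (fun x : R => (x `^ (a - 1))%:E).
  by apply/measurable_funTS/measurable_EFinP; exact: measurable_powR.
have p0 (x : R) : (0 <= (x `^ (a - 1))%:E)%E by rewrite lee_fin powR_ge0.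
have e0 : (0 <= (expR (- 1 : R))%:E)%E by rewrite lee_fin expR_ge0.
rewrite -(integral_powR a0).
rewrite -(ge0_integralZl mu (measurable_itv _) (mp _) (fun x _ => p0 x) e0).
rewrite integral_mkcond; apply: ge0_le_integral => //.
- by move=> x _; rewrite patchE; case: ifP => // _; rewrite lee_fin mulr_ge0// ?powR_ge0 ?expR_ge0.
- apply/(measurable_restrictT _ _).1 => //.
  apply/measurable_funTS/emeasurable_funM => //.
  by apply/measurable_EFinP; exact: measurable_powR.
- apply/measurable_EFinP/measurable_funM; first exact: measurable_tpow.
  by apply: measurableT_comp => //; exact: measurable_expR.
- move=> x _; rewrite patchE mem_setE in_itv/=; case: ifP; last first.
    by rewrite lee_fin mulr_ge0 ?tpow_ge0 ?expR_ge0.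
  move=> /andP[x0 x1]; rewrite /tpow x0 -EFinM lee_fin mulrC ler_wpM2l ?powR_ge0//.
  by rewrite ler_expR lerN2.
Qed.

(** The functional equation carries finiteness from 1 to all positive integers. For $b\ge1$,
    $x^{b-1}\le 1+x^n$ with $n=[b]$; smaller arguments are reached by the functional equation once
    more. *)
Lemma egamma_lty a : 0 < a -> (egamma a < +oo)%E.
Proof.
move=> a0.
have gn (n : nat) : (egamma (n.+1%:R : R) < +oo)%E.
  elim: n => [|n IH]; first by rewrite mulr1n egamma1 ltry.
  have n0 : 0 < n.+1%:R :> R by [].
  have := egammaS n0; rewrite nat1r => e.
  move: IH; rewrite e; case: (egamma (n.+2%:R : R)) (egamma_ge0 (n.+2%:R : R)) => [r _| _|] //.
    by rewrite !ltry.
  by rewrite gt0_mulye // lte_fin invr_gt0.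
suff ge1 b : 1 <= b -> (egamma b < +oo)%E.
  rewrite (egammaS a0); have := ge1 (1 + a); rewrite lerDl (ltW a0) => /(_ isT).
  case: (egamma _) (egamma_ge0 (1 + a)) => [r| |] // _ _.
  by rewrite -EFinM ltry.
move=> b1; pose n := Num.truncn b.
have bn : b <= n.+1%:R by rewrite ltW // /n truncnS_gt.
apply: (@le_lt_trans _ _ (egamma 1 + egamma n.+1%:R)%E); last first.
  by rewrite lte_add_pinfty// egamma1 ltry.
have mh c : measurable_fun setT (fun x => (tpow c x * expR (- x))%:E).
  apply/measurable_EFinP/measurable_funM; first exact: measurable_tpow.
  by apply: measurableT_comp => //; exact: measurable_expR.
have h0 c x : (0 <= (tpow c x * expR (- x))%:E)%E.
  by rewrite lee_fin mulr_ge0 ?tpow_ge0 ?expR_ge0.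
rewrite /egamma -(ge0_integralD mu measurableT (fun x _ => h0 _ x) (mh _) (fun x _ => h0 _ x) (mh _)).
apply: ge0_le_integral => //.
- exact: mh.
- exact: emeasurable_funD (mh _) (mh _).
- move=> x _; rewrite -EFinD lee_fin -mulrDl ler_wpM2r ?expR_ge0//.
  rewrite /tpow; case: ifP => [x0|_]; last by rewrite addr0.
  rewrite subrr powRr0; case: (leP 1 x) => x1.
    by rewrite ler_wpDl// ler_powR// lerD2r.
  by rewrite ler_wpDr ?powR_ge0// -[leRHS](powRr0 x) ger_powR ?subr_ge0 ?x0 ?(ltW x1).
Qed.

Lemma egammaE a : 0 < a -> egamma a = (Gamma a)%:E.
Proof.
move=> a0; rewrite GammaE fineK//.
by rewrite ge0_fin_numE ?egamma_ge0// egamma_lty.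
Qed.

Lemma Gamma_gt0 a : 0 < a -> 0 < Gamma a.
Proof. by move=> a0; rewrite -lte_fin -egammaE// egamma_gt0. Qed.

Lemma Gamma1 : Gamma (1 : R) = 1.
Proof. by rewrite GammaE egamma1. Qed.

Definition beta_coeff a b : R := Gamma a * Gamma b / Gamma (a + b).

Lemma ebetaE a b : 0 < a -> 0 < b -> ebeta a b = (beta_coeff a b)%:E.
Proof.
move=> a0 b0; have ab0 : 0 < a + b by rewrite addr_gt0.
have := egammaM a b; rewrite !egammaE// -EFinM.
have g0 := Gamma_gt0 ab0.
case: (ebeta a b) (ebeta_ge0 a b) => [r| |] // _.
  by rewrite -EFinM => -[e]; rewrite /beta_coeff e mulrAC mulfV ?mul1r// gt_eqF.
by rewrite gt0_muley ?lte_fin.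
Qed.

Lemma econv_tpowE a b t : 0 < a -> 0 < b ->
  econv (EFin \o tpow a) (EFin \o tpow b) t = (tpow (a + b) t * beta_coeff a b)%:E.
Proof. by move=> a0 b0; rewrite econv_tpow ebetaE. Qed.

Lemma GammaS a : 0 < a -> Gamma (a + 1) = a * Gamma a.
Proof.
move=> a0; have := egammaS a0; rewrite !egammaE// ?addr_gt0// -EFinM addrC => -[->].
by rewrite mulrCA mulfV ?mulr1// gt_eqF.
Qed.

End GammaValues.

(** * The convolution algebra of functions with a power singularity at 0 *)

Section ConvolutionAlgebra.
Context {R : realType}.
Notation mu := (@lebesgue_measure R).
Implicit Types (a b c t x s : R) (g h k : R -> R).

Definition unit_cut g t : R := if 0 < t <= 1 then g t else 0.

Definition upow a : R -> R := unit_cut (fun t => t `^ (a - 1)).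

(** The order [a] records the growth at 0. Every such function is integrable and the class is stable
    under convolution, so the laws below need no separate integrability hypotheses. *)
Definition tame a g : Prop :=
  [/\ 0 < a, measurable_fun setT g & exists C, forall x, `|g x| <= C * upow a x].

Definition rconv g h t : R := \int[mu]_s (g (t - s) * h s).

(* Cutting everything to ]0, 1], which does not change convolutions there, keeps
   all functions integrable on R. *)
Definition conv g h : R -> R := unit_cut (rconv g h).

Lemma upow_ge0 a x : 0 <= upow a x.
Proof. by rewrite /upow /unit_cut; case: ifP => // _; exact: powR_ge0. Qed.

Lemma upow_le_tpow a x : upow a x <= tpow a x.
Proof.
rewrite /upow /unit_cut /tpow; case: (ltP 0 x) => x0 //=.
by case: ifP => // _; exact: powR_ge0.
Qed.

Lemma measurable_unit_cut g : measurable_fun (`]0, 1] : set R) g ->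
  measurable_fun setT (unit_cut g).
Proof.
move=> mg; rewrite (_ : unit_cut g = g \_ `]0, 1]).
  by apply/(measurable_restrictT _ _).1.
by apply/funext => x; rewrite patchE mem_setE in_itv.
Qed.

Lemma tame_upow a : 0 < a -> tame a (upow a).
Proof.
move=> a0; split => //.
  by apply: measurable_unit_cut; apply: measurable_funTS; exact: measurable_powR.
by exists 1 => x; rewrite mul1r ger0_norm ?upow_ge0.
Qed.

(** Unlike those of [upow], convolutions of [tpow] are explicit on the whole line. The sign of the
    constant is read off at 1, where [upow] equals 1. *)
Lemma tame_bound a g : tame a g -> exists2 C, 0 <= C & forall x, `|g x| <= C * tpow a x.
Proof.
move=> [_ _ [C gC]]; have C0 : 0 <= C.
  have := gC 1; rewrite /upow /unit_cut ltr01 lexx /= powR1 mulr1.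
  exact: le_trans.
by exists C => // x; rewrite (le_trans (gC x))// ler_wpM2l// upow_le_tpow.
Qed.

Lemma tame_supp a g x : tame a g -> (0 < x <= 1) = false -> g x = 0.
Proof.
move=> [_ _ [C gC]] xN; have := gC x.
by rewrite /upow /unit_cut xN mulr0 normr_le0 => /eqP.
Qed.

Lemma tame_gt0 a g x : tame a g -> g x != 0 -> 0 < x.
Proof.
move=> tg; apply: contraNT; rewrite -leNgt => x0.
by apply/eqP/(tame_supp tg); rewrite ltNge x0.
Qed.

Lemma tame_measurable a g : tame a g -> measurable_fun setT g.
Proof. by case. Qed.

Lemma tame_ex_gt0 a g : tame a g -> 0 < a.
Proof. by case. Qed.

Lemma measurable_shift g h t : measurable_fun setT g -> measurable_fun setT h ->
  measurable_fun setT (fun s => g (t - s) * h s).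
Proof.
move=> mg mh; apply: measurable_funM => //.
by apply: measurableT_comp => //; exact: measurable_funB.
Qed.

(** The dominating function is a convolution of two truncated powers, known in closed form. Absolute
    convergence thus holds at every [t], not merely almost everywhere. *)
Lemma tame_conv_bound a b g h : tame a g -> tame b h -> exists2 C, 0 <= C &
  forall t, (\int[mu]_s `|(g (t - s) * h s)%:E| <= (C * tpow (a + b) t)%:E)%E.
Proof.
move=> tg th; have [Cg Cg0 gC] := tame_bound tg; have [Ch Ch0 hC] := tame_bound th.
have a0 := tame_ex_gt0 tg; have b0 := tame_ex_gt0 th.
exists (Cg * Ch * beta_coeff a b).
  by rewrite !mulr_ge0 // ?invr_ge0 ltW// Gamma_gt0// addr_gt0.
move=> t; rewrite -mulrA [beta_coeff _ _ * _]mulrC EFinM -econv_tpowE //.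
have mc : measurable_fun setT
    (fun s : R => ((EFin \o tpow a) (t - s)%R * (EFin \o tpow b) s)%E).
  apply: emeasurable_funM; last exact: measurable_Etpow.
  apply: measurableT_comp; [exact: measurable_Etpow|exact: measurable_funB].
have nn s : (0 <= (EFin \o tpow a) (t - s)%R * (EFin \o tpow b) s)%E.
  by rewrite -EFinM lee_fin mulr_ge0 ?tpow_ge0.
have CC0 : (0 <= (Cg * Ch)%:E)%E by rewrite lee_fin mulr_ge0.
rewrite /econv -(ge0_integralZl mu measurableT mc (fun s _ => nn s) CC0).
have mgh : measurable_fun setT (fun s => `|(g (t - s) * h s)%:E|%E).
  apply: measurableT_comp => //; apply/measurable_EFinP.
  by apply: measurable_shift; [exact: tame_measurable tg|exact: tame_measurable th].
apply: (ge0_le_integral mu measurableT _ mgh) => //.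
- by apply: emeasurable_funM.
- move=> s _; rewrite /= -!EFinM lee_fin normrM mulrACA.
  by apply: ler_pM.
Qed.

Lemma conv_integrable a b g h t : tame a g -> tame b h ->
  mu.-integrable setT (fun s => (g (t - s) * h s)%:E).
Proof.
move=> tg th; apply/integrableP; split.
  apply/measurable_EFinP.
  by apply: measurable_shift; [exact: tame_measurable tg|exact: tame_measurable th].
have [C _ /(_ t) gh] := tame_conv_bound tg th.
by rewrite (le_lt_trans gh)// ltry.
Qed.

Lemma rconvE a b g h t : tame a g -> tame b h ->
  (\int[mu]_s (g (t - s) * h s)%:E)%E = (rconv g h t)%:E.
Proof.
move=> tg th; rewrite /rconv /Rintegral fineK //.
exact: integrable_fin_num (conv_integrable t tg th).
Qed.

Lemma rconv_le a b g h : tame a g -> tame b h -> exists2 C, 0 <= C &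
  forall t, `|rconv g h t| <= C * tpow (a + b) t.
Proof.
move=> tg th; have [C C0 gh] := tame_conv_bound tg th; exists C => // t.
rewrite -lee_fin -abse_EFin -(rconvE t tg th); apply: le_trans (gh t).
apply: le_abse_integral => //.
exact: measurable_int (conv_integrable t tg th).
Qed.

Lemma rconv_le0 a b g h t : tame a g -> tame b h -> t <= 0 -> rconv g h t = 0.
Proof.
move=> tg th t0; have [C C0 /(_ t)] := rconv_le tg th.
by rewrite /tpow ltNge t0 mulr0 normr_le0 => /eqP.
Qed.

Lemma conv_rconv a b g h t : tame a g -> tame b h -> t <= 1 ->
  conv g h t = rconv g h t.
Proof.
move=> tg th t1; rewrite /conv /unit_cut t1 andbT; case: ltP => // t0.
by rewrite (rconv_le0 tg th).
Qed.

Lemma tame_integrable a g : tame a g -> mu.-integrable setT (EFin \o g).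
Proof.
move=> [a0 mg [C gC]].
apply: (@le_integrable _ _ _ mu _ measurableT _
   (EFin \o (fun x => C * upow a x))) => //.
- by apply/measurable_EFinP.
- move=> x _ /=; rewrite lee_fin (le_trans (gC x))// ler_norm//.
apply: (@integrableZl _ _ _ mu _ measurableT C (EFin \o upow a)).
apply/integrableP; split.
  by apply/measurable_EFinP; exact: (tame_measurable (tame_upow a0)).
have -> : (\int[mu]_x `|(EFin \o upow a) x| =
    \int[mu]_x ((fun x => (x `^ (a - 1))%:E) \_ `]0%R, 1%R]) x)%E.
  apply: eq_integral => x _ /=.
  rewrite patchE mem_setE in_itv /= ger0_norm ?upow_ge0//.
  by rewrite /upow /unit_cut; case: ifP.
by rewrite -integral_mkcond integral_powR// ltry.
Qed.

(** Fubini's theorem provides measurability once the integrand is integrable in the plane; by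
    Tonelli its norm there is the product of the $L^1$ norms. *)
Lemma measurable_rconv a b g h : tame a g -> tame b h ->
  measurable_fun setT (rconv g h).
Proof.
move=> tg th; have mg := tame_measurable tg; have mh := tame_measurable th.
pose f (z : R * R) : \bar R := (g (z.1 - z.2) * h z.2)%:E.
have mf : measurable_fun setT f.
  apply/measurable_EFinP/measurable_funM; apply: measurableT_comp => //.
  exact: measurable_sub_fst_snd.
have fi : (mu \x mu)%E.-integrable setT f.
  apply/(integrable12ltyP mu mu mf).
  have mng : measurable_fun setT (fun x => `|(g x)%:E|%E).
    by apply: measurableT_comp => //; apply/measurable_EFinP.
  have mnh : measurable_fun setT (fun x => `|(h x)%:E|%E).
    by apply: measurableT_comp => //; apply/measurable_EFinP.
  have /integrableP [_ ig] := tame_integrable tg.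
  have /integrableP [_ ih] := tame_integrable th.
  have e := integral_econv mng mnh (fun x => abse_ge0 _) (fun x => abse_ge0 _).
  have -> : (\int[mu]_x \int[mu]_y `|f (x, y)| =
      \int[mu]_t econv (fun x => `|(g x)%:E|) (fun x => `|(h x)%:E|) t)%E.
    apply: eq_integral => t _; apply: eq_integral => s _.
    by rewrite /f /= normrM EFinM.
  by rewrite e lte_mul_pinfty ?integral_ge0// ge0_fin_numE ?integral_ge0.
have := measurable_fubini_F fi; rewrite /fubini_F /= => mF.
apply/measurable_EFinP; apply: eq_measurable_fun mF => t _ /=.
by rewrite -(rconvE t tg th).
Qed.

Lemma tame_conv a b g h : tame a g -> tame b h -> tame (a + b) (conv g h).
Proof.
move=> tg th; split.
- by rewrite addr_gt0// ?(tame_ex_gt0 tg)// (tame_ex_gt0 th).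
- by apply: measurable_unit_cut; apply: measurable_funTS; exact: (measurable_rconv tg th).
- have [C C0 gh] := rconv_le tg th; exists C => x.
  rewrite /conv /upow /unit_cut; case: ifP => [/andP[x0 x1]|_]; last by rewrite normr0 mulr0.
  by rewrite (le_trans (gh x))// /tpow x0.
Qed.

Lemma conv_comm a b g h : tame a g -> tame b h -> conv g h = conv h g.
Proof.
move=> tg th; apply/funext => t; rewrite /conv /unit_cut; case: ifP => // _.
apply: EFin_inj; rewrite -(rconvE t tg th) -(rconvE t th tg).
have m1 : measurable_fun setT (fun s => (h (t - s) * g s)%:E).
  exact: measurable_int (conv_integrable t th tg).
rewrite [RHS](@integral_affine_unit _ (-1) t _ (normrN1 _) m1).
apply: eq_integral => s _; rewrite /affine mulN1r mulrC.
by rewrite (addrC (- s)) subKr.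
Qed.

Lemma convDl a b c g g' h : tame a g -> tame b g' -> tame c h ->
  conv (g + g') h = conv g h + conv g' h.
Proof.
move=> tg tg' th; apply/funext => t; rewrite !fctE /conv /unit_cut /=.
case: ifP => _; last by rewrite addr0.
rewrite /rconv -RintegralD//; [|exact: conv_integrable tg th|exact: conv_integrable tg' th].
by apply: eq_Rintegral => s _; rewrite mulrDl.
Qed.

Lemma convZl a b c g h : tame a g -> tame b h -> conv (c *: g) h = c *: conv g h.
Proof.
move=> tg th; apply/funext => t; rewrite !fctE /conv /unit_cut /=.
case: ifP => _; last by rewrite scaler0.
rewrite /rconv -[RHS]RintegralZl//; last exact: conv_integrable tg th.
by apply: eq_Rintegral => s _; rewrite mulrA.
Qed.

Lemma tameZ a c g : tame a g -> tame a (c *: g).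
Proof.
move=> [a0 mg [C gC]]; split => //.
  by apply: measurable_funM.
by exists (`|c| * C) => x; rewrite !fctE normrM -mulrA ler_wpM2l.
Qed.

Lemma tameD a g h : tame a g -> tame a h -> tame a (g + h).
Proof.
move=> [a0 mg [C gC]] [_ mh [C' hC]]; split => //.
  by apply: measurable_funD.
exists (C + C') => x; rewrite !fctE mulrDl (le_trans (ler_normD _ _))//.
exact: lerD.
Qed.

Lemma tameN a g : tame a g -> tame a (- g).
Proof. by rewrite -scaleN1r; exact: tameZ. Qed.

Lemma tameB a g h : tame a g -> tame a h -> tame a (g - h).
Proof. by move=> tg th; apply: tameD => //; exact: tameN. Qed.

Lemma tame_le a b g : 0 < b <= a -> tame a g -> tame b g.
Proof.
move=> /andP[b0 ba] [a0 mg [C gC]]; split => //; exists C => x.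
have C0 : 0 <= C.
  have := gC 1; rewrite /upow /unit_cut ltr01 lexx /= powR1 mulr1.
  exact: le_trans.
rewrite (le_trans (gC x))// ler_wpM2l// /upow /unit_cut; case: ifP => // x01.
by rewrite ger_powR// lerB.
Qed.

(** Fubini for $g(t-x)h(x-s)k(s)$. Integrating the absolute value over $s$ gives $O(x^{b+c-1})$ by
    [tame_conv_bound]; the remaining integral is again a convolution of truncated powers. *)
Lemma conv_assoc a b c g h k : tame a g -> tame b h -> tame c k ->
  conv (conv g h) k = conv g (conv h k).
Proof.
move=> tg th tk; apply/funext => t.
have mg := tame_measurable tg; have mh := tame_measurable th; have mk := tame_measurable tk.
rewrite {1}/conv {2}/conv /unit_cut; case: ifP => // /andP[t0 t1].
pose F (z : R * R) : \bar R := (g (t - z.1) * (h (z.1 - z.2) * k z.2))%:E.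
have mF : measurable_fun setT F.
  apply/measurable_EFinP/measurable_funM.
    by apply: measurableT_comp => //; exact: measurable_funB.
  apply: measurable_funM; apply: measurableT_comp => //.
  exact: measurable_sub_fst_snd.
have Fi : (mu \x mu)%E.-integrable setT F.
  apply/(integrable12ltyP mu mu mF).
  have [C C0 hk] := tame_conv_bound th tk.
  have bc0 : 0 < b + c by rewrite addr_gt0// ?(tame_ex_gt0 th)// (tame_ex_gt0 tk).
  have [D D0 gD] := tame_bound tg.
  have a0 := tame_ex_gt0 tg.
  apply: (@le_lt_trans _ _ ((D * C)%:E * econv (EFin \o tpow a) (EFin \o tpow (b + c)) t)%E); last first.
    by rewrite econv_tpowE// -EFinM ltry.
  have mc : measurable_fun setT
      (fun s : R => ((EFin \o tpow a) (t - s)%R * (EFin \o tpow (b + c)) s)%E).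
    apply: emeasurable_funM; last exact: measurable_Etpow.
    apply: measurableT_comp; [exact: measurable_Etpow|exact: measurable_funB].
  have nn s : (0 <= (EFin \o tpow a) (t - s)%R * (EFin \o tpow (b + c)) s)%E.
    by rewrite -EFinM lee_fin mulr_ge0 ?tpow_ge0.
  have DC0 : (0 <= (D * C)%:E)%E by rewrite lee_fin mulr_ge0.
  rewrite /econv -(ge0_integralZl mu measurableT mc (fun s _ => nn s) DC0).
  apply: ge0_le_integral => //.
  - by move=> x _; apply: integral_ge0.
  - apply: (@measurable_fun_fubini_tonelli_F _ _ _ _ R mu (fun z => `|F z|%E)) => //.
    exact: measurableT_comp.
  - by apply: emeasurable_funM.
  - move=> x _; rewrite /F /=.
    have mhk : measurable_fun setT (fun y : R => `|(h ((x : R) - y) * k y)%:E|%E).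
      apply: measurableT_comp => //.
      exact: measurable_int (conv_integrable x th tk).
    have -> : (\int[mu]_y (`|g (t - x) * (h (x - y) * k y)|)%:E =
       `|g (t - x)|%:E * \int[mu]_y `|(h (x - y) * k y)%:E|)%E.
      rewrite -(ge0_integralZl mu measurableT mhk (fun s _ => abse_ge0 _)) //.
      by apply: eq_integral => y _; rewrite /= normrM EFinM.
    apply: (@le_trans _ _ ((D * tpow a (t - x))%:E * (C * tpow (b + c) x)%:E)%E).
      by apply: lee_pmul => //; [exact: integral_ge0|rewrite lee_fin].
    by rewrite -!EFinM lee_fin mulrACA.
have := Fubini Fi; rewrite /= => FE.
apply: EFin_inj.
rewrite -(rconvE t (tame_conv tg th) tk) -(rconvE t tg (tame_conv th tk)).
transitivity (\int[mu]_s \int[mu]_x F (x, s))%E.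
  apply: eq_integral => s _.
  (* The inner [conv] is cut off at 1. Where $k(s)\ne0$ one has $s>0$, so its argument $t-s$ is at
     most 1 and the cut is harmless. *)
  have [ks0|ks0] := eqVneq (k s) 0.
    by rewrite ks0 mulr0 integral0_eq// => x _; rewrite /F /= ks0 !mulr0.
  have s0 := tame_gt0 tk ks0.
  rewrite (conv_rconv tg th); last by rewrite lerBlDr (le_trans t1)// lerDl ltW.
  rewrite EFinM -(rconvE _ tg th).
  have igh := conv_integrable (t - s) tg th.
  rewrite -(@integralZr _ _ _ mu _ measurableT _ igh).
  have m1 : measurable_fun setT (fun x => F (x, s)).
    exact: measurableT_comp mF (pair2_measurable s).
  rewrite [RHS](@integral_affine_unit _ 1 s _ (normr1 _) m1).
  apply: eq_integral => r _; rewrite /F /affine /= mul1r addrK -EFinM mulrA.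
  by rewrite (addrC r s) opprD addrA.
rewrite -FE; apply: eq_integral => x _.
(* Likewise $g(t-x)\ne0$ forces $x<t\le1$. *)
have [gx0|gx0] := eqVneq (g (t - x)) 0.
  by rewrite gx0 mul0r integral0_eq// => s _; rewrite /F /= gx0 !mul0r.
have x1 : x <= 1.
  by have := tame_gt0 tg gx0; rewrite subr_gt0 => /ltW /le_trans; apply.
rewrite (conv_rconv th tk x1) EFinM -(rconvE _ th tk).
rewrite -(@integralZl _ _ _ mu _ measurableT _ (conv_integrable x th tk)).
by apply: eq_integral => s _; rewrite /F /= EFinM.
Qed.

(** For $t\le1$ and $0<s<t$ both $s$ and $t-s$ lie below 1, so the cut powers can be replaced by
    [tpow]. *)
Lemma conv_upow a b : 0 < a -> 0 < b ->
  conv (upow a) (upow b) = beta_coeff a b *: upow (a + b).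
Proof.
move=> a0 b0; apply/funext => t; rewrite !fctE /conv [upow (a + b)]/upow /unit_cut.
case: ifP => [/andP[t0 t1]|_]; last by rewrite scaler0.
apply: EFin_inj; rewrite -(rconvE t (tame_upow a0) (tame_upow b0)).
have e : (((t `^ (a + b - 1)) * beta_coeff a b)%:E =
    econv (EFin \o tpow a) (EFin \o tpow b) t)%E.
  by rewrite econv_tpowE// /tpow t0.
rewrite /GRing.scale /= mulrC e; apply: eq_integral => s _ /=.
rewrite -EFinM /tpow /upow /unit_cut subr_gt0; congr EFin.
have [s0|s0] := ltP 0 s; last by rewrite !mulr0.
have [st|st] := ltP s t; last by rewrite !mul0r.
have -> : s <= 1 by rewrite (le_trans _ t1)// ltW.
by have -> : t - s <= 1 by rewrite lerBlDr (le_trans t1)// lerDl ltW.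
Qed.

End ConvolutionAlgebra.

(** * Riemann-Liouville integrals and Mittag-Leffler functions *)

(* Otherwise conversion tests unfold [Gamma] down to the Lebesgue integral. *)
Local Opaque Gamma.

Section RiemannLiouvilleKernels.
Context {R : realType}.
Notation mu := (@lebesgue_measure R).
Implicit Types (a b c t x s : R) (g h k : R -> R).

(* [conv (gpow a)] is the Riemann-Liouville integral of order a. *)
Definition gpow a : R -> R := (Gamma a)^-1 *: upow a.

Lemma gpowE a t : 0 < t <= 1 -> gpow a t = t `^ (a - 1) / Gamma a.
Proof. by move=> t01; rewrite /gpow fctE /upow /unit_cut t01 mulrC. Qed.

Lemma tame_gpow a : 0 < a -> tame a (gpow a).
Proof. by move=> a0; apply: tameZ; exact: tame_upow. Qed.

Lemma convZr a b c g h : tame a g -> tame b h -> conv g (c *: h) = c *: conv g h.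
Proof.
move=> tg th; rewrite (conv_comm tg (tameZ c th)) (convZl _ th tg).
by rewrite (conv_comm th tg).
Qed.

Lemma convDr a b g h h' : tame a g -> tame b h -> tame b h' ->
  conv g (h + h') = conv g h + conv g h'.
Proof.
move=> tg th th'; rewrite (conv_comm tg (tameD th th')) (convDl th th' tg).
by rewrite (conv_comm th tg) (conv_comm th' tg).
Qed.

Lemma convNr a b g h : tame a g -> tame b h -> conv g (- h) = - conv g h.
Proof. by move=> tg th; rewrite -scaleN1r (convZr _ tg th) scaleN1r. Qed.

Lemma convBr a b g h h' : tame a g -> tame b h -> tame b h' ->
  conv g (h - h') = conv g h - conv g h'.
Proof.
by move=> tg th th'; rewrite (convDr tg th (tameN th')) (convNr tg th').
Qed.

Lemma conv0r g : conv g 0 = 0.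
Proof.
apply/funext => t; rewrite /conv /unit_cut; case: ifP => // _.
rewrite /rconv /Rintegral integral0_eq// => s _.
by rewrite (_ : (0 : R -> R) s = 0) ?mulr0.
Qed.

(** The Gamma factors absorb the Beta coefficient: this is the semigroup law of fractional
    integration. *)
Lemma conv_gpow a b : 0 < a -> 0 < b -> conv (gpow a) (gpow b) = gpow (a + b).
Proof.
move=> a0 b0; rewrite /gpow (convZl _ (tame_upow a0) (tameZ _ (tame_upow b0))).
rewrite (convZr (Gamma b)^-1 (tame_upow a0) (tame_upow b0)) conv_upow// !scalerA.
congr (_ *: _); rewrite /beta_coeff.
have ga := Gamma_gt0 a0; have gb := Gamma_gt0 b0.
have gab : 0 < Gamma (a + b) by rewrite Gamma_gt0// addr_gt0.
move: (Gamma a) (Gamma b) (Gamma (a + b)) ga gb gab => A B C A0 B0 C0.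
by field; rewrite !gt_eqF.
Qed.

(** Dominated convergence, needed to integrate the Mittag-Leffler series term by term. *)
Lemma conv_cvg a b g h (f : nat -> R -> R) C t : tame a g ->
  (forall n, measurable_fun setT (f n)) -> 0 < b ->
  (forall n x, `|f n x| <= C * upow b x) -> (forall x, f n x @[n --> \oo] --> h x) ->
  conv g (f n) t @[n --> \oo] --> conv g h t.
Proof.
move=> tg mf b0 fC fh; rewrite /conv /unit_cut; case: ifP => t01; last exact: cvg_cst.
have tf n : tame b (f n) by split => //; exists C.
have th : tame b h.
  split => //.
    by apply: (@measurable_fun_cvg _ _ _ _ f) => // x _; exact: fh.
  exists C => x; have /cvg_norm nfh := fh x.
  by apply: (cvgr_to_le nfh); near=> n; exact: fC.
apply: (fine_cvg (f := fun n => (rconv g (f n) t)%:E)).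
have -> : (fun n => (rconv g (f n) t)%:E) =
    (fun n => \int[mu]_s (g (t - s)%R * f n s)%:E)%E.
  by apply/funext => n; rewrite -(rconvE t tg (tf n)).
rewrite -(rconvE t tg th).
apply: (@dominated_cvg _ _ _ mu setT measurableT _ _
  (fun s => `|(g (t - s) * (C * upow b s))%:E|%E)) => //.
- by move=> n; exact: measurable_int (conv_integrable t tg (tf n)).
- move=> s _; apply: cvg_EFin; first exact: nearW.
  by apply: cvgM; [exact: cvg_cst|exact: fh].
- apply: integrable_abse.
  exact: (conv_integrable t tg (tameZ C (tame_upow b0))).
- move=> n s _; rewrite /= lee_fin !normrM ler_wpM2l//.
  rewrite -normrM (le_trans (fC n s))// ler_norm//.
Unshelve. all: end_near. Qed.

End RiemannLiouvilleKernels.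

(* Sealed: unification of two instances with distinct parameters would otherwise
   unfold down to the integral defining Gamma. *)
Lemma ml_seal : {ml : forall R : realType, R -> R -> R -> R -> R |
  forall (R : realType) (alpha lambda b : R), ml R alpha lambda b =
    unit_cut (fun t => t `^ (b - 1) * mittag_leffler alpha b (lambda * t `^ alpha))}.
Proof. by eexists. Qed.

Definition ml (R : realType) : R -> R -> R -> R -> R := sval ml_seal R.

(** * The Mittag-Leffler series as a series of fractional kernels *)

Section MittagLeffler.
Context {R : realType} (alpha lambda : R).
Hypothesis alpha1 : 1 <= alpha.
Notation mu := (@lebesgue_measure R).
Implicit Types (a b t x y s : R).

Let alpha0 : 0 < alpha. Proof. exact: lt_le_trans ltr01 alpha1. Qed.

(* Bounds B(alpha, y) by B(1, y) = 1/y. *)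
Lemma Gamma_growth y : 0 < y ->
  (Gamma (alpha + y))^-1 <= (y * Gamma alpha * Gamma y)^-1.
Proof.
move=> y0; have ay0 : 0 < alpha + y by rewrite addr_gt0.
have [ga gy gay] := And3 (Gamma_gt0 alpha0) (Gamma_gt0 y0) (Gamma_gt0 ay0).
have aux (A B C : R) : 0 < A -> 0 < B -> A * B / C <= y^-1 ->
    C^-1 <= (y * A * B)^-1.
  move=> A0 B0; rewrite -ler_pdivlMl ?mulr_gt0// => /le_trans; apply.
  by rewrite -(mulrA y) (invfM y) (mulrC y^-1) lexx.
apply: aux => //; rewrite -/(beta_coeff alpha y).
rewrite -lee_fin -ebetaE// -(ebeta1l y0) /ebeta.
have mp (a : R) := measurable_Etpow a.
have mc (a b : R) : measurable_fun setT
    (fun s : R => ((EFin \o tpow a) (1 - s)%R * (EFin \o tpow b) s)%E).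
  apply: emeasurable_funM; last exact: mp.
  apply: measurableT_comp; [exact: mp|exact: measurable_funB].
rewrite /econv; apply: ge0_le_integral => //.
- by move=> s _; rewrite -EFinM lee_fin mulr_ge0 ?tpow_ge0.
- exact: mc.
- exact: mc.
- move=> s _; rewrite -!EFinM lee_fin /tpow; case: (ltP 0 (s : R)) => s0; last by rewrite !mulr0.
  rewrite ler_wpM2r ?powR_ge0//; case: ifP => // s1.
  rewrite subrr powRr0 -[leRHS](powRr0 (1 - s)) ger_powR ?subr_ge0//.
  by rewrite s1 gerBl ltW.
Qed.

(** Iterating [Gamma_growth] in steps of [alpha] from [b], the $k$-th step gains a factor of at
    least $c(k+1)\Gamma(\alpha)$. The Mittag-Leffler series is then dominated by an exponential
    series. *)
Lemma invGamma_le b : 0 < b -> exists D r, [/\ 0 <= D, 0 <= r &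
  forall k : nat, (Gamma (alpha * k%:R + b))^-1 <= D * (r ^+ k / k`!%:R)].
Proof.
(* Chosen so that $c(k+1)\le\alpha k+b$ for all $k$. *)
move=> b0; pose c := Num.min alpha b.
have c0 : 0 < c by rewrite lt_min alpha0.
have ga := Gamma_gt0 alpha0; have gb := Gamma_gt0 b0.
exists (Gamma b)^-1, (c * Gamma alpha)^-1; split.
- by rewrite invr_ge0 (ltW gb).
- by rewrite invr_ge0 mulr_ge0 ?(ltW c0) ?(ltW ga).
elim=> [|k IH].
  by rewrite mulr0 add0r expr0 fact0 divr1 mulr1.
have yk0 : 0 < alpha * k%:R + b by rewrite ltr_wpDl// mulr_ge0// ltW.
have -> : alpha * k.+1%:R + b = alpha + (alpha * k%:R + b).
  by rewrite -natr1 mulrDr mulr1 addrAC addrC addrCA addrA [RHS]addrC addrC addrA.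
have ck : c * k.+1%:R <= alpha * k%:R + b.
  rewrite -natr1 mulrDr mulr1 lerD//.
    by rewrite ler_wpM2r// ge_min lexx.
  by rewrite ge_min lexx orbT.
have aux (A B G q y k1 : R) : 0 < A -> 0 < B -> 0 < G -> 0 < y -> 0 < k1 ->
    c * k1 <= y -> G^-1 <= B^-1 * q ->
    (y * A * G)^-1 <= B^-1 * ((c * A)^-1 * q / k1).
  move=> A0 B0 G0 y0 k10 cky Gq.
  have -> : B^-1 * ((c * A)^-1 * q / k1) = (c * k1 * A)^-1 * (B^-1 * q).
    by field; rewrite !gt_eqF.
  rewrite invfM; apply: ler_pM Gq.
  - by rewrite invr_ge0 ltW// mulr_gt0.
  - by rewrite invr_ge0 ltW.
  - by rewrite lef_pV2 ?posrE ?mulr_gt0// ler_pM2r.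
apply: (le_trans (Gamma_growth yk0)).
have -> : (c * Gamma alpha)^-1 ^+ k.+1 / (k.+1)`!%:R =
    (c * Gamma alpha)^-1 * ((c * Gamma alpha)^-1 ^+ k / k`!%:R) / k.+1%:R.
  have gen (r q n m : R) : r * q / (n * m) = r * (q / m) / n by rewrite invfM; ring.
  by rewrite factS natrM exprS gen.
exact: (aux _ _ _ _ _ _ ga gb (Gamma_gt0 yk0) yk0 (ltr0Sn _ _) ck IH).
Qed.

Definition ml_coeff b x (k : nat) : R := x ^+ k / Gamma (alpha * k%:R + b).

Lemma Gamma_arg_gt0 b (k : nat) : 0 < b -> 0 < alpha * k%:R + b.
Proof. by move=> b0; rewrite ltr_wpDl// mulr_ge0// ltW. Qed.

Lemma is_cvg_ml_series b x : 0 < b -> cvgn (series (ml_coeff b x)).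
Proof.
move=> b0; apply: normed_cvg.
have [D [r [D0 r0 GD]]] := invGamma_le b0.
apply: (@series_le_cvg _ _ (fun k => D * (exp_coeff (`|x| * r) k))).
- by move=> n /=.
- by move=> n; rewrite mulr_ge0// exp_coeff_ge0// mulr_ge0.
- move=> n; rewrite /ml_coeff /exp_coeff /= normrM normrX.
  have gn := Gamma_gt0 (Gamma_arg_gt0 n b0).
  have gn' : 0 <= (Gamma (alpha * n%:R + b))^-1 by rewrite invr_ge0 ltW.
  rewrite (ger0_norm gn').
  apply: (@le_trans _ _ (`|x| ^+ n * (D * (r ^+ n / n`!%:R)))).
    by apply: ler_wpM2l; [rewrite exprn_ge0|exact: GD].
  by rewrite exprMn le_eqVlt; apply/orP; left; apply/eqP; ring.
- have -> : (fun k => D * exp_coeff (`|x| * r) k) = D *: exp_coeff (`|x| * r).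
    by apply/funext.
  by apply: is_cvg_seriesZ; exact: is_cvg_series_exp_coeff.
Qed.

Local Notation ml := (ml alpha lambda).

Lemma mlE b t : 0 < t <= 1 ->
  ml b t = t `^ (b - 1) * mittag_leffler alpha b (lambda * t `^ alpha).
Proof. by move=> t01; rewrite /ml (svalP ml_seal) /unit_cut t01. Qed.

(** Multiplied by $t^{b-1}$, the $k$-th term of the series at $\lambda t^\alpha$ is $\lambda^k$
    times the kernel of the fractional integral of order $\alpha k+b$. *)
Definition ml_part b (n : nat) : R -> R :=
  \sum_(0 <= k < n) lambda ^+ k *: gpow (alpha * k%:R + b).

Lemma ml_partE b n t : 0 < t <= 1 -> ml_part b n t =
  t `^ (b - 1) * series (ml_coeff b (lambda * t `^ alpha)) n.
Proof.
move=> t01; have /andP[t0 _] := t01.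
rewrite /ml_part fct_sumE /series /= mulr_sumr; apply: eq_bigr => k _.
rewrite fctE (gpowE _ t01) /ml_coeff /GRing.scale /= exprMn.
rewrite -(powR_mulrn k (powR_ge0 t alpha)) -powRrM.
have -> : alpha * k%:R + b - 1 = (b - 1) + alpha * k%:R by ring.
rewrite powRD; last by rewrite (gt_eqF t0) implybT.
by ring.
Qed.

Lemma ml_part_out b n t : (0 < t <= 1) = false -> ml_part b n t = 0.
Proof.
move=> t01; rewrite /ml_part fct_sumE big1// => k _.
by rewrite fctE /gpow fctE /upow /unit_cut t01 !scaler0.
Qed.

Lemma ml_cvg b t : 0 < b -> ml_part b n t @[n --> \oo] --> ml b t.
Proof.
move=> b0; rewrite /ml (svalP ml_seal) /unit_cut; case: ifP => t01.
  under eq_fun do rewrite ml_partE//.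
  by apply: cvgM; [exact: cvg_cst|exact: is_cvg_ml_series].
by under eq_fun do rewrite ml_part_out//; exact: cvg_cst.
Qed.

Lemma ml_part_bound b : 0 < b -> exists C, forall n t, `|ml_part b n t| <= C * upow b t.
Proof.
(* On $]0,1]$ one has $|\lambda t^\alpha|\le|\lambda|$, so the series at $|\lambda|$ dominates all
   partial sums. *)
move=> b0; exists (limn (series (ml_coeff b `|lambda|))) => n t.
have [t01|t01] := boolP (0 < t <= 1); last first.
  by rewrite ml_part_out ?normr0 ?(negbTE t01)// /upow /unit_cut (negbTE t01) mulr0.
have c0 (k : nat) : 0 <= ml_coeff b `|lambda| k.
  by rewrite mulr_ge0 ?exprn_ge0// invr_ge0 ltW// Gamma_gt0// Gamma_arg_gt0.
have /andP[t0 t1] := t01.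
rewrite ml_partE// /upow /unit_cut t01 normrM (ger0_norm (powR_ge0 _ _)) mulrC.
rewrite ler_wpM2r ?powR_ge0//.
apply: (@le_trans _ _ (series (ml_coeff b `|lambda|) n)); last first.
  apply: nondecreasing_cvgn_le; last exact: is_cvg_ml_series.
  by apply: nondecreasing_series => k _ _; exact: c0.
apply: (le_trans (ler_norm_sum _ _ _)); apply: ler_sum => k _.
have gn := Gamma_gt0 (Gamma_arg_gt0 k b0).
have gn' : 0 <= (Gamma (alpha * k%:R + b))^-1 by rewrite invr_ge0 ltW.
rewrite /ml_coeff normrM (ger0_norm gn'); apply: (ler_wpM2r gn').
rewrite normrX lerXn2r ?nnegrE//.
rewrite normrM (ger0_norm (powR_ge0 _ _)) ler_piMr//.
rewrite -(powRr0 t) ger_powR ?t01// ltW//.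
Qed.

Lemma measurable_ml_part b n : 0 < b -> measurable_fun setT (ml_part b n).
Proof.
move=> b0; rewrite /ml_part fct_sumE; apply: measurable_sum => k.
apply: measurable_funM => //.
exact: tame_measurable (tame_gpow (Gamma_arg_gt0 k b0)).
Qed.

Lemma tame_ml_part b n : 0 < b -> tame b (ml_part b n).
Proof.
move=> b0; split => //; first exact: measurable_ml_part.
by have [C hC] := ml_part_bound b0; exists C => x; exact: hC.
Qed.

Lemma tame_ml b : 0 < b -> tame b (ml b).
Proof.
move=> b0; split => //.
  apply: (@measurable_fun_cvg _ _ _ _ (ml_part b)) => //.
    by move=> n; exact: measurable_ml_part.
  by move=> x _; exact: ml_cvg.
have [C hC] := ml_part_bound b0; exists C => x.
have /cvg_norm nml := @ml_cvg b x b0.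
by apply: (cvgr_to_le nml); near=> n; exact: hC.
Unshelve. all: end_near. Qed.

Lemma conv_ml_part a b n : 0 < a -> 0 < b ->
  conv (gpow a) (ml_part b n) = ml_part (a + b) n.
Proof.
move=> a0 b0; elim: n => [|n IH].
  by rewrite /ml_part !big_nil conv0r.
have tn : tame b (lambda ^+ n *: gpow (alpha * n%:R + b)).
  apply: tameZ; apply: tame_le (tame_gpow (Gamma_arg_gt0 n b0)).
  by rewrite b0 lerDr mulr_ge0// ltW.
rewrite /ml_part !big_nat_recr//= (convDr (tame_gpow a0) (tame_ml_part n b0) tn).
rewrite -/(ml_part _ _) IH; congr (_ + _).
rewrite (convZr _ (tame_gpow a0) (tame_gpow (Gamma_arg_gt0 n b0))).
by rewrite conv_gpow ?Gamma_arg_gt0// addrCA.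
Qed.

(** The semigroup law applies to each term of the series and [conv_cvg] passes to the limit. *)
Lemma conv_ml a b : 0 < a -> 0 < b -> conv (gpow a) (ml b) = ml (a + b).
Proof.
move=> a0 b0; apply/funext => t.
have [C hC] := ml_part_bound b0.
have H := conv_cvg (t := t) (tame_gpow a0) (fun n => measurable_ml_part n b0) b0 hC
  (fun x => @ml_cvg b x b0).
have H' : conv (gpow a) (ml_part b n) t @[n --> \oo] --> ml (a + b) t.
  under eq_fun do rewrite conv_ml_part//.
  by apply: ml_cvg; rewrite addr_gt0.
by rewrite -(cvg_lim (@Rhausdorff R) H) (cvg_lim (@Rhausdorff R) H').
Qed.

Lemma ml_partS b n : ml_part b n.+1 = gpow b + lambda *: ml_part (alpha + b) n.
Proof.
rewrite /ml_part big_nat_recl//= expr0 scale1r mulr0 add0r; congr (_ + _).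
rewrite scaler_sumr; apply: eq_bigr => k _; rewrite exprS scalerA.
by congr (_ *: gpow _); rewrite -natr1 mulrDr mulr1 addrA.
Qed.

(** Splitting off the term $k=0$ shifts the summation index and so raises the order by [alpha].
    Combined with [conv_ml] this is the resolvent identity. *)
Lemma ml_rec b : 0 < b -> ml b = gpow b + lambda *: ml (alpha + b).
Proof.
move=> b0; apply/funext => t; rewrite !fctE.
have H : ml_part b n.+1 t @[n --> \oo] --> ml b t.
  by rewrite (cvg_shiftS (fun n => ml_part b n t)); exact: ml_cvg.
have H' : ml_part b n.+1 t @[n --> \oo] --> gpow b t + lambda * ml (alpha + b) t.
  under eq_fun do rewrite ml_partS.
  apply: cvgD; first exact: cvg_cst.
  by apply: cvgM; [exact: cvg_cst|apply: ml_cvg; rewrite addr_gt0].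
by rewrite -(cvg_lim (@Rhausdorff R) H) (cvg_lim (@Rhausdorff R) H').
Qed.

End MittagLeffler.

(** * One-sided derivatives and inversion of the Riemann-Liouville derivative *)

Section OneSidedDerivatives.
Context {R : realType}.
Implicit Types (x y l : R) (f g h : R -> R) (D : set R).

Local Notation I := (`]0, 1]%classic : set R).

Lemma is_derive_withinP D f x l : is_derive_within D f x l <->
  forall e : R, 0 < e -> exists2 d : R, 0 < d & forall y, D y -> y != x ->
    `|y - x| < d -> `|(f y - f x) / (y - x) - l| < e.
Proof.
rewrite /is_derive_within; split.
- move=> /cvgrPdist_lt H e e0; have [d /= d0 dP] := H e e0.
  exists d => // y Dy yx yxd; rewrite distrC; apply: dP => //=.
  by rewrite distrC.
- move=> H; apply/cvgrPdist_lt => e e0; have [d d0 dP] := H e e0.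
  by exists d => //= y yxd yx Dy; rewrite distrC; apply: dP => //; rewrite distrC.
Qed.

Lemma continuous_withinP D f : {within D, continuous f} <->
  forall x, D x -> forall e : R, 0 < e -> exists2 d : R, 0 < d & forall y, D y ->
    `|y - x| < d -> `|f y - f x| < e.
Proof.
rewrite subspace_continuousP; split.
- move=> H x Dx e e0; have /cvgrPdist_lt/(_ e e0) [d /= d0 dP] := H x Dx.
  by exists d => // y Dy yxd; rewrite distrC; apply: dP => //=; rewrite distrC.
- move=> H x Dx; apply/cvgrPdist_lt => e e0; have [d d0 dP] := H x Dx e e0.
  by exists d => //= y yxd Dy; rewrite distrC; apply: dP => //; rewrite distrC.
Qed.

Lemma is_derive_within_ext D f g x l : D x -> (forall y, D y -> f y = g y) ->
  is_derive_within D f x l -> is_derive_within D g x l.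
Proof.
move=> Dx fg /is_derive_withinP H; apply/is_derive_withinP => e /H[d d0 dP].
by exists d => // y Dy yx yxd; rewrite -!fg//; exact: dP.
Qed.

Lemma is_derive_withinD D f g x l m : is_derive_within D f x l ->
  is_derive_within D g x m -> is_derive_within D (f + g) x (l + m).
Proof.
move=> Hf Hg; rewrite /is_derive_within.
under eq_fun do rewrite !fctE opprD addrACA mulrDl.
exact: cvgD.
Qed.

Lemma is_derive_withinZ D f x l c : is_derive_within D f x l ->
  is_derive_within D (c *: f) x (c * l).
Proof.
move=> Hf; rewrite /is_derive_within.
under eq_fun do rewrite !fctE -scalerBr -scalerAl.
by apply: cvgM; [exact: cvg_cst|exact: Hf].
Qed.

Lemma is_derive_withinB D f g x l m : is_derive_within D f x l ->
  is_derive_within D g x m -> is_derive_within D (f - g) x (l - m).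
Proof.
move=> Hf Hg; have := is_derive_withinD Hf (is_derive_withinZ (c := -1) Hg).
by rewrite scaleN1r mulN1r.
Qed.

Lemma is_derive_within_cst D c x : is_derive_within D (cst c) x 0.
Proof.
apply/is_derive_withinP => e e0; exists 1 => // y _ _ _.
by rewrite subrr mul0r subrr normr0.
Qed.

Lemma is_derive_within_cvg D f x l : is_derive_within D f x l ->
  f y @[y --> within D x^'] --> f x.
Proof.
move=> Hf; apply/subr_cvg0.
have Hx : (y - x) @[y --> within D x^'] --> 0.
  apply/cvgrPdist_lt => e e0; exists e => //= y yx yx' Dy.
  by rewrite sub0r normrN distrC.
have : (f y - f x) / (y - x) * (y - x) @[y --> within D x^'] --> 0.
  by rewrite -(mulr0 l); exact: cvgM.
apply: cvg_trans; apply: near_eq_cvg.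
exists 1 => //= y _ yx _ /=.
by rewrite divfK// subr_eq0.
Qed.

Lemma is_derive_withinM D f g x l m : is_derive_within D f x l ->
  is_derive_within D g x m ->
  is_derive_within D (fun y => f y * g y) x (l * g x + f x * m).
Proof.
move=> Hf Hg; rewrite /is_derive_within.
have Hgx := is_derive_within_cvg Hg.
have : (f y - f x) / (y - x) * g y + f x * ((g y - g x) / (y - x))
    @[y --> within D x^'] --> l * g x + f x * m.
  apply: cvgD; first exact: cvgM.
  by apply: cvgM; [exact: cvg_cst|].
apply: cvg_trans; apply: near_eq_cvg; apply: nearW => y /=.
by ring.
Qed.

Lemma is_derive_within_continuous D f (f' : R -> R) :
  (forall x, D x -> is_derive_within D f x (f' x)) -> {within D, continuous f}.
Proof.
move=> Hf; apply/continuous_withinP => x Dx e e0.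
have /cvgrPdist_lt/(_ e e0)[d /= d0 dP] := is_derive_within_cvg (Hf x Dx).
exists d => // y Dy yxd; have [->|yx] := eqVneq y x; first by rewrite subrr normr0.
by rewrite distrC; apply: dP => //=; rewrite distrC.
Qed.

Lemma is_derive_is_derive_within D f x l :
  is_derive x 1 f l -> is_derive_within D f x l.
Proof.
move=> [fx lE]; apply/is_derive_withinP => e e0.
have : (fun k : R => k^-1 *: ((f \o shift x) (k *: 1) - f x)) @ 0^' --> l by rewrite -lE.
move=> /cvgrPdist_lt/(_ e e0)[d /= d0 dP]; exists d => // y _ yx yxd.
rewrite distrC; have := dP (y - x); rewrite /= sub0r normrN subr_eq0 => /(_ yxd yx).
by rewrite [_%:A]mulr1 subrK /GRing.scale /= mulrC.
Qed.

Lemma is_derive_within_is_derive f x l : 0 < x < 1 ->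
  is_derive_within I f x l -> is_derive x 1 f l.
Proof.
move=> /andP[x0 x1] /is_derive_withinP H.
have K : (fun k : R => k^-1 *: ((f \o shift x) (k *: 1) - f x)) @ 0^' --> l.
  apply/cvgrPdist_lt => e e0; have [d d0 dP] := H e e0.
  exists (Num.min d (Num.min x (1 - x))) => /=.
    by rewrite !lt_min d0 x0 subr_gt0.
  move=> h /=; rewrite sub0r normrN !lt_min => /and3P[hd hx hx1] h0.
  rewrite distrC; have := dP (h + x); rewrite addrK => /(_ _ _ hd).
  rewrite /= [_%:A]mulr1 /GRing.scale /= mulrC; apply.
    rewrite in_itv/=; move: hx hx1; rewrite !ltr_norml => /andP[? ?] /andP[? ?].
    by apply/andP; split; lra.
  by rewrite -subr_eq0 addrK.
by split; [apply: cvgP K|apply: cvg_lim K].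
Qed.

Lemma is_derive_within_uniq f x l m : I x ->
  is_derive_within I f x l -> is_derive_within I f x m -> l = m.
Proof.
rewrite /= in_itv/= => /andP[x0 x1] /is_derive_withinP H /is_derive_withinP H'.
apply/eqP; rewrite -subr_eq0 -normr_le0; apply/ler_addgt0Pr => e e0; rewrite add0r.
have e20 : 0 < e / 2 by rewrite divr_gt0.
have [d d0 dP] := H _ e20; have [d' d'0 dP'] := H' _ e20.
(* The test point $x-r/2$ lies to the left of $x$, hence in $]0,1]$ even for $x=1$. *)
pose r := Num.min (Num.min d d') x.
have r0 : 0 < r by rewrite !lt_min d0 d'0.
have [rd rd' rx] : [/\ r <= d, r <= d' & r <= x].
  by rewrite !ge_min !lexx !orbT.
have Iy : I (x - r / 2) by rewrite /= in_itv/=; apply/andP; split; lra.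
have yx : x - r / 2 != x by rewrite -subr_eq0 addrAC subrr add0r oppr_eq0 gt_eqF// divr_gt0.
have nyx : `|x - r / 2 - x| = r / 2.
  by rewrite addrAC subrr add0r normrN gtr0_norm// divr_gt0.
have := dP _ Iy yx; have := dP' _ Iy yx; rewrite nyx.
move=> /(_ _)/wrap[]; first lra; move=> h1 /(_ _)/wrap[]; first lra; move=> h2.
set q := (X in `|X - _|) in h1 h2.
have -> : l - m = (q - m) - (q - l) by ring.
by rewrite (le_trans (ler_normB _ _))// ltW// (splitr e) ltrD.
Qed.

Lemma is_derive_within0_cst f : (forall x, I x -> is_derive_within I f x 0) ->
  forall x, I x -> f x = f 1.
Proof.
move=> Hf x; rewrite /= in_itv/= => /andP[x0 x1].
have [->//|xn1] := eqVneq x 1.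
have {xn1}x1 : x < 1 by rewrite lt_neqAle xn1.
have sub : `[x, 1] `<=` I.
  by move=> y /=; rewrite !in_itv/= => /andP[xy ->]; rewrite (lt_le_trans x0).
have [||c _ /eqP] := @MVT R f (fun=> 0) x 1 x1.
- move=> y; rewrite in_itv/= => /andP[xy y1]; apply: is_derive_within_is_derive.
    by rewrite (lt_trans x0 xy) y1.
  by apply: Hf; rewrite /= in_itv/= (lt_trans x0 xy) ltW.
- exact: continuous_subspaceW sub (is_derive_within_continuous Hf).
- by rewrite mul0r subr_eq0 => /eqP.
Qed.

Lemma is_derive_n_within_ext n f f' h h' : (forall x, I x -> f x = f' x) ->
  (forall x, I x -> h x = h' x) ->
  is_derive_n_within I n f h -> is_derive_n_within I n f' h'.
Proof.
case: n => [|n] ff' hh' /=; first by move=> H x Ix; rewrite -ff'// -hh'// H.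
move=> [g1 Hg1 Hn]; exists g1.
  by move=> x Ix; apply: is_derive_within_ext (Hg1 x Ix).
elim: n g1 {Hg1} Hn => [|n IH] g1 /=; first by move=> H x Ix; rewrite -hh'// H.
by move=> [g2 Hg2 Hn]; exists g2 => //; exact: IH.
Qed.

Lemma is_derive_n_within_uniq n f h h' :
  is_derive_n_within I n f h -> is_derive_n_within I n f h' ->
  forall x, I x -> h x = h' x.
Proof.
elim: n f => [|n IH] f /=; first by move=> H H' x Ix; rewrite H// H'.
move=> [g Hg Hn] [g' Hg' Hn']; apply: (IH g) => //.
apply: is_derive_n_within_ext Hn' => // x Ix.
exact: is_derive_within_uniq (Hg' x Ix) (Hg x Ix).
Qed.

Lemma is_derive_n_withinZ n c f h : is_derive_n_within I n f h ->
  is_derive_n_within I n (c *: f) (c *: h).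
Proof.
elim: n f => [|n IH] f /=; first by move=> H x Ix; rewrite !fctE H.
move=> [g Hg Hn]; exists (c *: g); last exact: IH.
by move=> x Ix; apply: is_derive_withinZ; exact: Hg.
Qed.

Lemma is_derive_n_withinB n f f' h h' : is_derive_n_within I n f h ->
  is_derive_n_within I n f' h' -> is_derive_n_within I n (f - f') (h - h').
Proof.
elim: n f f' => [|n IH] f f' /=; first by move=> H H' x Ix; rewrite !fctE H// H'.
move=> [g Hg Hn] [g' Hg' Hn']; exists (g - g'); last exact: IH.
by move=> x Ix; apply: is_derive_withinB; [exact: Hg|exact: Hg'].
Qed.

End OneSidedDerivatives.

(** * Differentiating convolutions, and inverting the fractional derivative *)

Section ConvolutionCalculus.
Context {R : realType}.
Notation mu := (@lebesgue_measure R).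
Implicit Types (a b c t x y s l : R) (f g h : R -> R).

Local Notation I := (`]0, 1]%classic : set R).

Lemma conv1E a g t : tame a g -> 0 < t <= 1 ->
  conv (gpow 1) g t = \int[mu]_(s in `]0, t]) g s.
Proof.
move=> tg t01; have /andP[t0 t1] := t01.
rewrite -Rintegral_itv_bndo_bndc; last first.
  by apply: integrableS (tame_integrable tg) => //; exact: measurable_itv.
rewrite Rintegral_mkcond /conv /unit_cut t01 /rconv.
apply: eq_Rintegral => s _; rewrite patchE mem_setE in_itv/=.
have [s0|s0] := ltP 0 s; last first.
  by rewrite (tame_supp tg) ?mulr0//= ltNge s0.
have [st|st] := ltP s t; last first.
  rewrite (tame_supp (tame_gpow ltr01)) ?mul0r//.
  by rewrite subr_gt0 ltNge st.
rewrite gpowE ?subrr ?powRr0 ?Gamma1 ?divr1 ?mul1r//.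
by rewrite subr_gt0 st lerBlDr (le_trans t1)// lerDl ltW.
Qed.

Lemma conv1B a g x y : tame a g -> 0 < x -> x <= y -> y <= 1 ->
  conv (gpow 1) g y - conv (gpow 1) g x = \int[mu]_(s in `]x, y]) g s.
Proof.
move=> tg x0 xy y1; rewrite !(conv1E tg) ?x0 ?(lt_le_trans x0 xy) ?(le_trans xy)//.
rewrite Rintegral_itvB ?bnd_simp ?(ltW x0)//.
by apply: integrableS (tame_integrable tg) => //; exact: measurable_itv.
Qed.

Lemma mean_dist a g x y l (e : R) : tame a g -> x < y ->
  (forall s, x < s <= y -> `|g s - l| <= e) ->
  `|(\int[mu]_(s in `]x, y]) g s) / (y - x) - l| <= e.
Proof.
move=> tg xy gl; have yx0 : 0 < y - x by rewrite subr_gt0.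
have mxy : measurable (`]x, y] : set R) by exact: measurable_itv.
have ig : mu.-integrable `]x, y] (EFin \o g).
  by apply: integrableS (tame_integrable tg).
have fm : (mu `]x, y] < +oo)%E.
  by rewrite lebesgue_measure_itv /= lte_fin xy -EFinB ltry.
have mE (r : R) : \int[mu]_(s in `]x, y]) r = r * (y - x).
  rewrite Rintegral_cst//; congr (_ * _); rewrite -[RHS]/(fine (y - x)%:E).
  by congr fine; rewrite [LHS]lebesgue_measure_itv /= lte_fin xy.
have ic (r : R) : mu.-integrable `]x, y] (EFin \o cst r).
  apply: measurable_bounded_integrable => //; exact: bounded_cst.
have -> : (\int[mu]_(s in `]x, y]) g s) / (y - x) - l =
    (\int[mu]_(s in `]x, y]) (g s - l)) / (y - x).
  rewrite RintegralB//; last exact: ic.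
  by rewrite mE; field; rewrite gt_eqF.
rewrite normrM normfV (gtr0_norm yx0) ler_pdivrMr// -mE.
have igl : mu.-integrable `]x, y] (EFin \o (fun s => g s - l)).
  have -> : EFin \o (fun s => g s - l) = (fun s => (EFin \o g) s - (EFin \o cst l) s)%E.
    by apply/funext.
  exact: integrableB.
have nle : `|\int[mu]_(s in `]x, y]) (g s - l)| <= \int[mu]_(s in `]x, y]) `|g s - l|.
  exact: le_normr_Rintegral.
apply: (le_trans nle).
apply: le_Rintegral => //; [exact: integrable_norm|exact: (ic e)].
Qed.

(** The difference quotient is the mean of [g] between [x] and [y], so continuity near [x] suffices;
    [g] may be unbounded at 0. *)
Lemma conv1_derive a g x : tame a g -> {within I, continuous g} -> I x ->
  is_derive_within I (conv (gpow 1) g) x (g x).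
Proof.
move=> tg /continuous_withinP cg Ix; apply/is_derive_withinP => e e0.
have [d d0 dP] := cg x Ix (e / 2) (divr_gt0 e0 (ltr0Sn _ 1)).
exists d => // y Iy yx yxd; apply: (@le_lt_trans _ _ (e / 2)); last first.
  by rewrite ltr_pdivrMr// ltr_pMr// ltr1n.
move: Ix Iy; rewrite /= !in_itv/= => /andP[x0 x1] /andP[y0 y1].
have gd s : 0 < s -> s <= 1 -> `|s - x| < d -> `|g s - g x| <= e / 2.
  by move=> s0 s1 sd; apply/ltW/dP => //; rewrite /= in_itv/= s0.
have [xy|yx'|/eqP] := ltgtP x y; last by rewrite eq_sym (negbTE yx).
- rewrite (conv1B tg x0 (ltW xy) y1); apply: (mean_dist tg xy) => s /andP[xs sy].
  apply: gd; [exact: lt_trans xs|exact: le_trans y1|].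
  rewrite (gtr0_norm (x := s - x)) ?subr_gt0//; apply: le_lt_trans yxd.
  by rewrite gtr0_norm ?subr_gt0// lerD2r.
- have -> : (conv (gpow 1) g y - conv (gpow 1) g x) / (y - x) =
     (conv (gpow 1) g x - conv (gpow 1) g y) / (x - y).
    have gen (p q r s : R) : (p - q) / (r - s) = (q - p) / (s - r).
      by rewrite -(opprB s) -(opprB q) invrN mulrNN.
    exact: gen.
  rewrite (conv1B tg y0 (ltW yx') x1); apply: (mean_dist tg yx') => s /andP[ys sx].
  apply: gd; [exact: lt_trans ys|exact: le_trans x1|].
  rewrite ler0_norm ?subr_le0// opprB; apply: le_lt_trans yxd.
  by rewrite ltr0_norm ?subr_lt0// opprB lerD2l lerN2 ltW.
Qed.

(** Since $b\ge1$, [h] is bounded and a multiple of $|g|$ dominates the integrand; dominated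
    convergence then moves the limit inside, although [g] may be singular. *)
Lemma conv_continuous a b g h : tame a g -> tame b h -> 1 <= b ->
  {within I, continuous h} -> {within I, continuous conv g h}.
Proof.
move=> tg th b1 ch; rewrite (conv_comm tg th).
(* [h] drops to 0 beyond 1. Prolonging it by [h 1] leaves 0 as the only possible discontinuity and
   does not change the convolution on $]0,1]$. *)
pose h1 s := h (Num.min s 1).
have mh := tame_measurable th.
have mh1 : measurable_fun setT h1.
  by apply: measurableT_comp => //; exact: measurable_minr.
have [C hC] : exists C, forall s, `|h s| <= C.
  have [|_ _ [C hC]] := @tame_le _ b 1 h _ th; first by rewrite ltr01.
  exists C => s; apply: (le_trans (hC s)); rewrite /upow /unit_cut.
  have C0 : 0 <= C.
    have := hC 1; rewrite /upow /unit_cut ltr01 lexx /= powR1 mulr1.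
    exact: le_trans.
  by case: ifP => _; rewrite ?mulr0// subrr powRr0 mulr1.
have h1c y : y != 0 -> {for y, continuous h1}.
  rewrite neq_lt => /orP[y0|y0].
    have h10 z : z < 0 -> h1 z = 0.
      by move=> z0; rewrite /h1 (tame_supp th)// lt_min ltNge (ltW z0).
    apply/cvgrPdist_lt => e e0; near=> z; rewrite !h10 ?subrr ?normr0//.
    by near: z; exact: lt_nbhsl.
  have Iy : I (Num.min y 1).
    by rewrite /= in_itv/= lt_min y0 ltr01 ge_min lexx orbT.
  apply/cvgrPdist_lt => e e0.
  move/continuous_withinP : ch => /(_ _ Iy e e0)[d d0 dP].
  near=> z.
  have z0 : 0 < z by near: z; exact: lt_nbhsr.
  rewrite distrC; apply: dP; first by rewrite /= in_itv/= lt_min z0 ltr01 ge_min lexx orbT.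
  apply: (@le_lt_trans _ _ `|y - z|).
    have zy := ler_norm (z - y); have yz := ler_norm (y - z).
    rewrite (distrC z y) in zy; rewrite ler_norml.
    by case: (leP z 1) => z1; case: (leP y 1) => y1; apply/andP; split; lra.
  by near: z; exact: cvgr_dist_lt.
pose k t := \int[mu]_s (h1 (t - s) * g s).
have kc x : {for x, continuous k}.
  apply/(@cvg_nbhsP _ R^o) => v vx.
  have igC : mu.-integrable setT (fun s => (C * `|g s|)%:E).
    apply: (@integrableZl _ _ _ mu _ measurableT C (EFin \o (Num.norm \o g))).
    by apply: integrable_norm; exact: tame_integrable tg.
  have mi t : measurable_fun setT (fun s => (h1 (t - s) * g s)%:E).
    apply/measurable_EFinP; apply: (@measurable_shift _ h1 g t mh1).
    exact: tame_measurable tg.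
  have ub t s : `|h1 (t - s) * g s| <= C * `|g s|.
    by rewrite normrM ler_wpM2r// hC.
  have ii t : mu.-integrable setT (fun s => (h1 (t - s) * g s)%:E).
    apply: (@le_integrable _ _ _ mu _ measurableT _ _ (mi t) _ igC) => s _.
    by rewrite /= lee_fin (le_trans (ub _ _))// ler_norm.
  have vc : {ae mu, forall s, setT s ->
      (h1 (v n - s) * g s)%:E @[n --> \oo] --> (h1 (x - s) * g s)%:E}.
    (* Only at $s=x$ does the argument of [h1] tend to 0. *)
    exists [set x]; split => //; first exact: lebesgue_measure_set1.
    move=> s /= /not_implyP[_]; apply: contra_notP => xs.
    apply: cvg_EFin; first exact: nearW.
    apply: cvgM; last exact: cvg_cst.
    have xs0 : x - s != 0 by rewrite subr_eq0 eq_sym; apply/eqP.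
    apply: (@cvg_comp _ _ _ (fun n => v n - s) h1 _ (nbhs (x - s))).
      by apply: cvgB => //; exact: cvg_cst.
    exact: h1c.
  have ub' : {ae mu, forall s n, setT s -> (`|(h1 (v n - s) * g s)%:E| <= (C * `|g s|)%:E)%E}.
    by apply: aeW => s n _; rewrite lee_fin.
  have [_ _ K] := @dominated_convergence _ _ _ mu setT measurableT
    (fun n s => (h1 (v n - s) * g s)%:E) (fun s => (h1 (x - s) * g s)%:E)
    (fun s => (C * `|g s|)%:E) (fun n => mi (v n)) (mi x) vc igC ub'.
  have kE t : (\int[mu]_s (h1 (t - s) * g s)%:E)%E = (k t)%:E.
    by rewrite fineK//; exact: integrable_fin_num (ii t).
  apply: (fine_cvg (f := fun n => (k (v n))%:E)).
  rewrite -kE (_ : (fun n => (k (v n))%:E) =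
    (fun n => \int[mu]_s (h1 (v n - s)%R * g s)%:E)%E) //.
  by apply/funext => n; rewrite kE.
have kI t : I t -> conv h g t = k t.
  rewrite /= in_itv/= => t01; rewrite /conv /unit_cut t01 /rconv /k.
  apply: eq_Rintegral => s _; have [->|gs0] := eqVneq (g s) 0; first by rewrite !mulr0.
  rewrite /h1 min_l// lerBlDr; have /andP[_ t1] := t01.
  by rewrite (le_trans t1)// lerDl ltW// (tame_gt0 tg gs0).
apply/continuous_withinP => x Ix e e0.
have /cvgrPdist_lt/(_ e e0)[d /= d0 dP] := kc x.
exists d => // y Iy yxd; rewrite !kI// distrC; apply: dP.
by rewrite /= distrC.
Unshelve. all: end_near. Qed.

Lemma gpow_continuous a : {within I, continuous (gpow a)}.
Proof.
apply: (@is_derive_within_continuous _ _ _ (fun x => (Gamma a)^-1 * ((a - 1) * x `^ (a - 1 - 1)))).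
move=> x Ix; apply: (@is_derive_within_ext _ _ ((Gamma a)^-1 *: (fun t => t `^ (a - 1)))) => //.
  by move=> y; rewrite /= in_itv/= => y01; rewrite gpowE// fctE mulrC.
apply: is_derive_withinZ; apply: is_derive_is_derive_within.
by move: Ix; rewrite /= in_itv/= => /andP[x0 _]; exact: is_derive1_powR.
Qed.

Lemma gpow1_derive x : I x -> is_derive_within I (gpow 1) x 0.
Proof.
move=> Ix; apply: (@is_derive_within_ext _ _ (cst 1)) => //; last exact: is_derive_within_cst.
by move=> y; rewrite /= in_itv/= => y01; rewrite gpowE// subrr powRr0 Gamma1 divr1.
Qed.

Lemma continuousD_within f g : {within I, continuous f} -> {within I, continuous g} ->
  {within I, continuous (f + g)}.
Proof. by move=> cf cg x; apply: cvgD; [exact: cf|exact: cg]. Qed.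

Lemma continuousZ_within c f : {within I, continuous f} -> {within I, continuous (c *: f)}.
Proof. by move=> cf x; apply: cvgM; [exact: cvg_cst|exact: cf]. Qed.

(** By the semigroup law each [k m.+1] is a primitive of [k m]. The term in [c], a monomial of
    degree [n], becomes constant and disappears with the last derivative: it is the part that the
    fractional derivative cannot see. *)
Lemma gpow_n_conv_derive (n : nat) c g : tame 1 g -> {within I, continuous g} ->
  is_derive_n_within I n.+1 (c *: gpow n.+1%:R + conv (gpow n.+1%:R) g) g.
Proof.
move=> tg cg.
pose k (m : nat) := c *: gpow m.+1%:R + conv (gpow m.+1%:R) g.
have gp m : 0 < m.+1%:R :> R by rewrite ltr0n.
have tcp m : tame 1 (c *: gpow m.+1%:R).
  by apply: tameZ; apply: tame_le (tame_gpow (gp m)); rewrite ltr01 ler1n.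
have tpg m : tame 1 (conv (gpow m.+1%:R) g).
  by apply: tame_le (tame_conv (tame_gpow (gp m)) tg); rewrite ltr01 lerDr ltW.
have tk m : tame 1 (k m) by exact: tameD.
have kS m : k m.+1 = conv (gpow 1) (k m).
  rewrite /k (convDr (tame_gpow ltr01) (tcp m) (tpg m)).
  rewrite (convZr c (tame_gpow ltr01) (tame_gpow (gp m))) conv_gpow// nat1r.
  by rewrite -(conv_assoc (tame_gpow ltr01) (tame_gpow (gp m)) tg) conv_gpow// nat1r.
have k0' x : I x -> is_derive_within I (k 0%N) x (g x).
  move=> Ix; rewrite /k mulr1n.
  have := is_derive_withinD (is_derive_withinZ (c := c) (gpow1_derive Ix))
    (conv1_derive tg cg Ix).
  by rewrite mulr0 add0r.
have kd : forall m, {within I, continuous (k m)} /\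
    (forall x, I x -> is_derive_within I (k m.+1) x (k m x)).
  elim=> [|m [IH1 IH2]].
    have ck : {within I, continuous (k 0%N)} by exact: is_derive_within_continuous k0'.
    split; first exact: ck.
    by move=> x Ix; rewrite kS; exact: (conv1_derive (tk 0%N) ck Ix).
  have ck : {within I, continuous (k m.+1)} by exact: is_derive_within_continuous IH2.
  split; first exact: ck.
  by move=> x Ix; rewrite (kS m.+1); exact: (conv1_derive (tk m.+1) ck Ix).
rewrite -/(k n); elim: n => [|n IH]; first by exists g.
by exists (k n) => // x Ix; apply: (kd n).2.
Qed.

Lemma conv_inj_gpow (n : nat) z : tame 1 z -> {within I, continuous z} ->
  conv (gpow n.+1%:R) z = 0 -> z = 0.
Proof.
move=> tz cz z0; have := gpow_n_conv_derive n 0 tz cz.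
rewrite scale0r add0r z0 => H.
have H0 : is_derive_n_within I n.+1 (0 : R -> R) (0 : R -> R).
  by have := is_derive_n_withinZ 0 H; rewrite !scale0r.
apply/funext => x; have [x01|x01] := boolP (0 < x <= 1).
  by rewrite (is_derive_n_within_uniq H H0)//= in_itv/=.
by rewrite (tame_supp tz) ?(negbTE x01).
Qed.

Lemma gpowS_derive (n : nat) x : I x ->
  is_derive_within I (gpow n.+2%:R) x (gpow n.+1%:R x).
Proof.
move=> Ix; have n0 : 0 < n.+1%:R :> R by rewrite ltr0n.
rewrite -nat1r -conv_gpow//.
have tn : tame n.+1%:R (gpow n.+1%:R : R -> R) by exact: tame_gpow.
exact: (conv1_derive tn (@gpow_continuous _) Ix).
Qed.

(** Polynomials in the basis $t^j/j!$, on which differentiation is a shift of coefficients. *)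
Definition gpoly (c : nat -> R) (n : nat) : R -> R :=
  \sum_(0 <= j < n) c j *: gpow j.+1%:R.

Lemma gpoly_derive (c : nat -> R) (n : nat) x : I x ->
  is_derive_within I (gpoly c n.+1) x (gpoly (fun j => c j.+1) n x).
Proof.
move=> Ix; elim: n => [|n IH].
  rewrite /gpoly big_nat1 big_nil mulr1n -[X in is_derive_within _ _ _ X](mulr0 (c 0%N)).
  by apply: is_derive_withinZ; exact: gpow1_derive.
rewrite /gpoly big_nat_recr//= [in X in is_derive_within _ _ _ X]big_nat_recr//=.
apply: is_derive_withinD; first exact: IH.
by apply: is_derive_withinZ; exact: gpowS_derive.
Qed.

Lemma is_derive_n_within0 (n : nat) f : is_derive_n_within I n f (0 : R -> R) ->
  exists c : nat -> R, forall x, I x -> f x = gpoly c n x.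
Proof.
elim: n f => [|n IH] f.
  by move=> /= H; exists (fun=> 0) => x Ix; rewrite -H// /gpoly big_nil.
move=> [g Hg /IH [c gc]].
pose c' r (j : nat) := if j is i.+1 then c i else r.
have Hd r x : I x -> is_derive_within I (f - gpoly (c' r) n.+1) x 0.
  move=> Ix; have := is_derive_withinB (Hg x Ix) (@gpoly_derive (c' r) n x Ix).
  by rewrite -[gpoly _ n x]/(gpoly c n x) -gc// subrr.
have one1 : I (1 : R) by rewrite /= in_itv/= ltr01 lexx.
(* The constant of integration, read off at 1, where [gpow 1] equals 1. *)
pose r := f 1 - gpoly (c' 0) n.+1 1; exists (c' r) => x Ix.
have E x0 : I x0 -> gpoly (c' r) n.+1 x0 = r + gpoly (c' 0) n.+1 x0.
  rewrite /= in_itv/= => x01.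
  rewrite /gpoly !fct_sumE !big_nat_recl//= !fctE /GRing.scale /= mul0r add0r.
  by rewrite gpowE// subrr powRr0 Gamma1 divr1 mulr1.
have h1 : f 1 - gpoly (c' r) n.+1 1 = 0 by rewrite (E 1)// /r subrK subrr.
have := is_derive_within0_cst (Hd r) Ix; rewrite !fctE h1.
by move=> /eqP; rewrite subr_eq0 => /eqP.
Qed.

(** Letting $x\to0$ kills the constant coefficient; dividing by $x$ lowers the degree and the
    exponent of the bound together. *)
Lemma polynomial_small_coef0 (n : nat) (b : nat -> R) C :
  (forall x, I x -> `|\sum_(0 <= j < n.+1) b j * x ^+ j| <= C * x ^+ n) ->
  forall j, (j < n)%N -> b j = 0.
Proof.
elim: n b => [//|n IH] b H.
pose S x := \sum_(0 <= j < n.+1) b j.+1 * x ^+ j.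
have HS x : I x -> `|b 0%N + x * S x| <= C * x ^+ n.+1.
  move=> Ix; apply: le_trans (H x Ix); rewrite big_nat_recl//= expr0 mulr1.
  have -> : x * S x = \sum_(0 <= j < n.+1) b j.+1 * x ^+ j.+1.
    by rewrite /S mulr_sumr; apply: eq_bigr => j _; rewrite exprS mulrCA.
  exact: lexx.
have C0 : 0 <= C.
  have := HS 1; rewrite /= in_itv/= ltr01 lexx expr1n mulr1 => /(_ isT).
  exact: le_trans.
pose B := \sum_(0 <= j < n.+1) `|b j.+1|.
have B0 : 0 <= B by apply: sumr_ge0.
have SB x : I x -> `|S x| <= B.
  rewrite /= in_itv/= => /andP[x0 x1]; apply: (le_trans (ler_norm_sum _ _ _)).
  apply: ler_sum => j _; rewrite normrM ler_piMr// normrX (gtr0_norm x0).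
  by rewrite exprn_ile1// ltW.
have b0 : b 0%N = 0.
  apply/eqP; rewrite -normr_le0; apply/ler_addgt0Pr => e e0; rewrite add0r.
  (* For $x\le1$ one has $|b_0|\le(B+C)x$, and this $x$ makes the right side at most [e]; the added
     1 keeps the denominator positive. *)
  pose x := Num.min 1 (e / (B + C + 1)).
  have BC0 : 0 < B + C + 1 by rewrite ltr_wpDl// addr_ge0.
  have x0 : 0 < x by rewrite lt_min ltr01 divr_gt0.
  have x1 : x <= 1 by rewrite ge_min lexx.
  have Ix : I x by rewrite /= in_itv/= x0.
  have xe : (B + C) * x <= e.
    apply: (@le_trans _ _ ((B + C + 1) * x)).
      by rewrite ler_pM2r// lerDl.
    by rewrite mulrC -ler_pdivlMr// ge_min lexx orbT.
  rewrite -(addrK (x * S x) (b 0%N)); apply: (le_trans (ler_normB _ _)).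
  apply: le_trans xe; rewrite mulrDl addrC; apply: lerD.
    by rewrite normrM (gtr0_norm x0) mulrC ler_pM2r// SB.
  apply: (le_trans (HS x Ix)); rewrite ler_wpM2l//.
  by rewrite exprS ler_piMr ?(ltW x0)// exprn_ile1// ltW.
case=> [//|j]; rewrite ltnS => jn.
apply: (IH (fun j => b j.+1)) jn => x Ix.
have := HS x Ix; rewrite b0 add0r normrM exprS mulrCA.
move: Ix; rewrite /= in_itv/= => /andP[x0 x1].
by rewrite (gtr0_norm x0) ler_pM2l.
Qed.

(** A bound $O(t^n)$ leaves no room for monomials of degree below [n]. In the inversion this
    discards all solutions of the homogeneous equation but $t^{a-1}$. *)
Lemma gpoly_tame (n : nat) (c : nat -> R) L : tame n.+1%:R L ->
  (forall x, I x -> L x = gpoly c n.+1 x) -> L = c n *: gpow n.+1%:R.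
Proof.
move=> tL Lc; have [_ _ [C hC]] := tL.
pose b j := c j / Gamma (j.+1%:R : R).
have gE x j : 0 < x <= 1 -> c j * gpow j.+1%:R x = b j * x ^+ j.
  move=> x01; rewrite gpowE// -natr1 addrK powR_mulrn; last by case/andP: x01 => /ltW.
  by rewrite natr1 /b mulrCA mulrC.
have LE x : I x -> L x = \sum_(0 <= j < n.+1) b j * x ^+ j.
  move=> Ix; rewrite Lc// /gpoly fct_sumE; apply: eq_bigr => j _.
  by rewrite fctE; apply: gE; move: Ix; rewrite /= in_itv.
have bn : forall j, (j < n)%N -> b j = 0.
  apply: (@polynomial_small_coef0 n b C) => x Ix; rewrite -LE//; apply: le_trans (hC x) _.
  move: Ix; rewrite /= in_itv/= => x01; rewrite /upow /unit_cut x01.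
  by rewrite -natr1 addrK powR_mulrn//; case/andP: x01 => /ltW.
apply/funext => x; have [x01|x01] := boolP (0 < x <= 1); last first.
  rewrite (tame_supp tL) ?(negbTE x01)// fctE (tame_supp (tame_gpow _)) ?scaler0 ?ltr0n//.
  exact: negbTE.
rewrite LE ?in_itv//= fctE -[RHS]/(c n * _) gE// big_nat_recr//= big_nat big1 ?add0r//.
by move=> j /andP[_ jn]; rewrite bn// mul0r.
Qed.

(* [L] below has n+1 vanishing derivatives, hence is a polynomial of degree n; as
   it is O(t^n) it is a multiple of [gpow n.+1%:R], that is, the Riemann-Liouville
   integral of order n+1-a of a multiple of [gpow a]. *)
Lemma RL_inversion (n : nat) a v g : 0 < a -> 0 < n.+1%:R - a -> 1 <= a ->
  tame a v -> {within I, continuous v} -> tame 1 g -> {within I, continuous g} ->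
  is_derive_n_within I n.+1 (conv (gpow (n.+1%:R - a)) v) g ->
  exists c, v = c *: gpow a + conv (gpow a) g.
Proof.
move=> a0 b0 a1 tv cv tg cg Hv; set b := n.+1%:R - a in b0 Hv.
have n0 : 0 < n.+1%:R :> R by rewrite ltr0n.
have ban : b + a = n.+1%:R by rewrite subrK.
have abn : a + b = n.+1%:R by rewrite addrC.
pose L := conv (gpow b) v - conv (gpow n.+1%:R) g.
have tng : tame n.+1%:R (conv (gpow n.+1%:R) g).
  by apply: tame_le (tame_conv (tame_gpow n0) tg); rewrite n0 lerDl ler01.
have tbv : tame n.+1%:R (conv (gpow b) v).
  by rewrite -ban; exact: tame_conv (tame_gpow b0) tv.
have tL : tame n.+1%:R L by exact: tameB.
have HL : is_derive_n_within I n.+1 L (0 : R -> R).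
  rewrite -(subrr g); apply: is_derive_n_withinB => //.
  by have := gpow_n_conv_derive n 0 tg cg; rewrite scale0r add0r.
have [cs /(gpoly_tame tL) LE] := is_derive_n_within0 HL.
set c := cs n in LE; exists c.
have tag : tame a (conv (gpow a) g).
  by apply: tame_le (tame_conv (tame_gpow a0) tg); rewrite a0 lerDl ler01.
have tcp : tame a (c *: gpow a) by apply: tameZ; exact: tame_gpow.
have tw : tame a (c *: gpow a + conv (gpow a) g) by exact: tameD.
have tz : tame a (v - (c *: gpow a + conv (gpow a) g)) by exact: tameB.
have bz : conv (gpow b) (v - (c *: gpow a + conv (gpow a) g)) = 0.
  rewrite (convBr (tame_gpow b0) tv tw) (convDr (tame_gpow b0) tcp tag).
  rewrite (convZr c (tame_gpow b0) (tame_gpow a0)) conv_gpow//.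
  rewrite -(conv_assoc (tame_gpow b0) (tame_gpow a0) tg) conv_gpow// ban -LE /L.
  by rewrite subrK subrr.
(* Integrating further by order [a] brings the total order to an integer, where injectivity follows
   by differentiation. *)
have nz : conv (gpow n.+1%:R) (v - (c *: gpow a + conv (gpow a) g)) = 0.
  rewrite -abn -conv_gpow// (conv_assoc (tame_gpow a0) (tame_gpow b0) tz) bz.
  exact: conv0r.
apply/eqP; rewrite -subr_eq0; apply/eqP; apply: conv_inj_gpow nz.
  by apply: tame_le tz; rewrite ltr01.
rewrite -scaleN1r; apply: continuousD_within => //; apply: continuousZ_within.
apply: continuousD_within; first by apply: continuousZ_within; exact: gpow_continuous.
exact: (conv_continuous (tame_gpow a0) tg (lexx 1) cg).
Qed.

End ConvolutionCalculus.

(** * The linear boundary value problem *)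

Lemma fun_addE (R : realType) (f g : R -> R) t : (f + g) t = f t + g t.
Proof. by []. Qed.

Lemma fun_subE (R : realType) (f g : R -> R) t : (f - g) t = f t - g t.
Proof. by []. Qed.

Lemma fun_scaleE (R : realType) c (f : R -> R) t : (c *: f) t = c * f t.
Proof. by []. Qed.

Section LinearProblem.
Context {R : realType} (alpha lambda : R).
Hypothesis alpha12 : 1 < alpha <= 2.
Notation mu := (@lebesgue_measure R).
Implicit Types (c t x y s : R) (F G u : R -> R).

Local Notation I := (`]0, 1]%classic : set R).
Local Notation E := (ml alpha lambda alpha).
Local Notation E' := (ml alpha lambda (alpha - 1)).

Let alpha1 : 1 <= alpha. Proof. by case/andP: alpha12 => /ltW. Qed.
Let alpha0 : 0 < alpha. Proof. exact: lt_le_trans ltr01 alpha1. Qed.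
Let alpham1 : 0 < alpha - 1. Proof. by case/andP: alpha12; rewrite subr_gt0. Qed.

Lemma tame_E : tame alpha E. Proof. exact: tame_ml. Qed.
Lemma tame_E' : tame (alpha - 1) E'. Proof. exact: tame_ml. Qed.

Let tp : tame alpha (gpow alpha). Proof. exact: tame_gpow. Qed.

Lemma E_rec : E = gpow alpha + lambda *: conv (gpow alpha) E.
Proof. by rewrite (conv_ml lambda alpha1 alpha0 alpha0); exact: ml_rec. Qed.

Lemma convE_rec a G : tame a G ->
  conv E G = conv (gpow alpha) G + lambda *: conv (gpow alpha) (conv E G).
Proof.
move=> tG; rewrite {1}E_rec.
have tpE := tame_conv tp tame_E.
rewrite (convDl tp (tameZ lambda tpE) tG) (convZl lambda tpE tG).
by rewrite (conv_assoc tp tame_E tG).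
Qed.

(* Convolving the equation with E gives a second one; the resolvent identity
   [E = gpow alpha + lambda *: conv (gpow alpha) E] eliminates
   [conv (gpow alpha) G] and [conv E u] between the two. *)
Lemma volterra_resolvent c u F : tame 1 u -> tame 1 F ->
  u = c *: gpow alpha + conv (gpow alpha) (lambda *: u - F) ->
  u = c *: E - conv E F.
Proof.
move=> tu tF uE; set G := lambda *: u - F in uE.
have tlu := tameZ lambda tu; have tG : tame 1 G by exact: tameB.
have tpG := tame_conv tp tG; have tcp := tameZ c tp.
have e1 := convE_rec tG.
have e2 : conv E G = lambda *: conv E u - conv E F.
  by rewrite /G (convBr tame_E tlu tF) (convZr lambda tame_E tu).
have e3 : conv E u = c *: conv E (gpow alpha) + conv E (conv (gpow alpha) G).
  have t1 : tame 1 (c *: gpow alpha) by apply: tame_le tcp; rewrite ltr01.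
  have t2 : tame 1 (conv (gpow alpha) G).
    by apply: tame_le tpG; rewrite ltr01 lerDr ltW.
  by rewrite {1}uE (convDr tame_E t1 t2) (convZr c tame_E tp).
have e4 : conv (gpow alpha) (conv E G) = conv E (conv (gpow alpha) G).
  rewrite -(conv_assoc tp tame_E tG) -(conv_assoc tame_E tp tG).
  by rewrite (conv_comm tp tame_E).
have e5 := E_rec; rewrite (conv_comm tp tame_E) in e5.
rewrite e4 in e1.
apply/funext => t.
have := congr1 (@^~ t) uE; have := congr1 (@^~ t) e1; have := congr1 (@^~ t) e2.
have := congr1 (@^~ t) e3; have := congr1 (@^~ t) e5.
rewrite !(fun_subE, fun_addE, fun_scaleE).
move: (u t) (gpow _ t) (conv (gpow _) G t) (conv E G t) (conv E u t) (conv E F t) (E t)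
  (conv E (gpow _) t) (conv E (conv (gpow _) G) t) => z1 z2 z3 z4 z5 z6 z7 z8 z9.
move=> h5 h3 h2 h1 h0; rewrite h5 h0.
have : lambda * z5 - z6 = z3 + lambda * z9 by rewrite -h1 -h2.
rewrite h3 => hh.
have -> : z6 = lambda * (c * z8 + z9) - (z3 + lambda * z9) by rewrite -hh; ring.
ring.
Qed.

(** The converse of [volterra_resolvent], from [E_rec] and its convolution with [F]. *)
Lemma volterra_solution c F : tame 1 F ->
  let u := c *: E - conv E F in
  u = c *: gpow alpha + conv (gpow alpha) (lambda *: u - F).
Proof.
move=> tF u.
have tEF := tame_conv tame_E tF.
have tcE := tameZ c tame_E.
have tEF' : tame alpha (conv E F).
  by apply: tame_le tEF; rewrite alpha0 lerDl ler01.
have tu : tame alpha u by exact: tameB.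
have tu1 : tame 1 u by apply: tame_le tu; rewrite ltr01.
have e1 : conv (gpow alpha) (lambda *: u - F) =
    lambda *: (c *: conv (gpow alpha) E - conv (gpow alpha) (conv E F)) -
    conv (gpow alpha) F.
  rewrite (convBr tp (tameZ lambda tu1) tF) (convZr lambda tp tu1).
  by rewrite /u (convBr tp tcE tEF') (convZr c tp tame_E).
have e2 := convE_rec tF; have e3 := E_rec.
rewrite e1 /u; apply/funext => t.
have := congr1 (@^~ t) e2; have := congr1 (@^~ t) e3.
rewrite !(fun_subE, fun_addE, fun_scaleE).
move: (E t) (gpow _ t) (conv _ E t) (conv E F t) (conv _ F t) (conv _ (conv E F) t).
by move=> z1 z2 z3 z4 z5 z6 -> ->; ring.
Qed.

(* The derivative of [c *: E - conv E F]. *)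
Definition velocity c F : R -> R := c *: E' - conv E' F.

Lemma E_primitive : E = conv (gpow 1) E'.
Proof. by rewrite (conv_ml lambda alpha1 ltr01 alpham1) addrC subrK. Qed.

Lemma tame_convE'_F F : tame 1 F -> tame (alpha - 1) (conv E' F).
Proof.
by move=> tF; apply: tame_le (tame_conv tame_E' tF); rewrite alpham1 lerDl ler01.
Qed.

Lemma tame_velocity c F : tame 1 F -> tame (alpha - 1) (velocity c F).
Proof.
by move=> tF; apply: tameB; [exact: tameZ tame_E'|exact: tame_convE'_F].
Qed.

Lemma solution_primitive c F : tame 1 F ->
  c *: E - conv E F = conv (gpow 1) (velocity c F).
Proof.
move=> tF; have t1 := tame_gpow (@ltr01 R).
rewrite /velocity (convBr t1 (tameZ c tame_E') (tame_convE'_F tF)).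
by rewrite (convZr c t1 tame_E') -(conv_assoc t1 tame_E' tF) -E_primitive.
Qed.

Lemma continuousB_within F G : {within I, continuous F} -> {within I, continuous G} ->
  {within I, continuous (F - G)}.
Proof. by move=> cF cG x; apply: cvgB; [exact: cF|exact: cG]. Qed.

(** For $\alpha<2$ the function is unbounded at 0. Once its leading power is split off, a function
    of order $2\alpha-1>1$ remains, which is a convolution with the bounded kernel [gpow 1]. *)
Lemma continuous_E' : {within I, continuous E'}.
Proof.
rewrite (ml_rec lambda alpha1 alpham1).
apply: continuousD_within; first exact: gpow_continuous.
apply: continuousZ_within.
have a2 : 0 < alpha + (alpha - 1) - 1 by have := alpham1; lra.
rewrite -[alpha + (alpha - 1)](subrK 1) addrC -(conv_ml lambda alpha1 ltr01 a2).
have ta2 := tame_ml lambda alpha1 a2; have t1 := tame_gpow (@ltr01 R).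
rewrite (conv_comm t1 ta2).
by apply: (conv_continuous ta2 t1 (lexx _)); exact: gpow_continuous.
Qed.

Lemma continuous_velocity c F : tame 1 F -> {within I, continuous F} ->
  {within I, continuous (velocity c F)}.
Proof.
move=> tF cF; apply: continuousB_within.
  by apply: continuousZ_within; exact: continuous_E'.
exact: conv_continuous tame_E' tF (lexx 1) cF.
Qed.

Lemma solution_derive c F x : tame 1 F -> {within I, continuous F} -> I x ->
  is_derive_within I (c *: E - conv E F) x (velocity c F x).
Proof.
move=> tF cF Ix; rewrite (solution_primitive c tF).
apply: (conv1_derive (tame_velocity c tF) _ Ix); exact: continuous_velocity.
Qed.

Lemma tame_solution c F : tame 1 F -> tame alpha (c *: E - conv E F).
Proof.
move=> tF; apply: tameB; first exact: tameZ tame_E.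
by apply: tame_le (tame_conv tame_E tF); rewrite alpha0 lerDl ler01.
Qed.

(** The remainder is $O(t^\alpha)$, one order better than the solution. Together with
    [velocity_expansion] this controls the weighted solution and its derivative at 0. *)
Lemma solution_expansion c F : tame 1 F ->
  tame (alpha + 1) (c *: E - conv E F - c *: gpow alpha).
Proof.
move=> tF.
have -> : c *: E - conv E F - c *: gpow alpha =
    (c * lambda) *: ml alpha lambda (alpha + alpha) - conv E F.
  rewrite {1}(ml_rec lambda alpha1 alpha0) scalerDr scalerA.
  by rewrite addrAC (addrC (c *: _)) addrK.
apply: tameB; last exact: tame_conv tame_E tF.
apply: tameZ; have a2 : 0 < alpha + alpha by rewrite addr_gt0.
by apply: tame_le (tame_ml lambda alpha1 a2); rewrite addr_gt0//= lerD2l.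
Qed.

Lemma velocity_expansion c F : tame 1 F ->
  tame alpha (velocity c F - c *: gpow (alpha - 1)).
Proof.
move=> tF.
have -> : velocity c F - c *: gpow (alpha - 1) =
    (c * lambda) *: ml alpha lambda (alpha + (alpha - 1)) - conv E' F.
  rewrite /velocity {1}(ml_rec lambda alpha1 alpham1) scalerDr scalerA.
  by rewrite addrAC (addrC (c *: _)) addrK.
apply: tameB.
  apply: tameZ; have a2 : 0 < alpha + (alpha - 1) by rewrite addr_gt0.
  by apply: tame_le (tame_ml lambda alpha1 a2); rewrite alpha0 lerDl ltW.
by have := tame_conv tame_E' tF; rewrite subrK.
Qed.

(* The multiple of E is chosen so that the derivative vanishes at 1. *)
Definition solop F : R -> R := (conv E' F 1 / E' 1) *: E - conv E F.

Lemma solop_unique c F : E' 1 != 0 -> velocity c F 1 = 0 ->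
  c *: E - conv E F = solop F.
Proof.
move=> E1; rewrite /velocity !(fun_subE, fun_addE, fun_scaleE) => /eqP.
by rewrite subr_eq0 => /eqP h; rewrite /solop -h mulfK.
Qed.

Lemma velocity_solop F : E' 1 != 0 -> velocity (conv E' F 1 / E' 1) F 1 = 0.
Proof. by move=> E1; rewrite /velocity !(fun_subE, fun_addE, fun_scaleE) divfK// subrr. Qed.

Lemma tame_solop F : tame 1 F -> tame alpha (solop F).
Proof. exact: tame_solution. Qed.

End LinearProblem.

Local Opaque mittag_leffler.

(** * The Green function and its integral bounds *)

Section GreenFunction.
Context {R : realType} (alpha lambda : R).
Hypothesis alpha12 : 1 < alpha <= 2.
Notation mu := (@lebesgue_measure R).
Implicit Types (c t x y s : R) (F G u : R -> R).

Local Notation I := (`]0, 1]%classic : set R).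
Local Notation E := (ml alpha lambda alpha).
Local Notation E' := (ml alpha lambda (alpha - 1)).

Let alpha1 : 1 <= alpha. Proof. by case/andP: alpha12 => /ltW. Qed.
Let alpha0 : 0 < alpha. Proof. exact: lt_le_trans ltr01 alpha1. Qed.
Let alpham1 : 0 < alpha - 1. Proof. by case/andP: alpha12; rewrite subr_gt0. Qed.
Let tE : tame alpha E. Proof. exact: tame_E. Qed.
Let tE' : tame (alpha - 1) E'. Proof. exact: tame_E'. Qed.

Lemma ml_pred_at1 : E' 1 = mittag_leffler alpha (alpha - 1) lambda.
Proof. by rewrite mlE ?ltr01 ?lexx// !powR1 mul1r mulr1. Qed.

(** [E] vanishes at nonpositive arguments, which replaces the case distinction of [green]. *)
Definition kernel t s : R := E t * E' (1 - s) / E' 1 - E (t - s).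

Lemma kernel_green t s : 0 < t <= 1 -> 0 < s < 1 ->
  kernel t s = green alpha lambda t s.
Proof.
move=> t01 /andP[s0 s1]; have /andP[t0 t1] := t01.
have s1' : 0 < 1 - s by rewrite subr_gt0.
rewrite /kernel /green ml_pred_at1.
have -> : E t * E' (1 - s) / mittag_leffler alpha (alpha - 1) lambda =
    t `^ (alpha - 1) * mittag_leffler alpha alpha (lambda * t `^ alpha) *
    mittag_leffler alpha (alpha - 1) (lambda * (1 - s) `^ alpha) /
    ((1 - s) `^ (2 - alpha) * mittag_leffler alpha (alpha - 1) lambda).
  rewrite (mlE _ _ _ t01) mlE ?s1' ?lerBlDr ?lerDl ?(ltW s0)//.
  have -> : (1 - s) `^ (alpha - 1 - 1) = ((1 - s) `^ (2 - alpha))^-1.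
    by rewrite -powRN; congr powR; ring.
  have gen (p q r w z : R) : p * q * (w^-1 * r) / z = p * q * r / (w * z).
    by rewrite invfM; ring.
  exact: gen.
case: (leP s t) => st; last first.
  by rewrite (tame_supp tE) ?subr0// subr_gt0 ltNge (ltW st).
congr (_ - _).
have ts1 : t - s <= 1 by rewrite lerBlDr (le_trans t1)// lerDl ltW.
have [ts|ts] := ltP 0 (t - s); first by rewrite mlE ?ts.
(* On the diagonal [green] has the factor $0^{\alpha-1}$, which is 0 because $\alpha>1$. *)
have -> : t - s = 0 by apply/eqP; rewrite eq_le ts subr_ge0 st.
by rewrite powR0 ?mul0r ?(tame_supp tE) ?ltxx// gt_eqF.
Qed.

Lemma kernel_integrand F t s : kernel t s * F s =
  (E t / E' 1) * (E' (1 - s) * F s) - E (t - s) * F s.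
Proof.
have gen (p q r z w : R) : (p * q / r - z) * w = p / r * (q * w) - z * w by ring.
exact: gen.
Qed.

Lemma kernel_integrable F t : tame 1 F ->
  mu.-integrable setT (fun s => (kernel t s * F s)%:E).
Proof.
move=> tF.
have i1 : mu.-integrable setT (fun s => (E t / E' 1 * (E' (1 - s) * F s))%:E).
  apply: (@integrableZl _ _ _ mu _ measurableT (E t / E' 1)
     (fun s => (E' (1 - s) * F s)%:E)).
  exact: conv_integrable tE' tF.
have i2 := conv_integrable t tE tF.
have -> : (fun s => (kernel t s * F s)%:E) =
    (fun s => (E t / E' 1 * (E' (1 - s) * F s))%:E - (E (t - s) * F s)%:E)%E.
  by apply/funext => s; rewrite -EFinB; congr EFin; exact: kernel_integrand.
exact: (@integrableB _ _ _ mu _ measurableT _ _ i1 i2).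
Qed.

Lemma solop_kernel F t : tame 1 F -> I t ->
  solop alpha lambda F t = \int[mu]_s (kernel t s * F s).
Proof.
move=> tF; rewrite /= in_itv/= => t01.
have i1 := conv_integrable 1 tE' tF.
have i1' : mu.-integrable setT (EFin \o (fun s => E t / E' 1 * (E' (1 - s) * F s))).
  exact: (@integrableZl _ _ _ mu _ measurableT (E t / E' 1)
     (fun s => (E' (1 - s) * F s)%:E)).
have i2 := conv_integrable t tE tF.
transitivity (\int[mu]_s (E t / E' 1 * (E' (1 - s) * F s) - E (t - s) * F s)).
  rewrite (RintegralB measurableT i1' i2) (RintegralZl _ measurableT i1).
  have h1 : conv E' F 1 = \int[mu]_s (E' (1 - s) * F s).
    rewrite /conv /unit_cut ltr01 lexx; reflexivity.
  have h2 : conv E F t = \int[mu]_s (E (t - s) * F s).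
    rewrite /conv /unit_cut t01; reflexivity.
  have gen (p q r w : R) : p / q * r - w = r / q * p - w by ring.
  exact: (etrans (congr2 (fun p q => p / E' 1 * E t - q) h1 h2) (gen _ _ _ _)).
by apply: eq_Rintegral => s _; apply/esym; exact: kernel_integrand.
Qed.

(** $s(1-s)^{\alpha-2}$ on $]0,1[$ and 0 elsewhere, factored so that its integrals are convolutions
    evaluated at 1. *)
Definition weight s : R := upow (alpha - 1) (1 - s) * upow 2 s.

Lemma weightE s : 0 < s < 1 -> weight s = s * (1 - s) `^ (alpha - 2).
Proof.
move=> /andP[s0 s1]; rewrite /weight /upow /unit_cut s0 (ltW s1) subr_gt0 s1.
rewrite lerBlDr lerDl (ltW s0) /= mulrC; congr (_ * (_ `^ _)); last by ring.
by rewrite -[RHS](powRr1 (ltW s0)); congr powR; ring.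
Qed.

Lemma weight_ge0 s : 0 <= weight s.
Proof. by rewrite mulr_ge0 ?upow_ge0. Qed.

Definition wint F : R := \int[mu]_s (weight s * F s).

Let tame_up2 F : tame 1 F -> tame 2 (fun s => upow 2 s * F s).
Proof.
move=> [_ mF [C hC]]; have t2 : tame 2 (upow 2 : R -> R) by exact: tame_upow.
split => //; first by apply: measurable_funM => //; exact: tame_measurable t2.
exists C => s; rewrite normrM ger0_norm ?upow_ge0// mulrC ler_wpM2r ?upow_ge0//.
apply: (le_trans (hC s)); rewrite /upow /unit_cut.
have C0 : 0 <= C.
  have := hC 1; rewrite /upow /unit_cut ltr01 lexx /= powR1 mulr1.
  exact: le_trans.
by case: ifP => _; rewrite ?mulr0// subrr powRr0 mulr1.
Qed.

Lemma weight_integrable F : tame 1 F -> mu.-integrable setT (fun s => (weight s * F s)%:E).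
Proof.
move=> tF; have := conv_integrable 1 (tame_upow alpham1) (tame_up2 tF).
by apply: eq_integrable => // s _; rewrite /weight mulrA.
Qed.

(** [upow 1] is the indicator of $]0,1]$, so the integral is
    $B(\alpha-1,2)=\Gamma(\alpha-1)/\Gamma(\alpha+1)$. *)
Lemma wint_upow : wint (upow 1) = (alpha * (alpha - 1))^-1.
Proof.
have := congr1 (@^~ 1) (conv_upow alpham1 (ltr0Sn R 1)).
rewrite /conv /unit_cut ltr01 lexx /= fctE /GRing.scale /= /rconv.
rewrite [upow _ 1]/upow /unit_cut ltr01 lexx /= powR1 mulr1 => h.
transitivity (\int[mu]_s (upow (alpha - 1) (1 - s) * upow 2 s)).
  apply: eq_Rintegral => s _; rewrite /weight -mulrA; congr (_ * _).
  rewrite /upow /unit_cut; by case: ifP => _; rewrite ?mulr0// subrr powRr0 mulr1.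
rewrite h /beta_coeff.
have -> : Gamma (2 : R) = 1.
  by rewrite -[2%:R]natr1 GammaS// Gamma1 mulr1.
have -> : Gamma (alpha - 1 + 2) = alpha * ((alpha - 1) * Gamma (alpha - 1)).
  rewrite -(GammaS alpham1) subrK -(GammaS alpha0); congr Gamma; ring.
have := Gamma_gt0 alpham1; move: (Gamma (alpha - 1)) => g g0.
by field; rewrite !gt_eqF//= subr_gt0; case/andP: alpha12.
Qed.

Lemma wintZ c F : tame 1 F -> wint (c *: F) = c * wint F.
Proof.
move=> tF; rewrite /wint -(RintegralZl c measurableT (weight_integrable tF)).
by apply: eq_Rintegral => s _; rewrite fctE /GRing.scale /=; ring.
Qed.

Context (m : R -> R) (M : R).
Hypothesis m_ge0 : forall t, 0 < t < 1 -> 0 <= m t.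
Hypothesis hmM : forall t s, 0 < t < 1 -> 0 < s < 1 ->
  m t * weight s <= t `^ (2 - alpha) * kernel t s <= M * weight s.

Let kernel_out F t s : tame 1 F -> 0 < t < 1 -> ~~ (0 < s < 1) -> kernel t s * F s = 0.
Proof.
move=> tF /andP[t0 t1] s01; have [->|Fs0] := eqVneq (F s) 0; first by rewrite mulr0.
have s0 := tame_gt0 tF Fs0; move: s01; rewrite s0 /= -leNgt => s1.
have e1 : E' (1 - s) = 0 by apply: (tame_supp tE'); rewrite subr_gt0 ltNge s1.
have e2 : E (t - s) = 0.
  by apply: (tame_supp tE); rewrite subr_gt0 ltNge (le_trans (ltW t1)).
by rewrite /kernel e1 e2 mulr0 mul0r subrr mul0r.
Qed.

Let weight_out s : ~~ (0 < s < 1) -> weight s = 0.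
Proof.
rewrite negb_and -!leNgt => /orP[s0|s1].
  by rewrite /weight [upow 2 s]/upow /unit_cut ltNge s0 mulr0.
by rewrite /weight {1}/upow /unit_cut subr_gt0 ltNge s1 mul0r.
Qed.

Let solopZ F t : tame 1 F -> 0 < t < 1 -> t `^ (2 - alpha) * solop alpha lambda F t =
  \int[mu]_s (t `^ (2 - alpha) * (kernel t s * F s)).
Proof.
move=> tF /andP[t0 t1]; rewrite (RintegralZl _ measurableT (kernel_integrable t tF)).
by rewrite -solop_kernel//= in_itv/= t0 ltW.
Qed.

Let solopZ_integrable F t : tame 1 F ->
  mu.-integrable setT (fun s => (t `^ (2 - alpha) * (kernel t s * F s))%:E).
Proof.
move=> tF; exact: (@integrableZl _ _ _ mu _ measurableT _ _ (kernel_integrable t tF)).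
Qed.

Let weightZ_integrable c F : tame 1 F ->
  mu.-integrable setT (fun s => (c * (weight s * F s))%:E).
Proof.
move=> tF; exact: (@integrableZl _ _ _ mu _ measurableT _ _ (weight_integrable tF)).
Qed.

Lemma solop_ge F t : tame 1 F -> (forall s, 0 <= F s) -> 0 < t < 1 ->
  m t * wint F <= t `^ (2 - alpha) * solop alpha lambda F t.
Proof.
move=> tF F0 t01; rewrite solopZ//.
rewrite /wint -(RintegralZl _ measurableT (weight_integrable tF)).
apply: (le_Rintegral measurableT _ (solopZ_integrable _ tF)).
  exact: weightZ_integrable.
move=> s _; have [s01|s01] := boolP (0 < s < 1).
  have /andP[h _] := hmM t01 s01.
  by rewrite (mulrA (m t) (weight s)) (mulrA _ (kernel t s)) ler_wpM2r.
by rewrite (kernel_out tF t01 s01) (weight_out s01) mul0r !mulr0.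
Qed.

Lemma solop_norm_le F G t : tame 1 F -> tame 1 G -> (forall s, `|F s| <= G s) ->
  0 < t < 1 -> `|t `^ (2 - alpha) * solop alpha lambda F t| <= M * wint G.
Proof.
move=> tF tG FG t01; rewrite solopZ//.
rewrite /wint -(RintegralZl _ measurableT (weight_integrable tG)).
apply: (@le_trans _ _ (\int[mu]_s `|t `^ (2 - alpha) * (kernel t s * F s)|)).
  exact: le_normr_Rintegral (solopZ_integrable t tF).
apply: le_Rintegral => //.
- by apply: integrable_norm; exact: solopZ_integrable.
- exact: weightZ_integrable.
move=> s _; have [s01|s01] := boolP (0 < s < 1); last first.
  by rewrite (kernel_out tF t01 s01) (weight_out s01) mul0r !mulr0 normr0.
have /andP[h1 h2] := hmM t01 s01.
(* As $m\ge0$, the lower bound gives the sign of the kernel, and the upper bound then controls its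
   absolute value. *)
have k0 : 0 <= t `^ (2 - alpha) * kernel t s.
  by apply: le_trans h1; rewrite mulr_ge0 ?weight_ge0// m_ge0.
by rewrite (mulrA _ (kernel t s)) normrM (ger0_norm k0) (mulrA M (weight s)) ler_pM.
Qed.

End GreenFunction.

(** * The nonlinear problem *)

Section FixedPoint.
Context {R : realType} (alpha lambda : R).
Hypothesis alpha12 : 1 < alpha <= 2.
Implicit Types (c t x y s : R) (F G w : R -> R).

Local Notation I := (`]0, 1]%classic : set R).
Local Notation E := (ml alpha lambda alpha).
Local Notation E' := (ml alpha lambda (alpha - 1)).

Let alpha1 : 1 <= alpha. Proof. by case/andP: alpha12 => /ltW. Qed.
Let alpha0 : 0 < alpha. Proof. exact: lt_le_trans ltr01 alpha1. Qed.
Let alpham1 : 0 < alpha - 1. Proof. by case/andP: alpha12; rewrite subr_gt0. Qed.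

Lemma solopB F G : tame 1 F -> tame 1 G ->
  solop alpha lambda (F - G) = solop alpha lambda F - solop alpha lambda G.
Proof.
move=> tF tG; have tE := tame_E lambda alpha12; have tE' := tame_E' lambda alpha12.
rewrite /solop (convBr tE tF tG) (convBr tE' tF tG) fun_subE mulrBl scalerBl.
by rewrite !opprD !opprK addrACA.
Qed.

Context (m : R -> R) (M : R).
Hypothesis M_gt0 : 0 < M.
Hypothesis m_ge0 : forall t, 0 < t < 1 -> 0 <= m t.
Hypothesis hmM : forall t s, 0 < t < 1 -> 0 < s < 1 ->
  m t * weight alpha s <= t `^ (2 - alpha) * kernel alpha lambda t s <= M * weight alpha s.

(** Carries estimates to $t=1$, which the assumed bounds on the kernel do not cover. *)
Lemma continuous_le_at1 F c : {within I, continuous F} ->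
  (forall t, 0 < t < 1 -> F t <= c) -> F 1 <= c.
Proof.
move=> /continuous_withinP cF Fc; have I1 : I 1 by rewrite /= in_itv/= ltr01 lexx.
apply/ler_addgt0Pr => e e0; have [d d0 dP] := cF 1 I1 e e0.
pose t := 1 - Num.min d 1 / 2.
have md : 0 < Num.min d 1 by rewrite lt_min d0 ltr01.
have [m1 m2] : Num.min d 1 <= d /\ Num.min d 1 <= 1 by rewrite !ge_min !lexx orbT.
have t01 : 0 < t < 1 by rewrite /t; apply/andP; split; lra.
have It : I t by rewrite /= in_itv/=; case/andP: t01 => -> /ltW ->.
have td : `|t - 1| < d.
  by rewrite /t addrAC subrr add0r normrN gtr0_norm ?divr_gt0//; lra.
have := dP t It td; rewrite ltr_norml => /andP[h _].
have := Fc t t01; lra.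
Qed.

Lemma solop_weighted_derive F x : tame 1 F -> {within I, continuous F} -> I x ->
  is_derive_within I (fun t => t `^ (2 - alpha) * solop alpha lambda F t) x
   ((2 - alpha) * x `^ (1 - alpha) * solop alpha lambda F x +
    x `^ (2 - alpha) * velocity alpha lambda (conv E' F 1 / E' 1) F x).
Proof.
move=> tF cF Ix; apply: is_derive_withinM; last exact: solution_derive.
apply: is_derive_is_derive_within.
have -> : 1 - alpha = 2 - alpha - 1 by ring.
by apply: is_derive1_powR; move: Ix; rewrite /= in_itv/= => /andP[].
Qed.

Lemma continuous_solop_weighted F : tame 1 F -> {within I, continuous F} ->
  {within I, continuous (fun t => t `^ (2 - alpha) * solop alpha lambda F t)}.
Proof.
move=> tF cF.
exact: is_derive_within_continuous (fun x Ix => solop_weighted_derive tF cF Ix).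
Qed.

Lemma continuous_norm_within F : {within I, continuous F} ->
  {within I, continuous (fun t => `|F t|)}.
Proof. by move=> cF x; apply: cvg_norm; exact: cF. Qed.

Lemma solop_norm_bound F B t : tame 1 F -> {within I, continuous F} ->
  (forall s, `|F s| <= B * upow 1 s) -> I t ->
  `|t `^ (2 - alpha) * solop alpha lambda F t| <= M * (B / (alpha * (alpha - 1))).
Proof.
move=> tF cF FB.
have tB : tame 1 (B *: upow 1) by apply: tameZ; exact: tame_upow.
have lt1 x : 0 < x < 1 ->
    `|x `^ (2 - alpha) * solop alpha lambda F x| <= M * (B / (alpha * (alpha - 1))).
  rewrite -(wint_upow alpha12) -(wintZ alpha12 B (tame_upow ltr01)).
  exact: (solop_norm_le alpha12 m_ge0 hmM tF tB FB).
rewrite /= in_itv/= => /andP[t0]; rewrite le_eqVlt => /predU1P[->|t1]; last first.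
  by apply: lt1; rewrite t0.
apply: (continuous_le_at1 (F := fun t => `|t `^ (2 - alpha) * solop alpha lambda F t|)) => //.
apply: continuous_norm_within; exact: continuous_solop_weighted.
Qed.

Context (f : R -> R -> R) (K : R).
Hypothesis f_cont : {within `[0, 1] `*` `[0, +oo[,
  continuous (fun p : R * R => f p.1 p.2)}.
Hypothesis K_gt0 : 0 < K.
Hypothesis f_lip : forall t x y, t \in `[0, 1] -> 0 <= x -> 0 <= y ->
     `|f t x - f t y| <= K * `|x - y|.

Lemma source_continuous (D : set R) w : D `<=` `[0, 1] -> {within D, continuous w} ->
  {within D, continuous (fun s => f s (Num.max 0 (w s)))}.
Proof.
move=> D01 cw; apply/subspace_continuousP => x Dx.
pose g s : R * R := (s, Num.max 0 (w s)).
have gD s : D s -> (`[0, 1] `*` `[0, +oo[)%classic (g s).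
  move=> Ds; split; first exact: D01.
  by rewrite /= in_itv/= andbT le_max lexx.
have gx : g s @[s --> within D (nbhs x)] --> g x.
  apply: (@cvg_pair _ _ _ (within D (nbhs x)) (nbhs x) (nbhs (Num.max 0 (w x)))).
    exact: cvg_within.
  apply: (@continuous_cvg _ _ _ (within D (nbhs x)) _ w (Num.max 0) (w x)); last by move/subspace_continuousP : cw; exact.
  apply: (@continuous_max _ _ (cst 0) id); [exact: cst_continuous|exact: id].
move/subspace_continuousP : f_cont => /(_ _ (gD x Dx)) fg.
move=> P HP; have H := gx _ (fg P HP).
change (nbhs x (fun s => D s -> P (f s (Num.max 0 (w s))))).
apply: (@filterS _ (nbhs x) _ _ _ _ H) => s Hs Ds; exact: Hs Ds (gD s Ds).
Qed.

(* Truncating at 0 defines the operator on all bounded functions; its fixed points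
   are nonnegative anyway. *)
Definition source w : R -> R := unit_cut (fun s => f s (Num.max 0 (w s))).

(* The weighted form of the operator whose fixed points are the solutions. *)
Definition picard w t : R := t `^ (2 - alpha) * solop alpha lambda (source w) t.

(** Boundedness stands in for a value at 0, so that the iteration takes place on $]0,1]$ alone. *)
Definition bounded_continuous w : Prop :=
  {within I, continuous w} /\ exists B, forall t, I t -> `|w t| <= B.

Lemma unit_cut_continuous w : {within I, continuous w} -> {within I, continuous (unit_cut w)}.
Proof.
move=> /continuous_withinP cw; apply/continuous_withinP => x Ix e e0.
have [d d0 dP] := cw x Ix e e0; exists d => // y Iy yxd.
have cutE z : I z -> unit_cut w z = w z by rewrite /= in_itv/= /unit_cut => ->.
by rewrite !cutE//; exact: dP.
Qed.

Lemma source_continuous_I w : bounded_continuous w -> {within I, continuous (source w)}.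
Proof.
move=> [cw _]; apply: unit_cut_continuous; apply: source_continuous => //.
by move=> x; rewrite /= !in_itv/= => /andP[/ltW -> ->].
Qed.

Lemma max0_lip (x y : R) : `|Num.max 0 x - Num.max 0 y| <= `|x - y|.
Proof.
have h1 := ler_norm (x - y); have h2 := ler_norm (y - x).
rewrite (distrC y x) in h2; rewrite ler_norml.
by case: (leP 0 x) => hx; case: (leP 0 y) => hy; apply/andP; split; lra.
Qed.

Lemma source_dist w w' B s : (forall t, I t -> `|w t - w' t| <= B) ->
  `|source w s - source w' s| <= K * B * upow 1 s.
Proof.
move=> ww; rewrite /source /upow /unit_cut; case: ifP => s01; last first.
  by rewrite subrr normr0 mulr0.
rewrite subrr powRr0 mulr1.
have s01' : s \in `[0, 1] by rewrite in_itv/=; case/andP: s01 => /ltW -> ->.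
apply: (le_trans (f_lip s01' _ _)); rewrite ?le_max ?lexx//.
rewrite ler_pM2l//; apply: (le_trans (max0_lip _ _)).
by apply: ww; rewrite /= in_itv/=.
Qed.

Lemma tame_source w : bounded_continuous w -> tame 1 (source w).
Proof.
move=> bw; have [cw [B wB]] := bw; split => //.
  apply: measurable_unit_cut; apply: subspace_continuous_measurable_fun => //.
  apply: source_continuous => //.
  by move=> x; rewrite /= !in_itv/= => /andP[/ltW -> ->].
(* The function $s\mapsto f(s,0)$ is bounded on the compact interval; the Lipschitz condition bounds
   the deviation from it. *)
have c0 : {within `[0, 1], continuous (fun s => f s (Num.max 0 ((cst 0 : R -> R) s)))}.
  by apply: source_continuous => // x; exact: cvg_cst.
have c0' : {within `[0, 1], continuous (fun s => `|f s (Num.max 0 0)|)}.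
  by move=> x; apply: cvg_norm; exact: c0.
have [c _ cmax] := EVT_max ler01 c0'.
exists (`|f c (Num.max 0 0)| + K * B) => s.
rewrite /source /upow /unit_cut; case: ifP => s01; last by rewrite normr0 mulr0.
have s01' : s \in `[0, 1] by rewrite in_itv/=; case/andP: s01 => /ltW -> ->.
have Is : I s by rewrite /= in_itv/=.
rewrite subrr powRr0 mulr1 -[f s _](subrK (f s (Num.max 0 0))) addrC.
apply: (le_trans (ler_normD _ _)); apply: lerD; first exact: cmax.
apply: (le_trans (f_lip s01' _ _)); rewrite ?le_max ?lexx//.
rewrite ler_pM2l//; apply: (le_trans (max0_lip _ _)).
by rewrite subr0; exact: wB.
Qed.

Definition ratio : R := K * M / (alpha * (alpha - 1)).

Lemma picard_dist w w' B t : bounded_continuous w -> bounded_continuous w' ->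
  (forall t, I t -> `|w t - w' t| <= B) -> I t ->
  `|picard w t - picard w' t| <= ratio * B.
Proof.
move=> bw bw' ww It.
have tw := tame_source bw; have tw' := tame_source bw'.
have -> : picard w t - picard w' t =
    t `^ (2 - alpha) * solop alpha lambda (source w - source w') t.
  by rewrite (solopB tw tw') fun_subE mulrBr.
have -> : ratio * B = M * (K * B / (alpha * (alpha - 1))) by rewrite /ratio; ring.
apply: solop_norm_bound => //.
- exact: tameB.
- by apply: continuousB_within; exact: source_continuous_I.
- by move=> s; exact: source_dist.
Qed.

Lemma bounded_continuous_picard w : bounded_continuous w -> bounded_continuous (picard w).
Proof.
move=> bw; have tw := tame_source bw; have cw := source_continuous_I bw.
split; first exact: continuous_solop_weighted.
have [_ _ [C hC]] := tw.
exists (M * (C / (alpha * (alpha - 1)))) => t It; exact: solop_norm_bound.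
Qed.

Hypothesis ratio_lt1 : ratio < 1.

Let ratio_gt0 : 0 < ratio.
Proof. by rewrite divr_gt0 ?mulr_gt0. Qed.

Lemma bounded_continuous0 : bounded_continuous (cst 0).
Proof.
by split; [move=> x; exact: cvg_cst|exists 0 => t _; rewrite normr0].
Qed.

Definition iterate (n : nat) : R -> R := iter n picard (cst 0).

Lemma bounded_continuous_iterate n : bounded_continuous (iterate n).
Proof.
elim: n => [|n IH]; first exact: bounded_continuous0.
exact: bounded_continuous_picard.
Qed.

Lemma iterate_dist : exists2 B, 0 <= B & forall (n j : nat) t, I t ->
  `|iterate (n + j)%N t - iterate n t| <= B * ratio ^+ n.
Proof.
have [_ [B0 hB0]] := bounded_continuous_picard bounded_continuous0.
have I1 : I 1 by rewrite /= in_itv/= ltr01 lexx.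
have B00 : 0 <= B0 by exact: le_trans (hB0 1 I1).
have r1 : 0 < 1 - ratio by rewrite subr_gt0.
have step n t : I t -> `|iterate n.+1 t - iterate n t| <= B0 * ratio ^+ n.
  elim: n t => [|n IH] t It.
    by rewrite expr0 mulr1 /iterate /= subr0; exact: hB0.
  rewrite exprS mulrCA.
  exact: (picard_dist (bounded_continuous_iterate n.+1) (bounded_continuous_iterate n) IH).
exists (B0 / (1 - ratio)) => [|n j t It]; first by rewrite divr_ge0// ltW.
(* The factor [1 - ratio ^+ j] comes from the partial geometric sum and makes the induction on [j]
   close. *)
have : `|iterate (n + j) t - iterate n t| <=
    B0 / (1 - ratio) * ratio ^+ n * (1 - ratio ^+ j).
  elim: j => [|j IH]; first by rewrite addn0 !subrr normr0 mulr0.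
  have -> : B0 / (1 - ratio) * ratio ^+ n * (1 - ratio ^+ j.+1) =
      B0 * ratio ^+ (n + j) + B0 / (1 - ratio) * ratio ^+ n * (1 - ratio ^+ j).
    by rewrite exprS exprD; field; rewrite gt_eqF.
  rewrite addnS -[X in `|X|](subrKA (iterate (n + j) t)).
  apply: (le_trans (ler_normD _ _)); apply: lerD IH; exact: step.
move=> /le_trans; apply; rewrite ler_piMr//.
  by rewrite mulr_ge0 ?divr_ge0 ?exprn_ge0// ltW.
by rewrite lerBlDr lerDl exprn_ge0// ltW.
Qed.

Lemma cvg_ratio (B : R) : B * ratio ^+ n @[n --> \oo] --> 0.
Proof.
rewrite -(mulr0 B); apply: cvgM; first exact: cvg_cst.
by apply: cvg_expr; rewrite gtr0_norm.
Qed.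

(** Banach's argument carried out pointwise: the iterates converge at each point at a rate
    independent of it, so boundedness and continuity pass to the limit. *)
Lemma picard_fixpoint : exists2 w, bounded_continuous w &
  forall t, I t -> w t = picard w t.
Proof.
have [B B0 hB] := iterate_dist.
have cvg_it t : I t -> cvgn (fun n => iterate n t).
  move=> It; apply/cauchy_cvgP/cauchy_exP => e e0.
  have /cvgrPdist_lt/(_ e e0)[N _ /(_ N (leqnn N)) /=] := cvg_ratio B.
  rewrite sub0r normrN ger0_norm; last by rewrite mulr_ge0// exprn_ge0// ltW.
  move=> BN; exists (iterate N t); exists N => // n /= Nn.
  by rewrite /ball /= distrC -(subnKC Nn); apply: le_lt_trans BN; exact: hB.
pose w t := limn (fun n => iterate n t).
have wit n t : I t -> `|w t - iterate n t| <= B * ratio ^+ n.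
  move=> It; have cw : `|iterate (n + j)%N t - iterate n t| @[j --> \oo] --> `|w t - iterate n t|.
    apply: cvg_norm; apply: cvgB; last exact: cvg_cst.
    have cit : iterate j t @[j --> \oo] --> w t by exact: cvg_it.
    rewrite -(cvg_shiftn n) in cit; apply: cvg_trans cit.
    by apply: near_eq_cvg; apply: nearW => j /=; rewrite addnC.
  by apply: (cvgr_to_le cw); apply: nearW => j; exact: hB.
have bw : bounded_continuous w.
  split; last by exists (B * ratio ^+ 0) => t It; have := wit 0%N t It; rewrite /iterate /= subr0.
  apply/continuous_withinP => x Ix e e0; have e30 : 0 < e / 3 by rewrite divr_gt0.
  have /cvgrPdist_lt/(_ _ e30)[N _ /(_ N (leqnn N)) /=] := cvg_ratio B.
  rewrite sub0r normrN ger0_norm; last by rewrite mulr_ge0// exprn_ge0// ltW.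
  move=> BN; have [cN _] := bounded_continuous_iterate N.
  move/continuous_withinP : cN => /(_ x Ix _ e30)[d d0 dP].
  exists d => // y Iy yxd.
  have h1 := le_lt_trans (wit N y Iy) BN; have h2 := le_lt_trans (wit N x Ix) BN.
  have h3 := dP y Iy yxd.
  move: h1 h2 h3; rewrite !ltr_norml => /andP[? ?] /andP[? ?] /andP[? ?].
  by apply/andP; split; lra.
exists w => // t It.
have H1 : iterate n.+1 t @[n --> \oo] --> w t.
  by rewrite (cvg_shiftS (fun n => iterate n t)); exact: cvg_it.
(* By the contraction estimate the images of the iterates converge to the image of their limit. *)
have H2 : iterate n.+1 t @[n --> \oo] --> picard w t.
  apply/cvgrPdist_lt => e e0.
  have /cvgrPdist_lt/(_ e e0)[N _ HN] := cvg_ratio (ratio * B).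
  exists N => // n Nn.
  apply: le_lt_trans (picard_dist bw (bounded_continuous_iterate n) (wit n) It) _.
  have := HN n Nn; rewrite /= sub0r normrN mulrA ger0_norm//.
  have rn : 0 <= ratio ^+ n by rewrite exprn_ge0// ltW.
  exact: mulr_ge0 (mulr_ge0 (ltW ratio_gt0) B0) rn.
by rewrite -(cvg_lim (@Rhausdorff R) H1) (cvg_lim (@Rhausdorff R) H2).
Qed.

Lemma picard_fixpoint_unique w w' : bounded_continuous w -> bounded_continuous w' ->
  (forall t, I t -> w t = picard w t) -> (forall t, I t -> w' t = picard w' t) ->
  forall t, I t -> w t = w' t.
Proof.
move=> bw bw' fw fw' t It.
have [_ [C hC]] := bw; have [_ [C' hC']] := bw'.
(* Each use of the two fixed-point equations gains a factor [ratio], so the distance is 0. *)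
have H n : forall t, I t -> `|w t - w' t| <= (C + C') * ratio ^+ n.
  elim: n => [|n IH] x Ix.
    rewrite expr0 mulr1 (le_trans (ler_normB _ _))// lerD//; [exact: hC|exact: hC'].
  by rewrite fw// fw'// exprS mulrCA; exact: picard_dist.
apply/eqP; rewrite -subr_eq0 -normr_le0.
apply: (cvgr_to_ge (cvg_ratio (C + C'))); apply: nearW => n; exact: H.
Qed.

Hypothesis f_ge0 : forall t x, t \in `[0, 1] -> 0 <= x -> 0 <= f t x.

Lemma source_ge0 w s : 0 <= source w s.
Proof.
rewrite /source /unit_cut; case: ifP => // s01; apply: f_ge0; last by rewrite le_max lexx.
by rewrite in_itv/=; case/andP: s01 => /ltW -> ->.
Qed.

End FixedPoint.

(** * Behaviour at 0, and Riemann-Liouville integrals as convolutions *)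

Section Regularity.
Context {R : realType}.
Notation mu := (@lebesgue_measure R).
Implicit Types (a b c t x y s : R) (f g u v : R -> R).

Local Notation I := (`]0, 1]%classic : set R).

Lemma is_derive_within_unit_itv f x l : I x ->
  is_derive_within I f x l -> is_derive_within `[0, 1] f x l.
Proof.
rewrite /= in_itv/= => /andP[x0 x1] /is_derive_withinP H; apply/is_derive_withinP => e /H[d d0 dP].
exists (Num.min d x) => [|y]; first by rewrite lt_min d0.
rewrite /= in_itv/= lt_min => /andP[y0 y1] yx /andP[yd yxx]; apply: dP => //.
rewrite /= in_itv/= y1 andbT lt_neqAle y0 andbT eq_sym; apply/eqP => y00.
by move: yxx; rewrite y00 sub0r normrN gtr0_norm// ltxx.
Qed.

Lemma continuous_unit_itv f : {within I, continuous f} ->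
  (forall e : R, 0 < e -> exists2 d : R, 0 < d & forall y, I y -> y < d -> `|f y - f 0| < e) ->
  {within `[0, 1], continuous f}.
Proof.
move=> /continuous_withinP cf f0; apply/continuous_withinP => x.
rewrite /= in_itv/= => /andP[x0 x1] e e0.
have [->|xn0] := eqVneq x 0.
  have [d d0 dP] := f0 e e0; exists d => // y; rewrite /= in_itv/= => /andP[y0 y1] yd.
  have [->|yn0] := eqVneq y 0; first by rewrite subrr normr0.
  apply: dP; first by rewrite /= in_itv/= lt_neqAle eq_sym yn0 y0.
  by apply: le_lt_trans yd; rewrite subr0 ler_norm.
have xp : 0 < x by rewrite lt_neqAle eq_sym xn0.
have Ix : I x by rewrite /= in_itv/= xp.
have [d d0 dP] := cf x Ix e e0.
exists (Num.min d x) => [|y]; first by rewrite lt_min d0.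
rewrite /= in_itv/= lt_min => /andP[y0 y1] /andP[yd yx]; apply: dP => //.
rewrite /= in_itv/= y1 andbT lt_neqAle y0 andbT eq_sym; apply/eqP => y00.
by move: yx; rewrite y00 sub0r normrN gtr0_norm// ltxx.
Qed.

Lemma powR_mul_tame a b u : tame b u -> exists2 C, 0 <= C &
  forall t, I t -> `|t `^ a * u t| <= C * t `^ (a + b - 1).
Proof.
move=> [_ _ [C hC]]; exists C.
  have := hC 1; rewrite /upow /unit_cut ltr01 lexx /= powR1 mulr1.
  exact: le_trans.
move=> t; rewrite /= in_itv/= => t01; have /andP[t0 t1] := t01.
have -> : a + b - 1 = a + (b - 1) by ring.
rewrite powRD ?(gt_eqF t0) ?implybT// normrM (ger0_norm (powR_ge0 _ _)) mulrCA.
rewrite ler_wpM2l ?powR_ge0//.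
by have := hC t; rewrite /upow /unit_cut t01.
Qed.

Lemma cvg0_of_le_linear f C : (forall t, I t -> `|f t| <= C * t) ->
  f t @[t --> 0^'+] --> (0 : R).
Proof.
move=> fC; have C0 : 0 <= C.
  by have := fC 1; rewrite /= in_itv/= ltr01 lexx mulr1 => /(_ isT); exact: le_trans.
apply/cvgrPdist_lt => e e0; near=> t; rewrite sub0r normrN.
have t0 : 0 < t by near: t; exact: nbhs_right_gt.
have t1 : t <= 1 by near: t; exact: nbhs_right_le.
apply: (@le_lt_trans _ _ (C * t)); first by apply: fC; rewrite /= in_itv/= t0.
apply: (@le_lt_trans _ _ ((C + 1) * t)); first by rewrite ler_pM2r// lerDl.
rewrite mulrC -ltr_pdivlMr ?ltr_wpDl//.
by near: t; apply: nbhs_right_lt; rewrite divr_gt0 ?ltr_wpDl.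
Unshelve. all: end_near. Qed.

(** Links the integral in [is_RL_derive] to the convolution algebra: it only sees [v] on $]0,t[$, so
    cutting [v] is harmless. *)
Lemma RL_integralE a b v t : 0 < b -> tame a (unit_cut v) -> I t ->
  \int[mu]_(s in `]0, t[) ((t - s) `^ (b - 1) * v s) =
  Gamma b * conv (gpow b) (unit_cut v) t.
Proof.
move=> b0 tv; rewrite /= in_itv/= => t01; have /andP[t0 t1] := t01.
have gb := Gamma_gt0 b0.
have i1 := conv_integrable t (tame_gpow b0) tv.
rewrite {1}/conv {1}/unit_cut t01 /rconv -(RintegralZl _ measurableT i1).
rewrite [LHS]Rintegral_mkcond /Rintegral; congr fine; apply: eq_integral => s _; congr EFin.
rewrite patchE mem_setE in_itv/=.
have [s0|s0] := ltP 0 s; last by rewrite /= (tame_supp tv) ?mulr0// ltNge s0.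
have [st|st] := ltP s t; last first.
  by rewrite /= (tame_supp (tame_gpow b0)) ?mul0r ?mulr0// subr_gt0 ltNge st.
have ts : 0 < t - s <= 1 by rewrite subr_gt0 st lerBlDr (le_trans t1)// lerDl ltW.
rewrite /= (gpowE _ ts) /unit_cut s0 (le_trans (ltW st) t1) /=.
by rewrite mulrA [Gamma b * _]mulrC divfK// gt_eqF.
Qed.

End Regularity.

(** * The linear equation: regularity of solutions and converse *)

Section SolutionRegularity.
Context {R : realType} (alpha lambda : R).
Hypothesis alpha12 : 1 < alpha <= 2.
Implicit Types (c t x y s : R) (F u v : R -> R).

Local Notation I := (`]0, 1]%classic : set R).
Local Notation E := (ml alpha lambda alpha).
Local Notation E' := (ml alpha lambda (alpha - 1)).

Let alpha1 : 1 <= alpha. Proof. by case/andP: alpha12 => /ltW. Qed.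
Let alpha0 : 0 < alpha. Proof. exact: lt_le_trans ltr01 alpha1. Qed.
Let alpham1 : 0 < alpha - 1. Proof. by case/andP: alpha12; rewrite subr_gt0. Qed.

(** For $\lambda<0$ a zero would contradict the maximality of [lambda1]; for $\lambda\ge0$ the
    series has nonnegative terms and first term $1/\Gamma(\alpha-1)>0$. *)
Lemma mittag_leffler_neq0 lambda1 :
  largest_negative_zero (mittag_leffler alpha (alpha - 1)) lambda1 ->
  lambda1 < lambda -> mittag_leffler alpha (alpha - 1) lambda != 0.
Proof.
move=> [_ _ maxl] ll; have [l0|l0] := ltP lambda 0.
  by apply/eqP => /(maxl _ l0); rewrite leNgt ll.
have cv := @is_cvg_ml_series _ _ alpha1 (alpha - 1) lambda alpham1.
have g0 := Gamma_gt0 alpham1.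
rewrite gt_eqF//; apply: (@lt_le_trans _ _ (series (ml_coeff alpha (alpha - 1) lambda) 1)).
  rewrite /series /= big_nat1 /ml_coeff expr0 mulr0 add0r mul1r invr_gt0//.
apply: (nondecreasing_cvgn_le _ cv); apply: nondecreasing_series => k _ _.
exact: divr_ge0 (exprn_ge0 k l0) (ltW (Gamma_gt0 (Gamma_arg_gt0 alpha1 k alpham1))).
Qed.

Lemma weightedE u t : I t -> weighted alpha u t = t `^ (2 - alpha) * u t.
Proof.
by rewrite /= in_itv/= => /andP[t0 _]; rewrite /weighted gt_eqF.
Qed.

Lemma weighted_tame_linear u : tame alpha u -> exists C, forall t, I t ->
  `|t `^ (2 - alpha) * u t| <= C * t.
Proof.
move=> tu; have [C C0 hC] := powR_mul_tame (2 - alpha) tu; exists C => t It.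
rewrite (le_trans (hC t It))// (_ : 2 - alpha + alpha - 1 = 1); last by ring.
by rewrite powRr1//; move: It; rewrite /= in_itv/= => /andP[/ltW].
Qed.

Lemma weighted_cvg0 u : tame alpha u -> t `^ (2 - alpha) * u t @[t --> 0^'+] --> (0 : R).
Proof. by move=> tu; have [C] := weighted_tame_linear tu; exact: cvg0_of_le_linear. Qed.

Lemma weighted0 u : t `^ (2 - alpha) * u t @[t --> 0^'+] --> (0 : R) -> weighted alpha u 0 = 0.
Proof. by move=> u0; rewrite /weighted eqxx; exact: (cvg_lim (@Rhausdorff R) u0). Qed.

(** Away from 0 this is the product rule, but the factor $t^{1-\alpha}$ is unbounded at 0. There $u$
    behaves like $l\,t^{\alpha-1}$, so $t^{2-\alpha}u$ behaves like $l\,t$. *)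
Lemma solution_C1 c F (u := c *: E - conv E F) : tame 1 F -> {within I, continuous F} ->
  C1_on `[0, 1] (weighted alpha u).
Proof.
move=> tF cF.
have tu : tame alpha u by exact: tame_solution.
have u0 : weighted alpha u 0 = 0 by apply: weighted0; exact: weighted_cvg0.
pose v := velocity alpha lambda c F.
pose g t := (2 - alpha) * t `^ (1 - alpha) * u t + t `^ (2 - alpha) * v t.
(* The leading coefficient of [u] at 0, hence the derivative there of the weighted function. *)
pose l := c / Gamma alpha.
pose g1 t := if t == 0 then l else g t.
have ga := Gamma_gt0 alpha0; have gam := Gamma_gt0 alpham1.
have GE : Gamma alpha = (alpha - 1) * Gamma (alpha - 1) by rewrite -(GammaS alpham1) subrK.
have g1E t : I t -> g1 t = g t.
  by rewrite /= in_itv/= => /andP[t0 _]; rewrite /g1 gt_eqF.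
have ww x : I x -> is_derive_within I (fun t => t `^ (2 - alpha) * u t) x (g x).
  move=> Ix; apply: is_derive_withinM; last exact: solution_derive.
  apply: is_derive_is_derive_within.
  have -> : 1 - alpha = 2 - alpha - 1 by ring.
  by apply: is_derive1_powR; move: Ix; rewrite /= in_itv/= => /andP[].
have [C1 C10 hr] := powR_mul_tame (2 - alpha) (solution_expansion lambda alpha12 c tF).
have [C2 C20 hr'] := powR_mul_tame (2 - alpha) (velocity_expansion lambda alpha12 c tF).
have [C3 C30 hr3] := powR_mul_tame (1 - alpha) (solution_expansion lambda alpha12 c tF).
have pE a b t : 0 < t -> t `^ a * t `^ b = t `^ (a + b).
  by move=> t0; rewrite powRD// (gt_eqF t0) implybT.
have uE t : I t -> u t = l * t `^ (alpha - 1) + (u - c *: gpow alpha) t.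
  rewrite /= in_itv/= => t01; rewrite fun_subE fun_scaleE (gpowE _ t01) /l.
  by ring.
have vE t : I t -> v t = c / Gamma (alpha - 1) * t `^ (alpha - 2) + (v - c *: gpow (alpha - 1)) t.
  rewrite /= in_itv/= => t01; rewrite fun_subE fun_scaleE (gpowE _ t01).
  by rewrite (_ : alpha - 1 - 1 = alpha - 2); ring.
(* The quadratic remainder gives the derivative at 0. *)
have wl t : I t -> `|t `^ (2 - alpha) * u t - l * t| <= C1 * t ^+ 2.
  move=> It; rewrite (uE t It); have t0 : 0 < t by move: It; rewrite /= in_itv/= => /andP[].
  have -> : t `^ (2 - alpha) * (l * t `^ (alpha - 1) + (u - c *: gpow alpha) t) - l * t =
      t `^ (2 - alpha) * (u - c *: gpow alpha) t.
    have e1 : t `^ (2 - alpha) * t `^ (alpha - 1) = t.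
      by rewrite pE// (_ : _ + _ = 1) ?powRr1 ?ltW//; ring.
    move: ((u - c *: gpow alpha) t) => r.
    transitivity (l * (t `^ (2 - alpha) * t `^ (alpha - 1)) + t `^ (2 - alpha) * r - l * t).
      by ring.
    by rewrite e1; ring.
  apply: le_trans (hr t It) _; rewrite (_ : _ + _ - 1 = 2%:R); last by ring.
  by rewrite powR_mulrn// ltW.
(* Continuity of the derivative at 0: the two leading terms are $(2-\alpha)l$ and $(\alpha-1)l$,
   with sum $l$. *)
have gl t : I t -> `|g t - l| <= ((2 - alpha) * C3 + C2) * t.
  move=> It; have t0 : 0 < t by move: It; rewrite /= in_itv/= => /andP[].
  have -> : g t - l = (2 - alpha) * (t `^ (1 - alpha) * (u - c *: gpow alpha) t) +
       t `^ (2 - alpha) * (v - c *: gpow (alpha - 1)) t.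
    rewrite /g {1}(uE t It) {1}(vE t It).
    have e1 : t `^ (1 - alpha) * t `^ (alpha - 1) = 1.
      rewrite pE// (_ : 1 - alpha + (alpha - 1) = 0) ?powRr0//.
      by ring.
    have e2 : t `^ (2 - alpha) * t `^ (alpha - 2) = 1.
      rewrite pE// (_ : 2 - alpha + (alpha - 2) = 0) ?powRr0//.
      by ring.
    have e3 : l * (alpha - 1) = c / Gamma (alpha - 1).
      by rewrite /l GE; field; rewrite !gt_eqF.
    move: ((u - c *: gpow alpha) t) ((v - c *: gpow (alpha - 1)) t) => r r'.
    transitivity ((2 - alpha) * l * (t `^ (1 - alpha) * t `^ (alpha - 1)) +
       (2 - alpha) * (t `^ (1 - alpha) * r) +
       c / Gamma (alpha - 1) * (t `^ (2 - alpha) * t `^ (alpha - 2)) + t `^ (2 - alpha) * r' - l).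
      by ring.
    by rewrite e1 e2 -e3; ring.
  apply: (le_trans (ler_normD _ _)); rewrite (mulrDl ((2 - alpha) * C3)); apply: lerD.
    rewrite normrM ger0_norm; last by rewrite subr_ge0; case/andP: alpha12.
    rewrite -mulrA; apply: ler_wpM2l; first by rewrite subr_ge0; case/andP: alpha12.
    apply: le_trans (hr3 t It) _; rewrite (_ : _ + _ - 1 = 1); last by ring.
    by rewrite powRr1// ltW.
  apply: le_trans (hr' t It) _; rewrite (_ : _ + _ - 1 = 1); last by ring.
  by rewrite powRr1// ltW.
exists g1.
- move=> x; rewrite /= in_itv/= => /andP[x0 x1].
  have [x00|xn0] := eqVneq x 0; last first.
    have Ix : I x by rewrite /= in_itv/= lt_neqAle eq_sym xn0 x0.
    rewrite g1E//; apply: is_derive_within_unit_itv => //.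
    by apply: is_derive_within_ext (ww x Ix) => // y Iy; rewrite weightedE.
  rewrite x00 /g1 eqxx; apply/is_derive_withinP => e e0.
  have C11 : 0 < C1 + 1 by rewrite ltr_wpDl.
  exists (e / (C1 + 1)) => [|y]; first exact: divr_gt0.
  rewrite /= in_itv/= => /andP[y0 y1] yn0; rewrite subr0 => ye.
  have yp : 0 < y by rewrite lt_neqAle eq_sym yn0.
  have Iy : I y by rewrite /= in_itv/= yp.
  rewrite u0 subr0 (weightedE _ Iy).
  have -> : y `^ (2 - alpha) * u y / y - l = (y `^ (2 - alpha) * u y - l * y) / y.
    by field.
  rewrite normrM normfV (gtr0_norm yp) ltr_pdivrMr//.
  apply: (le_lt_trans (wl y Iy)); rewrite expr2 mulrA ltr_pM2r//.
  rewrite (gtr0_norm yp) ltr_pdivlMr// mulrC in ye.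
  by apply: le_lt_trans ye; rewrite ler_pM2r// lerDl.
- apply: continuous_unit_itv.
    have pc a : {within I, continuous (fun t => t `^ a)}.
      apply: (@is_derive_within_continuous _ _ _ (fun x => a * x `^ (a - 1))) => x Ix.
      apply: is_derive_is_derive_within; apply: is_derive1_powR.
      by move: Ix; rewrite /= in_itv/= => /andP[].
    have cu : {within I, continuous u}.
      apply: (@is_derive_within_continuous _ _ _ (velocity alpha lambda c F)) => x Ix.
  exact: solution_derive.
    have cv : {within I, continuous v} by exact: continuous_velocity.
    have cg : {within I, continuous g}.
      move=> x; apply: cvgD; apply: cvgM; last 1 first.
      - exact: cv.
      - by apply: cvgM; [exact: cvg_cst|exact: pc].
      - exact: cu.
      - exact: pc.
    apply/continuous_withinP => x Ix e e0; move/continuous_withinP : cg => /(_ x Ix e e0)[d d0 dP].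
    by exists d => // y Iy yxd; rewrite !g1E//; exact: dP.
  move=> e e0; set C := (2 - alpha) * C3 + C2 in gl.
  have C0 : 0 <= C by rewrite addr_ge0// mulr_ge0// subr_ge0; case/andP: alpha12.
  have C11 : 0 < C + 1 by rewrite ltr_wpDl.
  exists (e / (C + 1)) => [|y Iy ye]; first exact: divr_gt0.
  rewrite g1E// {1}/g1 eqxx; apply: (le_lt_trans (gl y Iy)).
  have yp : 0 < y by move: Iy; rewrite /= in_itv/= => /andP[].
  rewrite ltr_pdivlMr// mulrC in ye.
  by apply: le_lt_trans ye; rewrite ler_pM2r// lerDl.
Qed.

Lemma C1_weighted_continuous u : C1_on `[0, 1] (weighted alpha u) -> weighted_continuous alpha u.
Proof. by move=> [g hg _]; exact: is_derive_within_continuous hg. Qed.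

(** The order of the inner integral stays positive even at $\alpha=2$, where the integer is 3. *)
Lemma truncn_order (N := Num.truncn alpha) :
  0 < N.+1%:R - alpha /\ N.+1%:R - alpha + alpha = N.+1%:R.
Proof. by split; rewrite ?subrK// subr_gt0 /N truncnS_gt. Qed.

Lemma solution_RL c F (u := c *: E - conv E F) Du : tame 1 F -> {within I, continuous F} ->
  (forall t, I t -> Du t = lambda * u t - F t) -> is_RL_derive alpha u Du.
Proof.
move=> tF cF DuE; rewrite /is_RL_derive; set N := Num.truncn alpha.
have [b0 ba] := truncn_order; rewrite -/N in b0 ba; set b := N.+1%:R - alpha in b0 ba *.
have tu : tame alpha u by exact: tame_solution.
have tu1 : tame 1 u by apply: tame_le tu; rewrite ltr01.
have cu : {within I, continuous u}.
  apply: (@is_derive_within_continuous _ _ _ (velocity alpha lambda c F)) => x Ix.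
  exact: solution_derive.
pose G := lambda *: u - F.
have tG : tame 1 G by apply: tameB => //; exact: tameZ.
have cG : {within I, continuous G} by apply: continuousB_within => //; exact: continuousZ_within.
have uG : u = c *: gpow alpha + conv (gpow alpha) G by exact: volterra_solution.
have tp := tame_gpow alpha0; have tb := tame_gpow b0.
have tpG : tame alpha (conv (gpow alpha) G).
  by apply: tame_le (tame_conv tp tG); rewrite alpha0 lerDl ler01.
(* The fractional orders [b] and [alpha] add up to an integer, so the required derivatives are those
   of iterated primitives. *)
have bu : conv (gpow b) u = c *: gpow N.+1%:R + conv (gpow N.+1%:R) G.
  rewrite {1}uG (convDr tb (tameZ c tp) tpG) (convZr c tb tp).
  rewrite -(conv_assoc tb tp tG) (conv_gpow b0 alpha0) ba; reflexivity.
have cutu : unit_cut u = u.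
  apply/funext => t; rewrite /unit_cut; case: ifP => // t01.
  by rewrite (tame_supp tu).
have gb := Gamma_gt0 b0.
exists (Gamma b *: G).
  apply: (is_derive_n_within_ext (f := Gamma b *: conv (gpow b) u) (h := Gamma b *: G)).
  - move=> t It; rewrite fun_scaleE; have tcu : tame alpha (unit_cut u) by rewrite cutu.
    rewrite (RL_integralE b0 tcu It) cutu; reflexivity.
  - by move=> t _; reflexivity.
  - by apply: is_derive_n_withinZ; rewrite bu; exact: gpow_n_conv_derive.
move=> t It; rewrite DuE// fun_scaleE mulrA mulVf ?mul1r ?gt_eqF//.
Qed.

Lemma RL_solution v Du F : tame alpha (unit_cut v) -> {within I, continuous v} ->
  tame 1 F -> {within I, continuous F} ->
  (forall t, I t -> Du t = lambda * v t - F t) -> is_RL_derive alpha v Du ->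
  exists c, unit_cut v = c *: E - conv E F.
Proof.
move=> tv cv tF cF DuE [h]; set N := Num.truncn alpha.
have [b0 ba] := truncn_order; rewrite -/N in b0 ba; set b := N.+1%:R - alpha in b0 ba *.
move=> Hh Dh.
have gb := Gamma_gt0 b0.
have cutE t : I t -> unit_cut v t = v t by rewrite /= in_itv/= /unit_cut => ->.
pose G := lambda *: unit_cut v - F.
have tv1 : tame 1 (unit_cut v) by apply: tame_le tv; rewrite ltr01.
have cv' := unit_cut_continuous cv.
have tG : tame 1 G by apply: tameB => //; exact: tameZ.
have cG : {within I, continuous G} by apply: continuousB_within => //; exact: continuousZ_within.
have H : is_derive_n_within I N.+1 (conv (gpow b) (unit_cut v)) G.
  have := is_derive_n_withinZ (Gamma b)^-1 Hh.
  apply: is_derive_n_within_ext => t It.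
    by rewrite fun_scaleE (RL_integralE b0 tv It) mulrA mulVf ?mul1r ?gt_eqF.
  by rewrite fun_scaleE -Dh// DuE// /G fun_subE fun_scaleE cutE.
have [c vE] := RL_inversion alpha0 b0 alpha1 tv cv' tG cG H.
by exists c; exact: volterra_resolvent.
Qed.

(** A function differentiable at 0 with value 0 there is $O(t)$; dividing by $t^{2-\alpha}$ gives
    $v=O(t^{\alpha-1})$, the growth required by the inversion. *)
Lemma C1_weighted_tame v : C1_on `[0, 1] (weighted alpha v) -> weighted alpha v 0 = 0 ->
  {within I, continuous v} /\ tame alpha (unit_cut v).
Proof.
move=> hC1 v0; have wc := C1_weighted_continuous hC1.
have [g hg _] := hC1; set w := weighted alpha v in hg wc v0.
have vE t : I t -> v t = t `^ (alpha - 2) * w t.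
  move=> It; rewrite /w weightedE// mulrA.
  have t0 : 0 < t by move: It; rewrite /= in_itv/= => /andP[].
  rewrite -powRD ?(gt_eqF t0) ?implybT// (_ : alpha - 2 + (2 - alpha) = 0) ?powRr0 ?mul1r//.
  by ring.
have sub : I `<=` `[0, 1] by move=> x; rewrite /= !in_itv/= => /andP[/ltW -> ->].
have cv : {within I, continuous v}.
  have cw : {within I, continuous w} by exact: continuous_subspaceW sub wc.
  have pc a : {within I, continuous (fun t : R => t `^ a)}.
    apply: (@is_derive_within_continuous _ _ _ (fun x => a * x `^ (a - 1))) => x Ix.
    apply: is_derive_is_derive_within; apply: is_derive1_powR.
    by move: Ix; rewrite /= in_itv/= => /andP[].
  have cvw : {within I, continuous (fun t => t `^ (alpha - 2) * w t)}.
    by move=> x; apply: cvgM; [exact: pc|exact: cw].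
  apply/continuous_withinP => x Ix e e0; move/continuous_withinP : cvw => /(_ x Ix e e0)[d d0 dP].
  by exists d => // y Iy yxd; rewrite !vE//; exact: dP.
split => //; split => //.
  by apply: measurable_unit_cut; exact: subspace_continuous_measurable_fun.
have I0 : (`[0, 1]%classic : set R) 0 by rewrite /= in_itv/= lexx ler01.
have [d d0 dP] := (is_derive_withinP _ _ _ _).1 (hg 0 I0) 1 ltr01.
have cnw : {within `[0, 1], continuous (fun t => `|w t|)}.
  by move=> x; apply: cvg_norm; exact: wc.
have [z _ zmax] := EVT_max ler01 cnw.
(* The first summand serves for $t<d$, by the difference quotient at 0; the second for $t\ge d$,
   where $t/d\ge1$. *)
pose C := (`|g 0| + 1) + `|w z| / d.
have wC t : I t -> `|w t| <= C * t.
  move=> It; move: (It); rewrite /= in_itv/= => /andP[t0 t1].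
  have wz0 : 0 <= `|w z| / d by rewrite divr_ge0// ltW.
  have [td|td] := ltP t d.
    have tn0 : t != 0 by rewrite gt_eqF.
    have := dP t (sub _ It) tn0; rewrite v0 !subr0 gtr0_norm// => /(_ td) h.
    have : `|w t / t| <= `|g 0| + 1.
      rewrite -[w t / t](subrK (g 0)) addrC (le_trans (ler_normD _ _))//.
      by rewrite lerD2l ltW.
    rewrite normrM normfV (gtr0_norm t0) ler_pdivrMr// => /le_trans; apply.
    by rewrite ler_pM2r// lerDl.
  apply: (@le_trans _ _ `|w z|); first by apply: zmax; rewrite in_itv/= (ltW t0).
  apply: (@le_trans _ _ (`|w z| / d * t)).
    by rewrite -mulrA ler_peMr// mulrC ler_pdivlMr// mul1r.
  by rewrite ler_pM2r// lerDr addr_ge0.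
exists C => t; rewrite /upow /unit_cut; case: ifP => t01; last by rewrite normr0 mulr0.
have It : I t by rewrite /= in_itv/=.
have /andP[t0 t1] := t01.
rewrite vE// normrM (ger0_norm (powR_ge0 _ _)).
apply: (@le_trans _ _ (t `^ (alpha - 2) * (C * t))).
  by rewrite ler_wpM2l ?powR_ge0// wC.
rewrite mulrCA ler_wpM2l//.
  by rewrite !addr_ge0// divr_ge0// ltW.
rewrite -{2}(powRr1 (ltW t0)) -powRD ?(gt_eqF t0) ?implybT//.
by rewrite (_ : alpha - 2 + 1 = alpha - 1)//; ring.
Qed.

End SolutionRegularity.

Section WeightedNorm.
Context {R : realType} (alpha : R).
Implicit Types (t : R) (u : R -> R).

Local Notation I := (`]0, 1]%classic : set R).

Lemma weighted_norm_le u B : weighted alpha u 0 = 0 ->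
  (forall t, I t -> `|t `^ (2 - alpha) * u t| <= B) -> weighted_norm alpha u <= B.
Proof.
move=> u0 uB; have I1 : I 1 by rewrite /= in_itv/= ltr01 lexx.
have B0 : 0 <= B by exact: le_trans (uB 1 I1).
apply: ge_sup.
  by exists `|weighted alpha u 1|, 1 => //=; rewrite in_itv/= ler01 lexx.
move=> _ [t + <-]; rewrite /= in_itv/= => /andP[t0 t1].
have [->|tn0] := eqVneq t 0; first by rewrite u0 normr0.
have It : I t by rewrite /= in_itv/= lt_neqAle eq_sym tn0 t0.
by rewrite weightedE//; exact: uB.
Qed.

Lemma weighted_norm_ge0 u : weighted_continuous alpha u -> 0 <= weighted_norm alpha u.
Proof.
move=> wc; have cn : {within `[0, 1], continuous (fun t => `|weighted alpha u t|)}.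
  by move=> x; apply: cvg_norm; exact: wc.
have [z z01 zmax] := EVT_max ler01 cn.
apply: (le_trans (normr_ge0 (weighted alpha u z))); apply: ub_le_sup.
  by exists `|weighted alpha u z| => _ [t t01 <-]; exact: zmax.
by exists z.
Qed.

End WeightedNorm.

(** * Fixed points and solutions in the cone *)

Section NonlinearProblem.
Context {R : realType} (alpha lambda : R).
Hypothesis alpha12 : 1 < alpha <= 2.
Implicit Types (c t x y s : R) (F G u v w : R -> R).

Local Notation I := (`]0, 1]%classic : set R).
Local Notation E' := (ml alpha lambda (alpha - 1)).

Hypothesis E'1_neq0 : E' 1 != 0.
Context (m : R -> R) (M : R).
Hypothesis M_gt0 : 0 < M.
Hypothesis m_ge0 : forall t, 0 < t < 1 -> 0 <= m t.
Hypothesis m_cont : {within I, continuous m}.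
Hypothesis hmM : forall t s, 0 < t < 1 -> 0 < s < 1 ->
  m t * weight alpha s <= t `^ (2 - alpha) * kernel alpha lambda t s <= M * weight alpha s.

Lemma solop_weighted_bounds F t : tame 1 F -> {within I, continuous F} ->
  (forall s, 0 <= F s) -> I t ->
  m t * wint alpha F <= t `^ (2 - alpha) * solop alpha lambda F t <= M * wint alpha F.
Proof.
move=> tF cF F0; have cw := continuous_solop_weighted (lambda := lambda) alpha12 tF cF.
have lo x : 0 < x < 1 -> m x * wint alpha F <= x `^ (2 - alpha) * solop alpha lambda F x.
  exact: (solop_ge alpha12 hmM tF F0).
have up x : 0 < x < 1 -> x `^ (2 - alpha) * solop alpha lambda F x <= M * wint alpha F.
  move=> x01; apply: le_trans (ler_norm _) _.
  apply: (solop_norm_le alpha12 m_ge0 hmM tF tF _ x01) => s.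
  by rewrite ger0_norm// F0.
rewrite /= in_itv/= => /andP[t0]; rewrite le_eqVlt => /predU1P[->|t1]; last first.
  by rewrite lo ?up ?t0 ?t1.
apply/andP; split; last first.
  by apply: (continuous_le_at1 (F := fun t => t `^ (2 - alpha) * solop alpha lambda F t)).
rewrite -subr_le0.
apply: (continuous_le_at1 (F := fun t => m t * wint alpha F - t `^ (2 - alpha) * solop alpha lambda F t)).
  move=> x; apply: cvgB; last exact: cw.
  by apply: cvgM; [exact: m_cont|exact: cvg_cst].
by move=> x x01; rewrite subr_le0 lo.
Qed.

Context (f : R -> R -> R) (K : R).
Hypothesis f_cont : {within `[0, 1] `*` `[0, +oo[,
  continuous (fun p : R * R => f p.1 p.2)}.
Hypothesis K_gt0 : 0 < K.
Hypothesis f_lip : forall t x y, t \in `[0, 1] -> 0 <= x -> 0 <= y ->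
     `|f t x - f t y| <= K * `|x - y|.
Hypothesis f_ge0 : forall t x, t \in `[0, 1] -> 0 <= x -> 0 <= f t x.

Lemma sourceE w t : I t -> 0 <= w t -> source f w t = f t (w t).
Proof. by rewrite /= in_itv/= /source /unit_cut => -> /max_idPr ->. Qed.

Hypothesis m_ge0_I : forall t, I t -> 0 <= m t.

Section Existence.
Variable w : R -> R.
Hypothesis bw : bounded_continuous w.
Hypothesis fw : forall t, I t -> w t = picard alpha lambda f w t.

Let F := source f w.
Let u := solop alpha lambda F.
Let tF : tame 1 F. Proof. exact: tame_source f_cont K_gt0 f_lip w bw. Qed.
Let cF : {within I, continuous F}.
Proof. by apply: source_continuous_I. Qed.
Let F_ge0 s : 0 <= F s. Proof. exact: source_ge0. Qed.
Let wint_ge0 : 0 <= wint alpha F.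
Proof.
apply: Rintegral_ge0 => // s _; exact: mulr_ge0 (weight_ge0 _ _) (F_ge0 s).
Qed.

(** The lower bound on the kernel forces this sign, so the truncation inside [source] is inactive at
    a fixed point. *)
Let w_ge0 t : I t -> 0 <= w t.
Proof.
move=> It; rewrite fw//; have /andP[h _] := solop_weighted_bounds tF cF F_ge0 It.
by apply: le_trans h; rewrite mulr_ge0// m_ge0_I.
Qed.

Lemma picard_solution : is_solution alpha lambda f u.
Proof.
have tu := tame_solop lambda alpha12 tF.
split.
- exact: solution_C1.
- exists (fun t => lambda * u t - F t).
    by apply: (solution_RL alpha12 tF cF) => t _; reflexivity.
  move=> t t01; have It : I t by [].
  have -> : t `^ (2 - alpha) * u t = w t by rewrite fw.
  rewrite /F sourceE ?w_ge0//.
  by move: (lambda * u t) (f t (w t)) => p q; ring.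
- exact: weighted_cvg0.
- have I1 : I 1 by rewrite /= in_itv/= ltr01 lexx.
  have h : is_derive_within I u 1 (velocity alpha lambda (conv E' F 1 / E' 1) F 1).
    exact: solution_derive.
  by move: h; rewrite (velocity_solop F E'1_neq0).
Qed.

(** The weighted norm is at most [M * wint alpha F], while the weighted value at [t] is at least
    [m t * wint alpha F]: the quotient of the two constants is the $m/M$ of the cone. *)
Lemma picard_cone : cone alpha (fun t => t `^ (alpha - 2) * (m t / M)) u.
Proof.
have tu := tame_solop lambda alpha12 tF.
have u0 : weighted alpha u 0 = 0 by apply: weighted0; exact: weighted_cvg0.
split; first by apply: C1_weighted_continuous; case: picard_solution.
move=> t t01; have It : I t by [].
have t0 : 0 < t by move: It; rewrite /= in_itv/= => /andP[].
have nle : weighted_norm alpha u <= M * wint alpha F.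
  apply: weighted_norm_le => // s Is.
  have /andP[lo hi] := solop_weighted_bounds tF cF F_ge0 Is.
  rewrite ger0_norm//; apply: le_trans lo.
  by rewrite mulr_ge0// m_ge0_I.
have /andP[lo _] := solop_weighted_bounds tF cF F_ge0 It.
have p0 : 0 < t `^ (2 - alpha) by rewrite powR_gt0.
have -> : t `^ (alpha - 2) = (t `^ (2 - alpha))^-1 by rewrite -powRN opprB.
rewrite -mulrA ler_pdivrMl//; apply: le_trans lo.
rewrite -mulrA; apply: ler_wpM2l; first exact: m_ge0_I.
by rewrite ler_pdivrMl.
Qed.

End Existence.

Lemma solution_picard v : is_solution alpha lambda f v ->
  cone alpha (fun t => t `^ (alpha - 2) * (m t / M)) v ->
  let w := fun t => t `^ (2 - alpha) * v t in
  bounded_continuous w /\ forall t, I t -> w t = picard alpha lambda f w t.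
Proof.
move=> [vC1 [Du hDu eqDu] v0 v1] [wc hcone] w.
have w0 := weighted0 v0.
have [cv tv] := C1_weighted_tame alpha12 vC1 w0.
have wI t : I t -> w t = weighted alpha v t by move=> It; rewrite weightedE.
have bw : bounded_continuous w.
  split.
    have sub : I `<=` `[0, 1] by move=> x; rewrite /= !in_itv/= => /andP[/ltW -> ->].
    have cw := continuous_subspaceW sub wc.
    apply/continuous_withinP => x Ix e e0.
    move/continuous_withinP : cw => /(_ x Ix e e0)[d d0 dP].
    by exists d => // y Iy yxd; rewrite !wI//; exact: dP.
  have [C wC] := weighted_tame_linear tv; exists `|C| => t It.
  have := wC t It; rewrite /w; move: (It); rewrite /= in_itv/= /unit_cut => t01.
  rewrite t01 => /le_trans; apply; have /andP[t0 t1] := t01.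
  rewrite (le_trans (ler_norm _))// normrM (gtr0_norm t0).
  by rewrite ler_piMr.
have w_ge0 t : I t -> 0 <= w t.
  move=> It; rewrite /w mulr_ge0 ?powR_ge0//; apply: le_trans (hcone t It).
  rewrite mulr_ge0 ?weighted_norm_ge0// mulr_ge0 ?powR_ge0//.
  by rewrite divr_ge0 ?m_ge0_I// ltW.
split => //.
have tF := tame_source f_cont K_gt0 f_lip bw; have cF := source_continuous_I f_cont bw.
have DuE t : I t -> Du t = lambda * v t - source f w t.
  move=> It; have := eqDu t It; rewrite -/(w t) sourceE ?w_ge0//.
  move: (Du t) (lambda * v t) (f t (w t)) => p q r h.
  by rewrite -[RHS]addr0 -h; ring.
have [c vE] := RL_solution alpha12 tv cv tF cF DuE hDu.
have I1 : I 1 by rewrite /= in_itv/= ltr01 lexx.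
have cutE t : I t -> unit_cut v t = v t by rewrite /= in_itv/= /unit_cut => ->.
(* Left derivatives at 1 are unique, so the boundary condition on [v] becomes an equation for
   [c]. *)
have vel0 : velocity alpha lambda c (source f w) 1 = 0.
  have h1 : is_derive_within I (unit_cut v) 1 (velocity alpha lambda c (source f w) 1).
    by rewrite vE; exact: solution_derive.
  have h2 : is_derive_within I (unit_cut v) 1 0.
    by apply: (is_derive_within_ext (f := v)) => // y Iy; rewrite cutE.
  exact: is_derive_within_uniq I1 h1 h2.
move=> t It; rewrite /picard -(solop_unique E'1_neq0 vel0) -vE cutE//.
Qed.

End NonlinearProblem.

Theorem theorem14 (R : realType) (alpha lambda1 lambda M K : R)
  (m : R -> R) (f : R -> R -> R)
  (halpha : 1 < alpha <= 2)
  (hlambda1 : largest_negative_zero (mittag_leffler alpha (alpha - 1)) lambda1)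
  (hlambda : lambda1 < lambda)
  (hM : 0 < M)
  (m_cont : {within `[0, 1], continuous m})
  (m_0 : m 0 = 0)
  (m_gt0 : forall t, t \in `]0, 1] -> 0 < m t)
  (hmM : forall t s, t \in `]0, 1[ -> s \in `]0, 1[ ->
     m t <= t `^ (2 - alpha) * green alpha lambda t s
            / (s * (1 - s) `^ (alpha - 2)) <= M)
  (f_cont : {within `[0, 1] `*` `[0, +oo[,
               continuous (fun p : R * R => f p.1 p.2)})
  (f_ge0 : forall t x, t \in `[0, 1] -> 0 <= x -> 0 <= f t x)
  (hK : 0 < K)
  (f_lip : forall t x y, t \in `[0, 1] -> 0 <= x -> 0 <= y ->
     `|f t x - f t y| <= K * `|x - y|)
  (hKM : K * M / (alpha * (alpha - 1)) < 1) :
  let u0 := fun t : R => t `^ (alpha - 2) * (m t / M) in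
  exists u : R -> R,
    [/\ is_solution alpha lambda f u,
        cone alpha u0 u
      & forall v : R -> R, is_solution alpha lambda f v -> cone alpha u0 v ->
          forall t, t \in `]0, 1] -> v t = u t].
Proof.
(* This is where $\lambda>\lambda_1^*$ enters. *)
have E1 : ml alpha lambda (alpha - 1) 1 != 0.
  by rewrite ml_pred_at1; exact: mittag_leffler_neq0 halpha lambda1 hlambda1 hlambda.
have m0I t : (`]0, 1]%classic : set R) t -> 0 <= m t by move=> /m_gt0/ltW.
have m0 t : 0 < t < 1 -> 0 <= m t.
  by move=> /andP[t0 t1]; apply: m0I; rewrite /= in_itv/= t0 ltW.
have mI : {within (`]0, 1]%classic : set R), continuous m}.
  apply: continuous_subspaceW m_cont.
  by move=> x; rewrite /= !in_itv/= => /andP[/ltW -> ->].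
have kM t s : 0 < t < 1 -> 0 < s < 1 ->
    m t * weight alpha s <= t `^ (2 - alpha) * kernel alpha lambda t s <= M * weight alpha s.
  move=> t01 s01; have /andP[t0 t1] := t01; have /andP[s0 s1] := s01.
  have t01' : 0 < t <= 1 by rewrite t0 ltW.
  rewrite (kernel_green _ halpha t01' s01) (weightE _ s01).
  have W : 0 < s * (1 - s) `^ (alpha - 2) by rewrite mulr_gt0 ?powR_gt0 ?subr_gt0.
  have /andP[h1 h2] : _ := hmM t s t01 s01.
  by rewrite -(ler_pdivlMr _ _ W) h1 -(ler_pdivrMr _ _ W).
have [w bw fw] := picard_fixpoint halpha hM m0 kM f_cont hK f_lip hKM.
move=> u0; exists (solop alpha lambda (source f w)); split.
- exact: (picard_solution halpha E1 m0 mI kM f_cont hK f_lip f_ge0 m0I bw fw).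
- exact: (picard_cone halpha E1 hM m0 mI kM f_cont hK f_lip f_ge0 m0I bw fw).
move=> v sv cv t t01.
have [bv fv] := solution_picard halpha E1 hM f_cont hK f_lip m0I sv cv.
have := picard_fixpoint_unique halpha hM m0 kM f_cont hK f_lip hKM bv bw fv fw t01.
(* The fixed points are weighted solutions; the weight is nonzero on $]0,1]$ and cancels. *)
rewrite (fw t t01) /picard => /mulfI; apply.
by rewrite gt_eqF// powR_gt0//; move: t01; rewrite in_itv/= => /andP[].
Qed.
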